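(* Let $\mathbb{K}$ be an algebraically closed field of characteristic $0$. A Hilbert-Samuel sequence $\mathrm{T}=(t_0,t_1,t_2,\dots)$ with $t_1=2$ is of homogeneous finite type if and only if it is one of the sequences in the following list. (In each item all terms not specified are $0$; the value of $\dim G_{\mathrm{T}}$ for the sequence is also given as part of the list.) - $\mathrm{T}_1=(1,2,\dots,n-1,n)$: $t_i=i+1$ for $0\le i\le n-1$, where $n\ge 2$; $\dim G_{\mathrm{T}}=0$. - $\mathrm{T}_2=(1,2,1)$; $\dim G_{\mathrm{T}}=2$. - $\mathrm{T}_3=(1,2,3,1)$; $\dim G_{\mathrm{T}}=3$. - $\mathrm{T}_4=(1,2,3,2,1,\dots,1)$: $t_0=1$, $t_1=2$, $t_2=3$, $t_3=2$, $t_4=\dots=t_{4+k}=1$, where $k\ge 1$; $\dim G_{\mathrm{T}}=3$. - $\mathrm{T}_5=(1,2,\dots,n,1,\dots,1)$: $t_i=i+1$ for $0\le i\le n-1$, $t_n=\dots=t_{n+k}=1$, where $n\ge 2$, $k\ge 1$; $\dim G_{\mathrm{T}}=1$. - $\mathrm{T}_6=(1,2,\dots,n,2,\dots,2)$: $t_i=i+1$ for $0\le i\le n-1$, $t_n=\dots=t_{n+k}=2$, where $n\ge 1$, $k\ge 1$; $\dim G_{\mathrm{T}}=2$. - $\mathrm{T}_7=(1,2,\dots,n,2,\dots,2,1,\dots,1)$: $t_i=i+1$ for $0\le i\le n-1$, $t_n=\dots=t_{n+k}=2$, $t_{n+k+1}=\dots=t_{n+k+l}=1$, where $n\ge 1$,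 $k\ge 1$, $l\ge 1$; $\dim G_{\mathrm{T}}=2$ if $l>1$ and $\dim G_{\mathrm{T}}=3$ if $l=1$. - $\mathrm{T}_8=(1,2,\dots,n,3,\dots,3)$: $t_i=i+1$ for $0\le i\le n-1$, $t_n=\dots=t_{n+k}=3$, where $n\ge 2$, $k\ge 1$; $\dim G_{\mathrm{T}}=3$. - $\mathrm{T}_9=(1,2,\dots,n,3,\dots,3,1,\dots,1)$: $t_i=i+1$ for $0\le i\le n-1$, $t_n=\dots=t_{n+k}=3$, $t_{n+k+1}=\dots=t_{n+k+l}=1$, where $n\ge 2$, $k\ge 1$, $l\ge 2$; $\dim G_{\mathrm{T}}=3$. - $\mathrm{T}_{10}=(1,2,\dots,n,3,\dots,3,2,\dots,2)$: $t_i=i+1$ for $0\le i\le n-1$, $t_n=\dots=t_{n+k}=3$, $t_{n+k+1}=\dots=t_{n+k+l}=2$, where $n\ge 2$, $k\ge 1$, $l\ge 2$; $\dim G_{\mathrm{T}}=3$. - $\mathrm{T}_{11}=(1,2,\dots,n,3,\dots,3,2,\dots,2,1,\dots,1)$: $t_i=i+1$ for $0\le i\le n-1$, $t_n=\dots=t_{n+k}=3$, $t_{n+k+1}=\dots=t_{n+k+l}=2$, $t_{n+k+l+1}=\dots=t_{n+k+l+s}=1$, where $n\ge 2$, $k\ge 1$, $l\ge 2$, $s\ge 2$; $\dim G_{\mathrm{T}}=3$.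
   Context: All algebras are commutative, associative, unital, local, finite-dimensional $\mathbb{K}$-algebras. For such an algebra $R$ with maximal ideal $\mathfrak{m}$, its Hilbert-Samuel sequence is $\mathrm{T}(R)=(t_0,t_1,t_2,\dots)$ with $t_i=\dim_{\mathbb{K}}\mathfrak{m}^i/\mathfrak{m}^{i+1}$ and $\mathfrak{m}^0=R$; only finitely many $t_i$ are nonzero and only nonzero terms are written. A Hilbert-Samuel sequence is a sequence of the form $\mathrm{T}(R)$ for some such $R$. A graded algebra here means a local algebra which is graded and generated by elements of degree $1$, equivalently one isomorphic to a quotient of a polynomial ring (with the standard grading) by a homogeneous ideal; when $t_1=2$ these are the finite-dimensional quotients $\mathbb{K}[x,y]/I$ with $I$ homogeneous (and Hilbert-Samuel sequence having $t_1=2$). A Hilbert-Samuel sequence $\mathrm{T}$ is of homogeneous finite type if there are only finitely many isomorphism classes of such graded algebras $R$ with $\mathrm{T}(R)=\mathrm{T}$. With $N=\sum_i t_i$, let $\mathrm{Hilb}^N\,\mathbb{K}[[x,y]]$ be the Hilbert scheme (with reduced scheme structure) parametrizing ideals of colength $N$ in $\mathbb{K}[[x,y]]$. $G_{\mathrm{T}}$ denotes its subscheme parametrizing the homogeneous ideals $I$ whose quotient has Hilbert-Samuel sequence $\mathrm{T}$. *)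

(* Defs.v *)
From HB Require Import structures.
From mathcomp Require Import all_boot all_order all_algebra all_field.
From mathcomp Require Import mpoly.
From mathcomp Require Import boolp classical_sets functions.

Set Implicit Arguments.
Unset Strict Implicit.
Unset Printing Implicit Defensive.

Import GRing.Theory.
Local Open Scope ring_scope.
Local Open Scope classical_set_scope.

Section LocalAlgebras.
Variables (K : fieldType) (R : falgType K).

(* Ideals of R are K-subspaces, so {vspace R} captures all of them. *)
Definition is_ideal (J : {vspace R}) : Prop := ({:R} * J <= J)%VS.

(* The greatest proper ideal; it exists exactly when R is local. *)
Definition is_maximal_ideal (m : {vspace R}) : Prop :=
  [/\ is_ideal m, m <> fullv
    & forall J : {vspace R}, is_ideal J -> J <> fullv -> (J <= m)%VS].

(* The factor {:R} only matters for i = 0, since (m ^+ 0)%VS is the line K.1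
   whereas the zeroth power of an ideal is R. *)
Definition ideal_pow (m : {vspace R}) (i : nat) : {vspace R} :=
  ({:R} * m ^+ i)%VS.

(* R is a commutative local algebra whose Hilbert-Samuel sequence is T; the
   list T consists of the nonzero terms t_0, t_1, ... of the sequence. *)
Definition has_HilbertSamuel (T : seq nat) : Prop :=
  commutative (@GRing.mul R) /\ 0%N \notin T /\
  exists2 m : {vspace R}, is_maximal_ideal m &
    forall i, nth 0%N T i = (\dim (ideal_pow m i) - \dim (ideal_pow m i.+1))%N.

(* R carries a grading R = A 0 + A 1 + ... for which it is generated, as a
   unital K-algebra, by A 1. *)
Definition standard_graded : Prop :=
  exists (A : nat -> {vspace R}) (n : nat),
    [/\ forall i, (n <= i)%N -> A i = 0%VS,
        (\sum_(i < n) A i)%VS = fullv,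
        directv (\sum_(i < n) A i),
        forall i j, (A i * A j <= A (i + j)%N)%VS
      & agenv (A 1%N) = fullv].

End LocalAlgebras.

Definition alg_isomorphic (K : fieldType) (R S : falgType K) : Prop :=
  exists f : {lrmorphism R -> S}, bijective f.

Definition HilbertSamuel_sequence (K : fieldType) (T : seq nat) : Prop :=
  exists R : falgType K, has_HilbertSamuel R T.

Definition homogeneous_finite_type (K : fieldType) (T : seq nat) : Prop :=
  exists (n : nat) (S : 'I_n -> falgType K),
    forall R : falgType K, standard_graded R -> has_HilbertSamuel R T ->
      exists i, alg_isomorphic R (S i).

Definition fps (R : Type) : Type := nat -> R.

HB.instance Definition _ (R : zmodType) :=
  GRing.Zmodule.copy (fps R) (nat -> R).

Section PowerSeries.
Variable R : comNzRingType.
Implicit Types f g h : fps R.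

Definition fps_mul f g : fps R := fun n => \sum_(i < n.+1) f i * g (n - i)%N.
Definition fps_one : fps R := fun n => (n == 0%N)%:R.

Let fps_mul_rev f g n : fps_mul f g n = \sum_(i < n.+1) f (n - i)%N * g i.
Proof.
rewrite /fps_mul (reindex_inj rev_ord_inj) /=.
by apply: eq_bigr => i _; rewrite subSS subKn // -ltnS.
Qed.

Let fps_mulC : commutative fps_mul.
Proof.
move=> f g; apply/funext => n; rewrite fps_mul_rev.
by apply: eq_bigr => i _; rewrite mulrC.
Qed.

Let fps_mulA : associative fps_mul.
Proof.
move=> f g h; apply/funext => n; rewrite [RHS]fps_mul_rev [LHS]/fps_mul.
pose c j k := f j * (g (n - j - k)%N * h k).
transitivity (\sum_(j < n.+1) \sum_(k < n.+1 | (k <= n - j)%N) c j k).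
  apply: eq_bigr => j _; rewrite fps_mul_rev big_distrr /=.
  by rewrite (big_ord_narrow_leq (leq_subr _ _)).
rewrite (exchange_big_dep predT) //=; apply: eq_bigr => k _.
transitivity (\sum_(j < n.+1 | (j <= n - k)%N) c j k).
  apply: eq_bigl => j; rewrite -ltnS -(ltnS j) -!subSn ?leq_ord //.
  by rewrite -subn_gt0 -(subn_gt0 j) -!subnDA addnC.
rewrite (big_ord_narrow_leq (leq_subr _ _)) big_distrl /=.
by apply: eq_bigr => j _; rewrite /c -!subnDA addnC mulrA.
Qed.

Let fps_mul1 : left_id fps_one fps_mul.
Proof.
move=> f; apply/funext => n; rewrite /fps_mul big_ord_recl subn0 mul1r.
by rewrite big1 ?addr0 // => i _; rewrite mul0r.
Qed.

Let fps_mulDl : left_distributive fps_mul +%R.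
Proof.
move=> f g h; apply/funext => n.
rewrite -[RHS]/(fps_mul f h n + fps_mul g h n) /fps_mul -big_split.
by apply: eq_bigr => i _; rewrite [LHS]mulrDl.
Qed.

Let fps_one_neq0 : fps_one != 0.
Proof. by apply/eqP => /(congr1 (@^~ 0%N)) /eqP; rewrite /fps_one oner_eq0. Qed.

HB.instance Definition _ := GRing.Zmodule_isComNzRing.Build (fps R)
  fps_mulA fps_mulC fps_mul1 fps_mulDl fps_one_neq0.

End PowerSeries.

(* K[[x,y]] as K[[y]][[x]]: f i j is the coefficient of x^i y^j. *)
Definition fps2 (K : comNzRingType) : Type := fps (fps K).

HB.instance Definition _ (K : comNzRingType) :=
  GRing.ComNzRing.copy (fps2 K) (fps (fps K)).
HB.instance Definition _ (K : comNzRingType) :=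
  GRing.Lmodule.copy (fps2 K) (nat -> nat -> K^o).

Section PowerSeries2.
Variable K : comNzRingType.

Let fps2_scalerAl (a : K) (f g : fps2 K) : a *: (f * g) = (a *: f) * g.
Proof.
apply/funext => i; apply/funext => j.
rewrite -[LHS]/(a * (\sum_(k < i.+1) (f k * g (i - k)%N)) j).
rewrite -[RHS]/((\sum_(k < i.+1) ((a *: f) k * g (i - k)%N)) j).
have sumE (F : 'I_i.+1 -> fps K) :
  (\sum_(k < i.+1) F k) j = \sum_(k < i.+1) F k j.
  by elim/big_rec2: _ => //= k y ? _ <-.
rewrite !sumE big_distrr /=; apply: eq_bigr => k _.
by rewrite [LHS]big_distrr /=; apply: eq_bigr => l _; rewrite mulrA.
Qed.

HB.instance Definition _ :=
  GRing.Lmodule_isLalgebra.Build K (fps2 K) fps2_scalerAl.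
HB.instance Definition _ := GRing.Lalgebra_isComAlgebra.Build K (fps2 K).

Definition fps2_monomial (i j : nat) : fps2 K :=
  fun k l => ((k == i) && (l == j))%:R.

Definition fps2_component (d : nat) (f : fps2 K) : fps2 K :=
  fun i j => if (i + j == d)%N then f i j else 0.

Definition fps2_ideal (I : set (fps2 K)) : Prop :=
  [/\ I 0, forall f g, I f -> I g -> I (f + g)
    & forall f g, I g -> I (f * g)].

Definition fps2_homogeneous (I : set (fps2 K)) : Prop :=
  forall f d, I f -> I (fps2_component d f).

End PowerSeries2.

Section KrullDimension.
Variables (P : Type) (closedP : set (set P)).

Definition irreducible_set (Z : set P) : Prop :=
  Z !=set0 /\ forall C1 C2, closedP C1 -> closedP C2 ->
    Z `<=` C1 `|` C2 -> Z `<=` C1 \/ Z `<=` C2.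

Definition irreducible_chain (X : set P) (d : nat) (Z : nat -> set P) : Prop :=
  (forall i, (i <= d)%N ->
     irreducible_set (Z i) /\ exists2 C, closedP C & Z i = X `&` C) /\
  (forall i, (i < d)%N -> Z i `<` Z i.+1).

(* The subset X, with the topology induced by the closed sets closedP of P,
   has Krull dimension d. *)
Definition has_krull_dim (X : set P) (d : nat) : Prop :=
  (exists Z, irreducible_chain X d Z) /\
  (forall e Z, irreducible_chain X e Z -> (e <= d)%N).

End KrullDimension.

Section HilbertScheme.
Variables (K : fieldType) (N : nat).

(* phi identifies K[[x,y]]/I with K^N. *)
Definition quotient_frame (I : set (fps2 K))
    (phi : {linear fps2 K -> 'rV[K]_N}) : Prop :=
  (forall v, exists f, phi f = v) /\ (forall f, I f <-> phi f = 0).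

Definition Hilb : set (set (fps2 K)) :=
  [set I | fps2_ideal I /\ exists phi, quotient_frame I phi].

(* An ideal of colength N contains (x,y)^N, hence also x^N and y^N, so phi is
   determined by the images of the monomials x^i y^j with i, j < N. *)
Definition frame_coords (phi : {linear fps2 K -> 'rV[K]_N}) :
    'I_(N * N * N) -> K :=
  fun p => mxvec (\matrix_(a < N * N)
                    phi (fps2_monomial K (a %/ N) (a %% N))) 0 p.

(* Zariski topology on the points of the Hilbert scheme, as a subspace of the
   Grassmannian of N-dimensional quotients of K[[x,y]]/(x^N, y^N); the latter
   is the quotient by GL_N of the space of surjective N^2 x N matrices, so a
   set of ideals is closed iff its preimage among frames is cut out by
   polynomials in the matrix entries. *)
Definition Hilb_closed : set (set (set (fps2 K))) :=
  [set C | C `<=` Hilb /\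
    exists E : set {mpoly K[N * N * N]},
      forall I phi, Hilb I -> quotient_frame I phi ->
        (C I <-> forall p, E p -> p.@[frame_coords phi] = 0)].

End HilbertScheme.

Definition G_ (K : fieldType) (T : seq nat) : set (set (fps2 K)) :=
  [set I | fps2_homogeneous I /\
    exists (R : falgType K) (phi : {lrmorphism fps2 K -> R}),
      [/\ forall r, exists f, phi f = r, forall f, I f <-> phi f = 0
        & has_HilbertSamuel R T]].

Definition dim_G_eq (K : fieldType) (T : seq nat) (d : nat) : Prop :=
  has_krull_dim (@Hilb_closed K (sumn T)) (@G_ K T) d.

(* The list of sequences together with the dimensions of the G_T; note that
   iota 1 n is 1, 2, ..., n. *)
Inductive listed : seq nat -> nat -> Prop :=
| listed_T1 n of (2 <= n)%N : listed (iota 1 n) 0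
| listed_T2 : listed [:: 1; 2; 1]%N 2
| listed_T3 : listed [:: 1; 2; 3; 1]%N 3
| listed_T4 k of (1 <= k)%N : listed ([:: 1; 2; 3; 2]%N ++ nseq k.+1 1%N) 3
| listed_T5 n k of (2 <= n)%N & (1 <= k)%N : listed (iota 1 n ++ nseq k.+1 1%N) 1
| listed_T6 n k of (1 <= n)%N & (1 <= k)%N : listed (iota 1 n ++ nseq k.+1 2%N) 2
| listed_T7 n k l of (1 <= n)%N & (1 <= k)%N & (1 <= l)%N :
    listed (iota 1 n ++ nseq k.+1 2%N ++ nseq l 1%N)
           (if l == 1%N then 3 else 2)
| listed_T8 n k of (2 <= n)%N & (1 <= k)%N : listed (iota 1 n ++ nseq k.+1 3%N) 3
| listed_T9 n k l of (2 <= n)%N & (1 <= k)%N & (2 <= l)%N :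
    listed (iota 1 n ++ nseq k.+1 3%N ++ nseq l 1%N) 3
| listed_T10 n k l of (2 <= n)%N & (1 <= k)%N & (2 <= l)%N :
    listed (iota 1 n ++ nseq k.+1 3%N ++ nseq l 2%N) 3
| listed_T11 n k l s of (2 <= n)%N & (1 <= k)%N & (2 <= l)%N & (2 <= s)%N :
    listed (iota 1 n ++ nseq k.+1 3%N ++ nseq l 2%N ++ nseq s 1%N) 3.

(* Main.v *)
Require Import Defs.
From HB Require Import structures.
From mathcomp Require Import all_boot all_order all_algebra all_field.
From mathcomp Require Import mpoly.
From mathcomp Require Import zify.
From mathcomp Require Import ring.
From mathcomp Require Import boolp classical_sets functions.

(* Writing forms of degree i in x, y as polynomials of degree at most i, a homogeneous
   ideal with Hilbert function T is the same as a sequence of subspaces V_i of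
   codimension t_i with V_i and X V_i inside V_(i+1).  From the initial degree d on, T
   is nonincreasing; wherever T does not drop twice in a row, V_i consists of the
   multiples of a single form of degree t_i, and each of these forms divides the
   previous ones.  So a homogeneous ideal amounts to t_d points of the projective line,
   together with a Grassmannian-like choice at each double drop.

   If only finitely many isomorphism classes occur, G_T is covered by finitely many
   images of PGL_2, so all chains of irreducible closed subsets have length at most 3.
   If T is not listed, there are polynomial families of ideals giving a chain of length
   at least 4.  If T is listed, at most three points of the line, or two points and a
   functional on the two-dimensional quotient they define, have to be moved to a normal
   position by PGL_2.  The dimensions come from the same families.  Chains are bounded
   from above by transcendence degree: if finitely many polynomial maps on K^n cover a
   set, then irreducible closed chains in it have length at most n. *)

Set Implicit Arguments.
Unset Strict Implicit.
Unset Printing Implicit Defensive.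

Import GRing.Theory.

(** * Polynomial families and Krull dimension *)

Section PolynomialFunctions.
Local Open Scope ring_scope.
Variable K : closedFieldType.

(** Closedness is tested on frames of ideals, so dimensions are counted on sets of frames, where the
    fibre [GL_N] adds the same [N^2] parameters on both sides. Writing forms as polynomials in one
    variable hides the point at infinity: the normal families only reach ideals containing a form of
    full degree. The involutions [flip] by finitely many integers bring every ideal into this
    position, which is why coverings are always by finitely many polynomial families. The families
    allow a single exceptional degree [j], with a drop on both sides. This suffices for the listed
    sequences; among the others only [(1,2,3,2,1)] has no chain of length 4 from such a family, and
    it gets a family of its own by apolarity. The number 3 enters twice for one reason: [PGL_2] has
    dimension 3 and is transitive on triples of distinct points. Characteristic 0 supplies distinct
    integers and makes 2, 4 and the degree in the jet normal form invertible. *)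

Definition polyfun n (f : ('I_n -> K) -> K) : Prop :=
  exists p : {mpoly K[n]}, forall v, f v = p.@[v].

Section Closure.
Variable n : nat.
Implicit Types f g : ('I_n -> K) -> K.

Lemma polyfun_ext f g : f =1 g -> polyfun f -> polyfun g.
Proof. by move=> e [p hp]; exists p => v; rewrite -e. Qed.

Lemma polyfun_cst c : polyfun (fun _ : 'I_n -> K => c).
Proof. by exists c%:MP => v; rewrite mevalC. Qed.

Lemma polyfun_var i : polyfun (fun v : 'I_n -> K => v i).
Proof. by exists 'X_i => v; rewrite mevalXU. Qed.

Lemma polyfun_add f g : polyfun f -> polyfun g -> polyfun (fun v => f v + g v).
Proof. by move=> [p hp] [q hq]; exists (p + q) => v; rewrite mevalD hp hq. Qed.

Lemma polyfun_mul f g : polyfun f -> polyfun g -> polyfun (fun v => f v * g v).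
Proof. by move=> [p hp] [q hq]; exists (p * q) => v; rewrite mevalM hp hq. Qed.

Lemma polyfun_opp f : polyfun f -> polyfun (fun v => - f v).
Proof. by move=> [p hp]; exists (- p) => v; rewrite mevalN hp. Qed.

Lemma polyfun_sum (I : Type) (r : seq I) (P : pred I) (F : I -> ('I_n -> K) -> K) :
  (forall i, polyfun (F i)) -> polyfun (fun v => \sum_(i <- r | P i) F i v).
Proof.
move=> hF; elim: r => [|i r IH].
  by apply: (polyfun_ext _ (polyfun_cst 0)) => v; rewrite big_nil.
case Pi: (P i); last by apply: (polyfun_ext _ IH) => v; rewrite big_cons Pi.
by apply: (polyfun_ext _ (polyfun_add (hF i) IH)) => v; rewrite big_cons Pi.
Qed.

Lemma polyfun_prod (I : Type) (r : seq I) (P : pred I) (F : I -> ('I_n -> K) -> K) :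
  (forall i, polyfun (F i)) -> polyfun (fun v => \prod_(i <- r | P i) F i v).
Proof.
move=> hF; elim: r => [|i r IH].
  by apply: (polyfun_ext _ (polyfun_cst 1)) => v; rewrite big_nil.
case Pi: (P i); last by apply: (polyfun_ext _ IH) => v; rewrite big_cons Pi.
by apply: (polyfun_ext _ (polyfun_mul (hF i) IH)) => v; rewrite big_cons Pi.
Qed.

Lemma polyfun_exp f k : polyfun f -> polyfun (fun v => f v ^+ k).
Proof.
move=> hf; apply: (polyfun_ext _ (polyfun_prod (index_enum 'I_k) predT (fun=> hf))) => v.
by rewrite prodr_const card_ord.
Qed.

Lemma polyfun_comp m (p : {mpoly K[m]}) (F : 'I_m -> ('I_n -> K) -> K) :
  (forall i, polyfun (F i)) -> polyfun (fun v => p.@[fun i => F i v]).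
Proof.
move=> hF; apply: (polyfun_ext (fun v => esym (mevalE _ _))).
apply: polyfun_sum => i; apply: polyfun_mul; first exact: polyfun_cst.
by apply: polyfun_prod => j; apply: polyfun_exp.
Qed.

End Closure.

Lemma meval_muni n (p : {mpoly K[n.+1]}) (v : 'I_n.+1 -> K) :
  p.@[v] = (map_poly (meval (fun i => v (widen_ord (leqnSn n) i))) (muni p)).[v ord_max].
Proof.
rewrite mevalE muniE rmorph_sum horner_sum; apply: eq_bigr => m _.
rewrite -mul_polyC rmorphM /= map_polyXn map_polyC /= hornerM hornerXn hornerC.
rewrite mevalZ mevalX big_ord_recr /= -mulrA; congr (_ * (_ * _)).
by apply: eq_bigr => i _; rewrite mnmE.
Qed.

(** The coefficient of [p] at [m] is recovered from [muni p]: take its coefficient of degree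
    [m ord_max], then the coefficient of that at the truncation of [m] to the first [n]
    variables. *)
Lemma muni_eq0 n (p : {mpoly K[n.+1]}) : muni p = 0 -> p = 0.
Proof.
move=> h; apply/mpolyP => m; rewrite mcoeff0.
have: ((muni p)`_(m ord_max))@_[multinom m (widen_ord (leqnSn n) i) | i < n] = 0.
  by rewrite h coef0 mcoeff0.
rewrite muniE coef_sum raddf_sum /=.
under eq_bigr => m' _ do rewrite coefZ coefXn -scalerAl.
have E m' : ((p@_m' *: ('X_[[multinom m' (widen_ord (leqnSn n) i) | i < n]] *
   (m ord_max == m' ord_max)%:R)) : {mpoly K[n]})@_[multinom m (widen_ord (leqnSn n) i) | i < n]
   = p@_m' * (m' == m)%:R.
  rewrite mcoeffZ; congr (_ * _); rewrite mulr_natr mcoeffMn mcoeffX -mulr_natr.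
  case: (m' =P m) => [->|ne]; first by rewrite !eqxx mulr1.
  case: eqP => [e1|_]; last by rewrite mulr0 mul0rn.
  case: eqP => [e2|_]; last by rewrite mulr0n.
  case: ne; apply/mnmP => i.
  case: (ltnP i n) => hi; last first.
    have -> : i = ord_max by apply/val_inj/eqP; rewrite eqn_leq hi -ltnS ltn_ord.
    by rewrite e2.
  have := congr1 (fun m : 'X_{1..n} => m (Ordinal hi)) e1; rewrite /= !mnmE.
  by have -> : widen_ord (leqnSn n) (Ordinal hi) = i by apply: val_inj.
under eq_bigr => m' _ do rewrite E.
have [hm|hm] := boolP (m \in msupp p); last by rewrite (memN_msupp_eq0 hm).
rewrite (bigD1_seq m) ?msupp_uniq //= eqxx mulr1 big1 ?addr0 //.
by move=> i /negbTE ->; rewrite mulr0.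
Qed.

Hypothesis charK0 : [pchar K]%R =i pred0.

Lemma natK_inj : injective (fun n : nat => n%:R : K).
Proof.
move=> m n /eqP; wlog le: m n / (m <= n)%N.
  by case: (leqP m n) => h; [exact|move=> /(_ n m (ltnW h)) H; rewrite eq_sym => /H].
rewrite eq_sym -subr_eq0 -natrB //.
move/pcharf0P: charK0 => ->; rewrite subn_eq0 => h.
by apply/eqP; rewrite eqn_leq le.
Qed.

Lemma poly_eq0_horner (p : {poly K}) : (forall x, p.[x] = 0) -> p = 0.
Proof.
move=> h; apply/eqP; apply: contraT => nz.
have := max_poly_roots (rs := [seq i%:R | i <- iota 0 (size p)]) nz.
rewrite size_map size_iota ltnn => -> //.
  by apply/allP => x _; apply/eqP; apply: h.
by rewrite map_inj_uniq ?iota_uniq //; apply: natK_inj.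
Qed.

(** Induction on the number of variables: for fixed values of the others, [p] is a polynomial in the
    last variable vanishing everywhere, and the natural numbers already give it too many roots. *)
Lemma mpoly_eq0_meval n (p : {mpoly K[n]}) : (forall v, p.@[v] = 0) -> p = 0.
Proof.
elim: n p => [|n IH] p h.
  apply/mpolyP => m; rewrite mcoeff0; have := h (fun _ => 0).
  rewrite mevalE; have [hm|hm _] := boolP (m \in msupp p); last by rewrite memN_msupp_eq0.
  rewrite (bigD1_seq m) ?msupp_uniq //= big_ord0 mulr1 big1 ?addr0 //.
  by move=> m' /eqP []; apply/mnmP => -[].
apply: muni_eq0; apply/polyP => k; rewrite coef0; apply: IH => v.
have E : map_poly (meval v) (muni p) = 0.
  apply: poly_eq0_horner => x.
  pose w (i : 'I_n.+1) := if insub (i : nat) is Some j then v j else x.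
  have := h w; rewrite meval_muni.
  have -> : w ord_max = x by rewrite /w insubN //= ltnn.
  move=> <-; congr (horner _ _); apply: eq_map_poly => q; apply: meval_eq => i.
  by rewrite /w /= insubT //= => hi; congr (v _); apply: val_inj.
by have := congr1 (fun q : {poly K} => q`_k) E; rewrite coef_map coef0.
Qed.

(** Irreducibility of affine space. The irreducibility of polynomial families of ideals and that of
    [GL_N] are both reduced to it. *)
Lemma polyfun_integral n (f g : ('I_n -> K) -> K) : polyfun f -> polyfun g ->
  (forall v, f v * g v = 0) -> (forall v, f v = 0) \/ (forall v, g v = 0).
Proof.
move=> [p hp] [q hq] h; have : p * q = 0.
  by apply: mpoly_eq0_meval => v; rewrite mevalM -hp -hq.
by move/eqP; rewrite mulf_eq0 => /orP[] /eqP E; [left|right] => v;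
  rewrite ?hp ?hq E meval0.
Qed.

Lemma msize_prod_exp n k (P : 'I_k -> {mpoly K[n]}) e D (m : 'I_k -> nat) :
  (forall i, msize (P i) < e)%N -> (forall i, m i <= D)%N ->
  (msize (\prod_i P i ^+ m i) < k * (D * e + 2) + 2)%N.
Proof.
move=> hP hm.
have hX i j : (msize (P i ^+ j) < j * e + 2)%N.
  elim: j => [|j IH]; first by rewrite expr0 msize1.
  rewrite exprS; apply: leq_ltn_trans (msizeM_le _ _) _.
  by rewrite mulSn -addSn -addnA -addnS leq_add.
have : forall s : seq 'I_k,
    (msize (\prod_(i <- s) P i ^+ m i) < size s * (D * e + 2) + 2)%N.
  elim=> [|i s IH]; first by rewrite big_nil msize1.
  rewrite big_cons; apply: leq_ltn_trans (msizeM_le _ _) _.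
  rewrite /= mulSn -addSn -addnA -addnS leq_add //.
  by apply: leq_trans (hX i (m i)) _; rewrite leq_add2r leq_mul2r hm orbT.
by move=> /(_ (index_enum 'I_k)); rewrite /index_enum -enumT size_enum_ord.
Qed.

(** A counting argument that yields one relation for all [r] maps at once: the [D^k] monomials with
    exponents below [D] go to polynomials in [n] variables with exponents below [B <= q D], so there
    are at most [r (q D)^n] linear conditions on the coefficients of [p]. *)
Lemma algebraic_dependence n k r (P : 'I_r -> 'I_k -> {mpoly K[n]}) : (n < k)%N ->
  exists2 p : {mpoly K[k]}, p != 0 &
    forall a v, p.@[fun i => (P a i).@[v]] = 0.
Proof.
move=> ltnk.
pose e := (\max_(a < r) \max_(i < k) msize (P a i)).+1.
have he a i : (msize (P a i) < e)%N.
  rewrite /e ltnS; apply: leq_trans (leq_bigmax a).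
  exact: (leq_bigmax (F := fun i => msize (P a i))).
pose q := (k * (e + 2) + 2)%N.
(* Chosen so that [r q^n D^n < D^(n+1)]; as [n < k], there are then more unknowns than
   conditions. *)
pose D := (r * q ^ n).+1.
pose B := (k * (D * e + 2) + 2)%N.
have leB : (B <= q * D)%N.
  rewrite /B /q mulnDl -mulnA; apply: leq_add; last by rewrite leq_pmulr.
  rewrite leq_mul2l; apply/orP; right; rewrite mulnDl mulnC.
  by rewrite leq_add2l leq_pmulr.
pose A := {ffun 'I_k -> 'I_D}; pose C := ('I_r * {ffun 'I_n -> 'I_B})%type.
have cardAC : (#|{: C}| < #|{: A}|)%N.
  rewrite card_prod !card_ffun !card_ord.
  apply: leq_trans (leq_pexp2l _ ltnk) => //.
  apply: (@leq_ltn_trans (r * q ^ n * D ^ n)); last first.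
    by rewrite expnS ltn_pmul2r ?expn_gt0.
  rewrite -mulnA -expnMn leq_mul2l; apply/orP; right; case: (n) => [|n1] //; by rewrite leq_exp2r.
pose mA (a : A) : 'X_{1..k} := [multinom (a i : nat) | i < k].
pose mC (b : {ffun 'I_n -> 'I_B}) : 'X_{1..n} := [multinom (b i : nat) | i < n].
pose Q (x : 'I_r) (a : A) := \prod_i P x i ^+ mA a i.
pose M := \matrix_(a < #|{: A}|, c < #|{: C}|)
   (Q (enum_val c).1 (enum_val a))@_(mC (enum_val c).2).
have [v hv vn0] : exists2 v : 'rV_#|{: A}|, v *m M = 0 & v != 0.
  have : kermx M != 0.
    by rewrite kermx_eq0 /row_free; apply: contraTneq cardAC => <-; rewrite -leqNgt rank_leq_col.
  case/rowV0Pn => v /sub_kermxP hv vn0; by exists v.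
pose p := \sum_(a < #|{: A}|) v 0 a *: 'X_[mA (enum_val a)] : {mpoly K[k]}.
have mA_inj : injective mA.
  move=> a b /mnmP h; apply/ffunP => i; apply: val_inj; have := h i.
  by rewrite !mnmE.
exists p.
  have /rV0Pn [a0 ha0] := vn0.
  apply: contraNneq ha0 => /(congr1 (mcoeff (mA (enum_val a0)))).
  rewrite mcoeff0 raddf_sum /= (bigD1 a0) //= big1 => [|a ne].
    by rewrite addr0 mcoeffZ mcoeffX eqxx mulr1 => ->.
  rewrite mcoeffZ mcoeffX; case: eqP => [/mA_inj /enum_val_inj E|]; last by rewrite mulr0.
  by rewrite E eqxx in ne.
move=> x w.
have E : \sum_(a < #|{: A}|) v 0 a *: Q x (enum_val a) = 0.
  apply/mpolyP => m; rewrite mcoeff0 raddf_sum /=.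
  have [/forallP hm|] := boolP [forall i, m i < B]%N.
    pose b : {ffun 'I_n -> 'I_B} := [ffun i => Ordinal (hm i)].
    have Em : m = mC b by apply/mnmP => i; rewrite mnmE ffunE.
    have := congr1 (fun u : 'rV_ _ => u 0 (enum_rank ((x, b) : C))) hv.
    rewrite !mxE => h; rewrite -[RHS]h; apply: eq_bigr => a _.
    by rewrite mcoeffZ mxE enum_rankK Em.
  rewrite negb_forall => /existsP [i hi]; apply: big1 => a _.
  rewrite mcoeffZ memN_msupp_eq0 ?mulr0 //; apply: msize_mdeg_ge.
  apply: (@leq_trans B); last first.
    rewrite leqNgt; apply: contra hi => h; apply: leq_ltn_trans h.
    by rewrite mdegE (bigD1 i) //= leq_addr.
  apply: ltnW; apply: msize_prod_exp => // j.
  by rewrite mnmE ltnW.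
have := congr1 (meval w) E; rewrite meval0 => <-.
rewrite /p !rmorph_sum /=; apply: eq_bigr => a _.
rewrite !mevalZ mevalX rmorph_prod; congr (_ * _); apply: eq_bigr => i _.
by rewrite rmorphXn.
Qed.

End PolynomialFunctions.

(** * Closed sets of ideals, and chains obtained from polynomial families *)

Section KrullDimensionBounds.
Local Open Scope ring_scope.
Local Open Scope classical_set_scope.
Variables (K : closedFieldType) (charK0 : [pchar K]%R =i pred0) (N : nat).
Local Notation coords := ('I_(N * N * N) -> K).
Local Notation frame := {linear fps2 K -> 'rV[K]_N}.
Local Notation monos := (N * N)%N.

Definition frame_mx (phi : frame) : 'M[K]_(monos, N) :=
  \matrix_(a < N * N) phi (fps2_monomial K (a %/ N) (a %% N)).

Definition mxcoords m n (A : 'M[K]_(m, n)) : 'I_(m * n) -> K := fun p => mxvec A 0 p.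

Lemma frame_coordsE (phi : frame) : frame_coords phi = mxcoords (frame_mx phi).
Proof. by []. Qed.

Definition coords_mx m n (x : 'I_(m * n) -> K) : 'M[K]_(m, n) := vec_mx (\row_p x p).

Lemma mxcoordsK m n : cancel (@mxcoords m n) (@coords_mx m n).
Proof.
move=> A; rewrite /coords_mx -[RHS]mxvecK; congr vec_mx.
by apply/rowP => p; rewrite mxE.
Qed.

Lemma coords_mxK m n : cancel (@coords_mx m n) (@mxcoords m n).
Proof. by move=> x; apply/funext => p; rewrite /mxcoords /coords_mx vec_mxK mxE. Qed.

Lemma polyfun_coords_mx n m k (F : 'I_(m * k) -> ('I_n -> K) -> K) i j :
  (forall p, polyfun (F p)) -> polyfun (fun v => coords_mx (fun p => F p v) i j).
Proof.
move=> h; apply: polyfun_ext (h (mxvec_index i j)) => v.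
by rewrite /coords_mx mxE mxE.
Qed.

Lemma polyfun_mxcoords n m k (A : ('I_n -> K) -> 'M[K]_(m, k)) p :
  (forall i j, polyfun (fun v => A v i j)) -> polyfun (fun v => mxcoords (A v) p).
Proof.
move=> h; case/mxvec_indexP: p => i j; apply: polyfun_ext (h i j) => v.
by rewrite /mxcoords mxvecE.
Qed.

Lemma polyfun_mulmx n m k l (A : ('I_n -> K) -> 'M[K]_(m, k)) (B : ('I_n -> K) -> 'M[K]_(k, l)) :
  (forall i j, polyfun (fun v => A v i j)) -> (forall i j, polyfun (fun v => B v i j)) ->
  forall i j, polyfun (fun v => (A v *m B v) i j).
Proof.
move=> hA hB i j; apply: (polyfun_ext (fun v => esym (mxE _ _ _ _))).
by apply: polyfun_sum => p; apply: polyfun_mul.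
Qed.

Lemma polyfun_det n m (A : ('I_n -> K) -> 'M[K]_m) :
  (forall i j, polyfun (fun v => A v i j)) -> polyfun (fun v => \det (A v)).
Proof.
move=> hA; apply: polyfun_sum => s; apply: polyfun_mul; first exact: polyfun_cst.
by apply: polyfun_prod.
Qed.

Lemma polyfun_meval n (p : {mpoly K[n]}) : polyfun (fun v => p.@[v]).
Proof. by exists p. Qed.

Lemma frame_mul (I : set (fps2 K)) (phi : frame) (g : 'M[K]_N) :
  g \in unitmx -> quotient_frame I phi ->
  quotient_frame I (mulmxr g \o phi : frame).
Proof.
move=> ug [surj ker]; split=> [v|f].
  have [f hf] := surj (v *m invmx g); exists f.
  by rewrite /= hf mulmxKV.
rewrite ker /=; split=> [->|h]; first by rewrite mul0mx.
by rewrite -(mulmxK ug (phi f)) h mul0mx.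
Qed.

Lemma frame_mx_mul (phi : frame) (g : 'M[K]_N) :
  frame_mx (mulmxr g \o phi : frame) = frame_mx phi *m g.
Proof. by apply/row_matrixP => a; rewrite row_mul !rowK. Qed.

(** Both frames identify the same quotient with [K^N]. The comparison matrix is computed on lifts
    [b] of the unit vectors, and comparing in both directions shows that it is invertible. *)
Lemma frame_uniq (I : set (fps2 K)) (phi psi : frame) :
  quotient_frame I phi -> quotient_frame I psi ->
  exists2 g : 'M[K]_N, g \in unitmx & forall f, psi f = phi f *m g.
Proof.
have aux (p q : frame) : quotient_frame I p -> quotient_frame I q ->
    exists g : 'M[K]_N, forall f, q f = p f *m g.
  move=> [s1 k1] [s2 k2]; have [b hb] := choice (fun i => s1 (delta_mx 0 i)).
  exists (\matrix_i q (b i)) => f.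
  have : I (f - \sum_i p f 0 i *: b i).
    apply/k1; rewrite raddfB raddf_sum /= [X in X - _](row_sum_delta (p f)).
    rewrite [X in _ - X](eq_bigr (fun i => p f 0 i *: delta_mx 0 i)) ?subrr // => i _.
    by rewrite linearZ hb.
  move/k2; rewrite raddfB raddf_sum /= => /eqP; rewrite subr_eq0 => /eqP ->.
  rewrite mulmx_sum_row; apply: eq_bigr => i _.
  by rewrite linearZ rowK.
move=> h1 h2; have [g hg] := aux _ _ h1 h2; have [g' hg'] := aux _ _ h2 h1.
exists g => //; suff /mulmx1_unit [] : g *m g' = 1%:M by [].
apply/row_matrixP => i; rewrite row1 rowE mulmxA.
by have [f <-] := h1.1 (delta_mx 0 i); rewrite -hg -hg'.
Qed.

Lemma frame_mx_uniq (I : set (fps2 K)) (phi psi : frame) :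
  quotient_frame I phi -> quotient_frame I psi ->
  exists2 g : 'M[K]_N, g \in unitmx & frame_mx psi = frame_mx phi *m g.
Proof.
move=> h1 h2; have [g ug hg] := frame_uniq h1 h2; exists g => //.
by apply/row_matrixP => a; rewrite row_mul !rowK.
Qed.

Definition zero_locus (E : set {mpoly K[monos * N]}) : set (set (fps2 K)) :=
  [set I | Hilb N I /\ forall phi : frame, quotient_frame I phi ->
     forall p, E p -> p.@[frame_coords phi] = 0].

(** A closed set needs equations whose vanishing on any single frame decides membership, whereas
    [zero_locus] quantifies over all frames. Replacing [E] by all its translates under [GL_N] makes
    the condition independent of the frame. *)
Lemma zero_locus_closed E : @Hilb_closed K N (zero_locus E).
Proof.
split=> [I []//|].
exists [set q | exists g p, [/\ g \in unitmx, E p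
   & forall A : 'M[K]_(monos, N), q.@[mxcoords A] = p.@[mxcoords (A *m g)]]].
move=> I phi HI hphi; split=> [[_ h] q [g [p [ug Ep hq]]]|h].
  by rewrite frame_coordsE hq -frame_mx_mul; apply: h => //; apply: frame_mul.
split=> // psi hpsi p Ep; have [g ug hg] := frame_mx_uniq hphi hpsi.
have [q hq] : polyfun (fun x : coords => p.@[mxcoords (coords_mx x *m g)]).
  apply: polyfun_comp => i; apply: polyfun_mxcoords; apply: polyfun_mulmx.
    by move=> a b; apply: polyfun_coords_mx => c; apply: polyfun_var.
  by move=> a b; apply: polyfun_cst.
rewrite frame_coordsE hg -(h q) ?frame_coordsE; first by rewrite -hq mxcoordsK.
by exists g, p; split=> // A; rewrite -hq mxcoordsK.
Qed.

Definition zariski_closure (Y : set (set (fps2 K))) :=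
  zero_locus [set p | forall I (phi : frame), Y I -> quotient_frame I phi ->
    p.@[frame_coords phi] = 0].

Lemma zariski_closure_closed Y : @Hilb_closed K N (zariski_closure Y).
Proof. exact: zero_locus_closed. Qed.

Lemma zariski_closure_sub Y : Y `<=` Hilb N -> Y `<=` zariski_closure Y.
Proof. by move=> YH I YI; split=> [|phi hphi p hp]; [exact: YH|exact: hp YI hphi]. Qed.

Lemma zariski_closure_min Y C : @Hilb_closed K N C -> Y `<=` C -> zariski_closure Y `<=` C.
Proof.
move=> [CH [E hE]] YC I [HI hI]; have [phi hphi] := HI.2.
apply/(hE _ _ HI hphi) => p Ep; apply: hI => // J psi YJ hpsi.
by have CJ := YC _ YJ; exact: (hE _ _ (CH _ CJ) hpsi).1 CJ p Ep.
Qed.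

Section FamilyChain.
Variables (X : set (set (fps2 K))) (d : nat) (I : ('I_d -> K) -> set (fps2 K)).
Variable phi : ('I_d -> K) -> frame.
Hypotheses (XH : X `<=` Hilb N) (XI : forall u, X (I u)).
Hypothesis phiP : forall u, quotient_frame (I u) (phi u).
Hypothesis phi_poly : forall q, polyfun (fun u => frame_coords (phi u) q).

Let trunc k (u : 'I_d -> K) : 'I_d -> K := fun i => if (i < k)%N then u i else 0.
(** The members of the family whose parameters from index [k] on are zero; the chain will consist of
    the closures of these sets inside [X]. *)
Let Y k : set (set (fps2 K)) := [set J | exists u, J = I (trunc k u)].

(** An image of affine space: an equation of [C1] failing at one parameter and an equation of [C2]
    failing at another would have product zero along the whole family. *)
Let Y_irr k C1 C2 : @Hilb_closed K N C1 -> @Hilb_closed K N C2 ->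
  Y k `<=` C1 `|` C2 -> Y k `<=` C1 \/ Y k `<=` C2.
Proof.
move=> [C1H [E1 hE1]] [C2H [E2 hE2]] sub.
have [|] := pselect (Y k `<=` C1); first by left.
move=> /existsNP [J] /not_implyP [[u ->] nC1]; right=> _ [w ->].
have inH v : Hilb N (I v) by apply: XH.
apply: contrapT => nC2.
have [p1 Ep1 n1] : exists2 p, E1 p & p.@[frame_coords (phi (trunc k u))] <> 0.
  apply: contrapT => h; apply: nC1; apply/(hE1 _ _ (inH _) (phiP _)) => p Ep.
  by apply: contrapT => np; apply: h; exists p.
have [p2 Ep2 n2] : exists2 p, E2 p & p.@[frame_coords (phi (trunc k w))] <> 0.
  apply: contrapT => h; apply: nC2; apply/(hE2 _ _ (inH _) (phiP _)) => p Ep.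
  by apply: contrapT => np; apply: h; exists p.
have polyt (p : {mpoly K[monos * N]}) : polyfun (fun v => p.@[frame_coords (phi (trunc k v))]).
  apply: polyfun_comp => q; have [f hf] := phi_poly q.
  apply: (polyfun_ext (fun v => esym (hf (trunc k v)))); apply: polyfun_comp => i.
  by rewrite /trunc; case: (i < k)%N; [exact: polyfun_var|exact: polyfun_cst].
case: (polyfun_integral charK0 (polyt p1) (polyt p2)) => [v|h|h].
- have [c|c] := sub (I (trunc k v)) (ex_intro _ v erefl).
    by have/(hE1 _ _ (inH _) (phiP _))/(_ _ Ep1) -> := c; rewrite mul0r.
  by have/(hE2 _ _ (inH _) (phiP _))/(_ _ Ep2) -> := c; rewrite mulr0.
- exact: n1.
- exact: n2.
Qed.

(** The closures of the [Y k] are irreducible and increasing; the closed set [C k] separates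
    consecutive ones, since it contains [Y k] but misses a point of [Y k.+1]. *)
Lemma family_chain (C : nat -> set (set (fps2 K))) :
  (forall k, (k < d)%N -> @Hilb_closed K N (C k)) ->
  (forall k (u : 'I_d -> K), (k < d)%N -> (forall i : 'I_d, (k <= i)%N -> u i = 0) ->
     C k (I u)) ->
  (forall k, (k < d)%N -> exists2 u, (forall i : 'I_d, (k < i)%N -> u i = 0) & ~ C k (I u)) ->
  exists Z, irreducible_chain (@Hilb_closed K N) X d Z.
Proof.
move=> clC inC ninC; exists (fun k => X `&` zariski_closure (Y k)).
have YX k : Y k `<=` X by move=> _ [u ->].
have YH k : Y k `<=` Hilb N by move=> J /YX /XH.
split=> k hk; last first.
  split.
    move=> J [XJ cJ]; split=> //; apply: zariski_closure_min cJ.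
      exact: zariski_closure_closed.
    apply: subset_trans (zariski_closure_sub (YH _)) => _ [u ->].
    exists (trunc k u); congr I; apply/funext => i; rewrite /trunc.
    by case: (ltnP i k) => // h; [rewrite ltnS ltnW|rewrite if_same].
  move=> sub; have [u hu nC] := ninC k hk.
  have ut : u = trunc k.+1 u.
    by apply/funext => i; rewrite /trunc; case: (ltnP i k.+1) => // /hu.
  have : (X `&` zariski_closure (Y k)) (I u).
    by apply: sub; split=> //; apply: zariski_closure_sub => //; exists u; rewrite -ut.
  move=> [_ cl]; apply: nC; apply: zariski_closure_min cl; first exact: clC.
  move=> _ [w ->]; apply: inC => // i ki; by rewrite /trunc ltnNge ki.
split; last by exists (zariski_closure (Y k)) => //; exact: zariski_closure_closed.
split; first by exists (I (trunc k (fun=> 0))); split=> //; apply: zariski_closure_sub => //; eexists.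
move=> C1 C2 c1 c2 sub.
have sY : Y k `<=` X `&` zariski_closure (Y k).
  by move=> J YJ; split; [exact: YX YJ|exact: zariski_closure_sub].
by case: (Y_irr c1 c2 (subset_trans sY sub)) => h; [left|right] => J [_] cJ;
  apply: (zariski_closure_min _ h).
Qed.

End FamilyChain.

Definition dependent_locus t (g : 'I_t -> nat * nat) : set (set (fps2 K)) :=
  [set I | Hilb N I /\ exists2 c : 'rV[K]_t, c != 0 &
     I (\sum_k c 0 k *: fps2_monomial K (g k).1 (g k).2)].

(** Dependence of the monomials in the quotient is a rank condition on the corresponding rows of the
    frame matrix. *)
Lemma dependent_locus_closed t (g : 'I_t -> nat * nat) :
  (forall k, (g k).1 < N /\ (g k).2 < N)%N -> @Hilb_closed K N (dependent_locus g).
Proof.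
move=> hg; split=> [I []//|].
have idx_lt k : ((g k).1 * N + (g k).2 < monos)%N.
  by have [h1 h2] := hg k; rewrite (leq_trans (_ : _ < (g k).1.+1 * N)%N) ?leq_mul2r ?h1 ?orbT //
     mulSn addnC ltn_add2r.
pose idx k := Ordinal (idx_lt k).
have row_idx (phi : frame) k : row (idx k) (frame_mx phi) = phi (fps2_monomial K (g k).1 (g k).2).
  have [h1 h2] := hg k; rewrite rowK /=.
  by rewrite divnMDl ?(leq_ltn_trans _ h2) // divn_small // addn0 modnMDl modn_small.
pose S (A : 'M[K]_(monos, N)) := rowsub idx A.
(* Determinants of [S A] times an arbitrary [B] take the place of the maximal minors: if the rows of
   [S A] are independent, a right inverse [B] gives determinant 1. *)
exists [set p | exists B : 'M[K]_(N, t), forall A, p.@[mxcoords A] = \det (S A *m B)].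
move=> I phi HI hphi; rewrite /dependent_locus /=.
have combE (c : 'rV[K]_t) : c *m S (frame_mx phi) =
    phi (\sum_k c 0 k *: fps2_monomial K (g k).1 (g k).2).
  rewrite mulmx_sum_row raddf_sum; apply: eq_bigr => k _.
  by rewrite /= linearZ; congr (_ *: _); rewrite row_rowsub row_idx.
split=> [[_ [c cn0 /hphi.2]]|h].
  rewrite -combE => cS p [B hB]; rewrite frame_coordsE hB.
  apply/eqP; rewrite -[_ == 0]negbK -unitfE -unitmxE.
  apply: contra cn0 => u; rewrite -[c](mulmxK u) mulmxA cS.
  by rewrite !mul0mx.
split=> //; have [rf|nrf] := boolP (row_free (S (frame_mx phi))).
  have /row_freeP [B hB] := rf.
  have [p hp] : polyfun (fun x : coords => \det (S (coords_mx x) *m B)).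
    apply: polyfun_det; apply: polyfun_mulmx => i j; last exact: polyfun_cst.
    apply: (polyfun_ext (f := fun x => coords_mx x (idx i) j)) => [v|]; first by rewrite /S [RHS]mxE.
    by apply: polyfun_coords_mx => c; apply: polyfun_var.
  have /h : exists B, forall A, p.@[mxcoords A] = \det (S A *m B).
    by exists B => A; rewrite -hp mxcoordsK.
  by rewrite frame_coordsE -hp mxcoordsK hB det1 => /eqP; rewrite oner_eq0.
have : kermx (S (frame_mx phi)) != 0 by rewrite kermx_eq0.
case/rowV0Pn => c /sub_kermxP hc cn0; exists c => //.
by apply/hphi.2; rewrite -combE.
Qed.

End KrullDimensionBounds.

(** * Chain lengths bounded by transcendence degree *)

Section KrullDimensionUpperBound.
Local Open Scope ring_scope.
Local Open Scope classical_set_scope.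
Variables (K : closedFieldType) (charK0 : [pchar K]%R =i pred0) (N : nat).
Local Notation coords := ('I_(N * N * N) -> K).
Local Notation frame := {linear fps2 K -> 'rV[K]_N}.
Local Notation monos := (N * N)%N.

Definition frame_set (Z : set (set (fps2 K))) : set coords :=
  [set x | exists I (phi : frame), [/\ Z I, quotient_frame I phi & x = frame_coords phi]].

Lemma polyfun_mxcoords_mul n (A : ('I_n -> K) -> 'M[K]_(monos, N)) (g : ('I_n -> K) -> 'M[K]_N)
    (p : {mpoly K[monos * N]}) :
  (forall i j, polyfun (fun v => A v i j)) -> (forall i j, polyfun (fun v => g v i j)) ->
  polyfun (fun v => p.@[mxcoords (A v *m g v)]).
Proof.
by move=> hA hg; apply: polyfun_comp => i; apply: polyfun_mxcoords; apply: polyfun_mulmx.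
Qed.

Lemma polyfun_coords_var n m i j : polyfun (fun v : 'I_(n * m) -> K => coords_mx v i j).
Proof. by apply: polyfun_coords_mx => c; apply: polyfun_var. Qed.

(* The frames over a point form a GL_N-torsor, and GL_N is irreducible; so
   irreducibility passes from Z to its set of frames. *)
Lemma frame_set_integral Z (p q : {mpoly K[monos * N]}) :
  Z `<=` Hilb N -> irreducible_set (@Hilb_closed K N) Z ->
  (forall x, frame_set Z x -> p.@[x] * q.@[x] = 0) ->
  (forall x, frame_set Z x -> p.@[x] = 0) \/ (forall x, frame_set Z x -> q.@[x] = 0).
Proof.
move=> ZH [_ irr] pq0.
have [|||h|h] := irr (zero_locus [set p]) (zero_locus [set q]) _ _ _.
- exact: zero_locus_closed.
- exact: zero_locus_closed.
- move=> I ZI; have [_ [phi hphi]] := ZH _ ZI.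
  have polyp (r : {mpoly K[monos * N]}) :
      polyfun (fun v : 'I_(N * N) -> K => r.@[mxcoords (frame_mx phi *m coords_mx v)]).
    apply: polyfun_mxcoords_mul => i j; first exact: polyfun_cst.
    exact: polyfun_coords_var.
  (* The factor [\det] turns an identity on invertible matrices into one on all matrices, where the
     irreducibility of affine space applies. *)
  have polyd : polyfun (fun v : 'I_(N * N) -> K => \det (coords_mx v)).
    by apply: polyfun_det => i j; apply: polyfun_coords_var.
  have inZ r : (forall v : 'I_(N * N) -> K, coords_mx v \in unitmx ->
      r.@[mxcoords (frame_mx phi *m coords_mx v)] = 0) -> zero_locus [set r] I.
    move=> hr; split=> [|psi hpsi _ ->]; first exact: ZH.
    have [g ug hg] := frame_mx_uniq hphi hpsi.
    by rewrite frame_coordsE hg -(mxcoordsK g) hr ?mxcoordsK.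
  case: (polyfun_integral charK0 (polyfun_mul polyd (polyp p)) (polyp q)) => [v|h|h].
  + have [u|nu] := boolP (coords_mx v \in unitmx); last first.
      by move: nu; rewrite unitmxE unitfE negbK => /eqP ->; rewrite !mul0r.
    rewrite -mulrA pq0 ?mulr0 //; exists I; exists (mulmxr (coords_mx v) \o phi : frame).
    split=> //; first exact: frame_mul.
    by rewrite frame_coordsE frame_mx_mul.
  + left; apply: inZ => v u; have /eqP := h v; rewrite mulf_eq0 => /orP[/eqP d0|/eqP//].
    by move: u; rewrite unitmxE unitfE d0 eqxx.
  + by right; apply: inZ => v _.
- by left=> x [I [phi [ZI hphi ->]]]; apply: (h I ZI).2 hphi _ _.
- by right=> x [I [phi [ZI hphi ->]]]; apply: (h I ZI).2 hphi _ _.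
Qed.

Definition alg_indep k (f : 'I_k -> {mpoly K[monos * N]}) (Y : set coords) :=
  forall p : {mpoly K[k]}, (forall x, Y x -> p.@[fun i => (f i).@[x]] = 0) -> p = 0.

Definition extend k (f : 'I_k -> {mpoly K[monos * N]}) p : 'I_k.+1 -> {mpoly K[monos * N]} :=
  fun i => oapp f p (insub (i : nat)).

Lemma meval_extend k (f : 'I_k -> {mpoly K[monos * N]}) q (p : {mpoly K[k.+1]}) x :
  p.@[fun i => (extend f q i).@[x]] =
  (map_poly (meval (fun i => (f i).@[x])) (muni p)).[q.@[x]].
Proof.
rewrite meval_muni; have -> : extend f q ord_max = q by rewrite /extend insubN //= ltnn.
congr (horner _ _); apply: eq_map_poly => r; apply: meval_eq => i.
by rewrite /extend /= insubT //= => hi; congr ((f _).@[_]); apply: val_inj.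
Qed.

(** After substitution a relation [p] becomes [q^m] times a cofactor, with [m] the order of [p] in
    the last variable. As [q] does not vanish identically on the irreducible [Z'], the cofactor
    does. On [Z], where [q = 0], only the lowest coefficient of the cofactor survives, which
    contradicts the independence of [f]. *)
Lemma alg_indep_extend k (f : 'I_k -> {mpoly K[monos * N]}) q (Z Z' : set (set (fps2 K))) :
  Z' `<=` Hilb N -> irreducible_set (@Hilb_closed K N) Z' -> Z `<=` Z' ->
  alg_indep f (frame_set Z) ->
  (forall x, frame_set Z x -> q.@[x] = 0) -> (exists2 x, frame_set Z' x & q.@[x] != 0) ->
  alg_indep (extend f q) (frame_set Z').
Proof.
move=> Z'H irr sub hf q0 [x0 Zx0 qx0] p hp.
apply: muni_eq0; apply/eqP; apply: contraT => nz.
have [m hm min] : exists2 m, (muni p)`_m != 0 & forall j, (j < m)%N -> (muni p)`_j = 0.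
  have ex : exists m, (muni p)`_m != 0 by exists (size (muni p)).-1; rewrite -lead_coefE lead_coef_eq0.
  case: (ex_minnP ex) => m hm hmin; exists m => // j jm; apply/eqP; apply: contraTT jm => /hmin.
  by rewrite -leqNgt.
pose s := size (muni p).
pose c (j : nat) (x : coords) := ((muni p)`_j).@[fun i => (f i).@[x]].
have cE x : p.@[fun i => (extend f q i).@[x]] = q.@[x] ^+ m * \sum_(j < s) c (m + j)%N x * q.@[x] ^+ j.
  rewrite meval_extend (horner_coef_wide (n := (m + s)%N)); last first.
    by rewrite (leq_trans (size_poly _ _)) // leq_addl.
  rewrite big_split_ord /= big1 ?add0r => [|i _]; last first.
    by rewrite coef_map /= min ?ltn_ord // meval0 mul0r.
  rewrite big_distrr /=; apply: eq_bigr => i _.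
  by rewrite coef_map /= exprD mulrCA.
have polyc j : polyfun (c j) by apply: polyfun_comp => i; apply: polyfun_meval.
have [r hr] : polyfun (fun x => \sum_(j < s) c (m + j)%N x * q.@[x] ^+ j).
  apply: polyfun_sum => j; apply: polyfun_mul => //; apply: polyfun_exp.
  exact: polyfun_meval.
have : (forall x, frame_set Z' x -> (q ^+ m).@[x] = 0) \/ (forall x, frame_set Z' x -> r.@[x] = 0).
  apply: frame_set_integral => // x Zx; rewrite -hr rmorphXn /= -cE; exact: hp.
case=> h.
  by have := h _ Zx0; rewrite rmorphXn /= => /eqP; rewrite expf_eq0 (negbTE qx0) andbF.
case/eqP: hm; apply: hf => x Zx.
have Z'x : frame_set Z' x.
  by have [I [phi [ZI hphi E]]] := Zx; exists I, phi; split=> //; apply: sub.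
have := h _ Z'x; rewrite -hr; have : (0 < s)%N by rewrite lt0n size_poly_eq0.
rewrite /c; case: (s) => // s' _; rewrite big_ord_recl addn0 expr0 mulr1 big1 ?addr0 //.
by move=> i _; rewrite q0 // expr0n mulr0.
Qed.

(** The frames of a single ideal form a copy of [GL_N], which carries [N^2] independent functions:
    with [L] a left inverse of the frame matrix, the entries of [L A] recover the group element. *)
Lemma alg_indep_point (Z : set (set (fps2 K))) I (phi : frame) :
  Z I -> quotient_frame I phi -> \rank (frame_mx phi) = N ->
  exists f : 'I_(N * N) -> {mpoly K[monos * N]}, alg_indep f (frame_set Z).
Proof.
move=> ZI hphi rk.
have /row_fullP [L hL] : row_full (frame_mx phi) by rewrite /row_full rk.
have poly_f (p : 'I_(N * N)) : polyfun (fun x : coords => mxcoords (L *m coords_mx x) p).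
  apply: polyfun_mxcoords; apply: polyfun_mulmx => i j; first exact: polyfun_cst.
  exact: polyfun_coords_var.
have [f hf] := choice poly_f.
exists f => p hp; apply: (mpoly_eq0_meval charK0).
have poly_d : polyfun (fun v : 'I_(N * N) -> K => \det (coords_mx v)).
  by apply: polyfun_det => i j; apply: polyfun_coords_var.
case: (polyfun_integral charK0 poly_d (polyfun_meval p)) => [v|h|//].
  have [u|nu] := boolP (coords_mx v \in unitmx); last first.
    by move: nu; rewrite unitmxE unitfE negbK => /eqP ->; rewrite mul0r.
  rewrite -[X in _ * X](_ : p.@[fun i => (f i).@[mxcoords (frame_mx phi *m coords_mx v)]] = _).
    rewrite hp ?mulr0 //; exists I; exists (mulmxr (coords_mx v) \o phi : frame).
    by split=> //; [exact: frame_mul|rewrite frame_coordsE frame_mx_mul].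
  apply: meval_eq => i; rewrite -hf mxcoordsK mulmxA hL mul1mx.
  by rewrite coords_mxK.
by have /eqP := h (mxcoords 1%:M); rewrite mxcoordsK det1 oner_eq0.
Qed.

(** Each strict inclusion adds a function independent of the earlier ones, so the frames over the
    top of the chain carry [e + N^2] independent functions. These frames are covered by finitely
    many polynomial maps in [d + N^2] variables, namely a point of a family and an invertible
    matrix; hence [e <= d]. *)
Lemma irreducible_chain_le (X : set (set (fps2 K))) d r
    (A : 'I_r -> ('I_d -> K) -> 'M[K]_(monos, N)) :
  (forall a i j, polyfun (fun u => A a u i j)) -> X `<=` Hilb N ->
  (forall I, X I -> exists (phi : frame) a u,
     [/\ quotient_frame I phi, frame_mx phi = A a u & \rank (frame_mx phi) = N]) ->
  forall e Z, irreducible_chain (@Hilb_closed K N) X e Z -> (e <= d)%N.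
Proof.
move=> polyA XH cover e Z [hZ hsub].
have ZX i : (i <= e)%N -> Z i `<=` X by move=> /hZ [_ [C _ ->]] I [].
have indep i : (i <= e)%N ->
    exists f : 'I_(i + N * N) -> {mpoly K[monos * N]}, alg_indep f (frame_set (Z i)).
  elim: i => [|i IH] hi.
    have [[[I ZI] _] _] := hZ 0%N hi.
    have [phi [a [u [hphi _ rk]]]] := cover _ (ZX _ hi _ ZI).
    exact: alg_indep_point ZI hphi rk.
  have [f hf] := IH (ltnW hi); have [sub nsub] := hsub i hi.
  have [_ [C [CH [E hE]] ZC]] := hZ i (ltnW hi).
  have [I ZI nCI] : exists2 I, Z i.+1 I & ~ C I.
    apply: contrapT => h; apply: nsub => I ZI; rewrite ZC; split; first exact: ZX ZI.
    by apply: contrapT => nC; apply: h; exists I.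
  have IH' := XH _ (ZX _ hi _ ZI); have [phi hphi] := IH'.2.
  have [q Eq nq] : exists2 q, E q & q.@[frame_coords phi] <> 0.
    apply: contrapT => h; apply: nCI; apply/(hE _ _ IH' hphi) => p Ep.
    by apply: contrapT => np; apply: h; exists p.
  exists (extend f q); apply: (alg_indep_extend _ _ sub hf) => //.
  - by move=> J /(ZX _ hi) /XH.
  - exact: (hZ _ hi).1.
  - move=> x [J [psi [ZJ hpsi ->]]]; move: ZJ; rewrite ZC => -[XJ CJ].
    exact: (hE _ _ (XH _ XJ) hpsi).1.
  - by exists (frame_coords phi); [exists I, phi|apply/eqP].
have [f hf] := indep e (leqnn e).
rewrite leqNgt; apply/negP => lt_de.
pose uu (v : 'I_(d + N * N) -> K) : 'I_d -> K := fun i => v (lshift _ i).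
pose gg (v : 'I_(d + N * N) -> K) : 'M[K]_N := coords_mx (fun i => v (rshift _ i)).
have polyP (x : 'I_r * 'I_(e + N * N)) :
    polyfun (fun v => (f x.2).@[mxcoords (A x.1 (uu v) *m gg v)]).
  apply: polyfun_mxcoords_mul => i j; last first.
    by apply: polyfun_coords_mx => c; apply: polyfun_var.
  have [p hp] := polyA x.1 i j; apply: (polyfun_ext (fun v => esym (hp (uu v)))).
  by apply: polyfun_comp => c; apply: polyfun_var.
have [P hP] := choice polyP.
have [|p pn0 p0] := @algebraic_dependence K (d + N * N) (e + N * N) r (fun a i => P (a, i)).
  by rewrite ltn_add2r.
case/eqP: pn0; apply: hf => x [I [psi [ZI hpsi ->]]].
have [phi [a [u [hphi hA _]]]] := cover _ (ZX _ (leqnn e) _ ZI).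
have [g ug hg] := frame_mx_uniq hphi hpsi.
pose v (i : 'I_(d + N * N)) := match fintype.split i with inl j => u j | inr j => mxcoords g j end.
rewrite -[RHS](p0 a v); apply: meval_eq => i; rewrite -hP /= frame_coordsE hg hA.
have -> : uu v = u by apply/funext => j; rewrite /uu /v (unsplitK (inl j)).
have -> // : gg v = g.
rewrite /gg -[RHS]mxcoordsK; congr coords_mx; apply/funext => j.
by rewrite /v (unsplitK (inr j)).
Qed.

End KrullDimensionUpperBound.

(** * Binary forms inside the power series ring *)

Section FormalPowerSeries.
Local Open Scope ring_scope.
Variable K : fieldType.
Implicit Types (f g h : fps2 K) (p q : {poly K}).

Lemma fps2_mulE f g i j : (f * g) i j =
  \sum_(a < i.+1) \sum_(b < j.+1) f a b * g (i - a)%N (j - b)%N.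
Proof.
have sumE (F : 'I_i.+1 -> fps K) : (\sum_(k < i.+1) F k) j = \sum_(k < i.+1) F k j.
  by elim/big_rec2: _ => //= k y ? _ <-.
by rewrite -[LHS]/((\sum_(k < i.+1) (f k * g (i - k)%N)) j) sumE.
Qed.

Lemma fps2_addE f g i j : (f + g) i j = f i j + g i j.
Proof. by []. Qed.

Lemma fps2_scaleE c f i j : (c *: f) i j = c * f i j.
Proof. by []. Qed.

Lemma fps2_sumE (J : Type) (r : seq J) (P : pred J) (F : J -> fps2 K) i j :
  (\sum_(k <- r | P k) F k) i j = \sum_(k <- r | P k) F k i j.
Proof.
elim: r => [|k r IH]; first by rewrite !big_nil.
by rewrite !big_cons; case: (P k); rewrite ?fps2_addE IH.
Qed.

Lemma fps2_oneE i j : (1 : fps2 K) i j = ((i == 0%N) && (j == 0%N))%:R.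
Proof.
rewrite -[LHS]/((fps_one (fps K)) i j) /fps_one; case: (i == 0%N) => //=.
Qed.

Lemma fps2_monomial_mulE a b f i j : (fps2_monomial K a b * f) i j =
  if (a <= i)%N && (b <= j)%N then f (i - a)%N (j - b)%N else 0.
Proof.
rewrite fps2_mulE; case: ifP => [/andP[ai bj]|ne].
  have ai' : (a < i.+1)%N by []. have bj' : (b < j.+1)%N by [].
  rewrite (bigD1 (Ordinal ai')) //= [X in _ + X]big1 ?addr0; last first.
    move=> k; rewrite -val_eqE /= => /negbTE nk; apply: big1 => l _.
    by rewrite /fps2_monomial nk mul0r.
  rewrite (bigD1 (Ordinal bj')) //= [X in _ + X]big1 ?addr0; last first.
    move=> k; rewrite -val_eqE /= => /negbTE nk.
    by rewrite /fps2_monomial nk andbF mul0r.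
  by rewrite /fps2_monomial !eqxx mul1r.
apply: big1 => k _; apply: big1 => l _; rewrite /fps2_monomial.
case: eqP => [ka|_]; last by rewrite mul0r.
case: eqP => [lb|_]; last by rewrite mul0r.
by move: ne; rewrite -ka -lb -ltnS ltn_ord -ltnS ltn_ord.
Qed.

Lemma fps2_monomialM a b c d :
  fps2_monomial K a b * fps2_monomial K c d = fps2_monomial K (a + c) (b + d).
Proof.
apply/funext => i; apply/funext => j; rewrite fps2_monomial_mulE /fps2_monomial.
case: ifP => [/andP[ai bj]|ne].
  by rewrite -(eqn_add2l a) -(eqn_add2l b (j - b)%N) !subnKC.
case: eqP => [ei|//]; case: eqP => [ej|//].
by move: ne; rewrite ei ej !leq_addr.
Qed.

Lemma fps2_monomial0 : fps2_monomial K 0 0 = 1.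
Proof. by apply/funext => i; apply/funext => j; rewrite fps2_oneE. Qed.

Definition fps2X := fps2_monomial K 1 0.
Definition fps2Y := fps2_monomial K 0 1.

Lemma fps2_monomialE a b : fps2_monomial K a b = fps2X ^+ a * fps2Y ^+ b.
Proof.
have -> : fps2X ^+ a = fps2_monomial K a 0.
  by elim: a => [|a IH]; rewrite ?expr0 ?fps2_monomial0 // exprS IH fps2_monomialM.
have -> : fps2Y ^+ b = fps2_monomial K 0 b.
  by elim: b => [|b IH]; rewrite ?expr0 ?fps2_monomial0 // exprS IH fps2_monomialM.
by rewrite fps2_monomialM addn0.
Qed.

(** The homogeneous component of degree [i], dehomogenised by [y = 1]. *)
Definition slice i f : {poly K} := \poly_(k < i.+1) f k (i - k)%N.

Lemma slice_is_linear i : linear (slice i).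
Proof.
move=> c f g; apply/polyP => k; rewrite coefD coefZ !coef_poly.
by case: ifP => // _; rewrite mulr0 addr0.
Qed.
HB.instance Definition _ i :=
  GRing.isLinear.Build K (fps2 K) {poly K} _ (slice i) (slice_is_linear i).

Lemma size_slice i f : (size (slice i f) <= i.+1)%N.
Proof. exact: size_poly. Qed.

Lemma coef_slice i f k : (k <= i)%N -> (slice i f)`_k = f k (i - k)%N.
Proof. by move=> h; rewrite coef_poly ltnS h. Qed.

Lemma slice_inj f g : (forall i, slice i f = slice i g) -> f = g.
Proof.
move=> h; apply/funext => a; apply/funext => b.
have := congr1 (fun p : {poly K} => p`_a) (h (a + b)%N).
by rewrite !coef_slice ?leq_addr // addKn.
Qed.

Lemma coef_slice_gt i f k : (i < k)%N -> (slice i f)`_k = 0.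
Proof. by move=> h; rewrite coef_poly ltnS leqNgt h. Qed.

Lemma slice_mul i f g : slice i (f * g) = \sum_(j < i.+1) slice j f * slice (i - j) g.
Proof.
pose c n k (u : fps2 K) : K := if (k <= n)%N then u k (n - k)%N else 0.
have cE n k u : (slice n u)`_k = c n k u by rewrite coef_poly ltnS.
apply/polyP => k; rewrite coef_sum cE.
under [RHS]eq_bigr => j _ do (rewrite coefM; under eq_bigr => a _ do rewrite !cE).
rewrite exchange_big /=.
(* For fixed exponents of [x], only the degrees [j] between [a] and [a + (i - k)] contribute, and
   [j - a] is then the exponent of [y] in the first factor. *)
have term (a : 'I_k.+1) : \sum_(j < i.+1) c j a f * c (i - j)%N (k - a)%N g =
    if (k <= i)%N then \sum_(b < (i - k).+1) f a b * g (k - a)%N (i - k - b)%N else 0.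
  case: leqP => ki; last first.
    apply: big1 => j _; rewrite /c; case: leqP => [aj|_]; last by rewrite mul0r.
    case: leqP => [h|_]; last by rewrite mulr0.
    have ak : (a <= k)%N by rewrite -ltnS.
    have ji : (j <= i)%N by rewrite -ltnS.
    by move: h; rewrite leqNgt; case/negP; lia.
  rewrite -(big_mkord xpredT (fun j => c j a f * c (i - j)%N (k - a)%N g)).
  have ak : (a <= k)%N by rewrite -ltnS.
  rewrite (big_cat_nat (n := a)) //=; last by rewrite leqW // (leq_trans ak).
  rewrite big_nat_cond big1 ?add0r; last first.
    by move=> j /andP[/andP[_ ja] _]; rewrite /c leqNgt ja mul0r.
  rewrite -{1}[nat_of_ord a]add0n big_addn.
  rewrite (big_cat_nat (n := (i - k).+1)) //=; last by lia.
  rewrite [X in _ + X]big_nat_cond [X in _ + X]big1 ?addr0; last first.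
    move=> j /andP[/andP[ja jb] _]; rewrite /c.
    by rewrite (_ : (k - a <= i - (j + a))%N = false) ?mulr0 //; apply/negbTE; lia.
  rewrite big_mkord; apply: eq_bigr => b _; rewrite /c leq_addl addnK.
  have hb : (b <= i - k)%N by rewrite -ltnS.
  rewrite ifT; last by lia.
  by congr (_ * g _ _); lia.
under [RHS]eq_bigr => a _ do rewrite term.
by rewrite /c; case: leqP => _; [rewrite fps2_mulE|rewrite big1].
Qed.

End FormalPowerSeries.

Section BinaryForms.
Local Open Scope ring_scope.
Variable K : fieldType.

(* A binary form sum_k p_k x^k y^(i-k) of degree i is encoded by the polynomial p,
   of size at most i + 1, obtained by setting y = 1. *)
Definition hform (A : algType K) (x y : A) i (p : {poly K}) : A :=
  \sum_(k < i.+1) p`_k *: (x ^+ k * y ^+ (i - k)).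

Section Algebra.
Variables (A : algType K) (x y : A).

Lemma hform_is_linear i : linear (hform x y i).
Proof.
move=> c p q; rewrite /hform scaler_sumr -big_split; apply: eq_bigr => k _ /=.
by rewrite coefD coefZ scalerDl scalerA.
Qed.
HB.instance Definition _ i :=
  GRing.isLinear.Build K {poly K} A _ (hform x y i) (hform_is_linear i).

Lemma hformXn i k : (k <= i)%N -> hform x y i 'X^k = x ^+ k * y ^+ (i - k).
Proof.
move=> ki; rewrite /hform (bigD1 (Ordinal (ki : (k < i.+1)%N))) //= big1 ?addr0.
  by rewrite coefXn eqxx scale1r.
by move=> j; rewrite -val_eqE /= coefXn => /negbTE ->; rewrite scale0r.
Qed.

Lemma hform1 i : hform x y i 1 = y ^+ i.
Proof. by rewrite -[1]/('X^0) hformXn // mul1r subn0. Qed.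

Lemma poly_sumXn n (p : {poly K}) : (size p <= n)%N -> p = \sum_(k < n) p`_k *: 'X^k.
Proof. by move=> h; rewrite -[LHS](take_poly_id h) /take_poly poly_def. Qed.

Hypothesis xy : x * y = y * x.

Lemma hformM i j (p q : {poly K}) : (size p <= i.+1)%N -> (size q <= j.+1)%N ->
  hform x y (i + j) (p * q) = hform x y i p * hform x y j q.
Proof.
move=> sp sq; rewrite [in LHS](poly_sumXn sp) [in LHS](poly_sumXn sq).
rewrite big_distrlr raddf_sum /= [RHS]big_distrlr /=; apply: eq_bigr => a _.
rewrite raddf_sum /=; apply: eq_bigr => b _.
rewrite -scalerAl -scalerAr -exprD !linearZ /= hformXn; last first.
  by apply: leq_add; rewrite -ltnS.
rewrite -scalerAl -scalerAr; congr (_ *: (_ *: _)).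
have ai : (a <= i)%N by rewrite -ltnS.
have bj : (b <= j)%N by rewrite -ltnS.
have -> : (i + j - (a + b) = (i - a) + (j - b))%N by lia.
rewrite !exprD -!mulrA; congr (_ * _); rewrite !mulrA; congr (_ * _).
by apply: commrX; apply/commr_sym/commrX/commr_sym.
Qed.

End Algebra.

Lemma hform_rmorph (A B : algType K) (f : {lrmorphism A -> B}) (x y : A) i p :
  f (hform x y i p) = hform (f x) (f y) i p.
Proof.
rewrite /hform raddf_sum; apply: eq_bigr => k _.
by rewrite /= linearZ rmorphM !rmorphXn.
Qed.

Lemma size_hform (a b : {poly K}) i (p : {poly K}) : (size a <= 2)%N -> (size b <= 2)%N ->
  (size (hform a b i p) <= i.+1)%N.
Proof.
move=> sa sb; rewrite /hform; apply: leq_trans (size_sum _ _ _) _.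
apply/bigmax_leqP => k _; apply: leq_trans (size_scale_leq _ _) _.
have ki : (k <= i)%N by rewrite -ltnS.
have hX (c : {poly K}) n : (size c <= 2)%N -> (size (c ^+ n) <= n.+1)%N.
  move=> sc; apply: leq_trans (size_poly_exp_leq _ _) _; rewrite ltnS.
  rewrite -[leqRHS]mul1n leq_mul2r; apply/orP; right.
  by move: sc; case: (size c) => [|[|[|]]].
apply: leq_trans (size_polyMleq _ _) _.
move: (hX a k sa) (hX b (i - k)%N sb); move: (size _) (size _) => u v; lia.
Qed.

Lemma slice_hform j i (p : {poly K}) : (size p <= i.+1)%N ->
  slice j (hform (fps2X K : fps2 K) (fps2Y K) i p) = if j == i then p else 0.
Proof.
move=> sp; apply/polyP => k.
have -> : hform (fps2X K : fps2 K) (fps2Y K) i p = fun a b => if (a + b == i)%N then p`_a else 0.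
  apply/funext => a; apply/funext => b; rewrite /hform fps2_sumE.
  under eq_bigr => k' _ do rewrite fps2_scaleE -fps2_monomialE /fps2_monomial.
  case: eqP => [<-|ne]; last first.
    apply: big1 => k' _; case: eqP => [e1|]; rewrite ?mulr0 //.
    case: eqP => [e2|]; rewrite ?mulr0 //; case: ne; rewrite e1 e2 subnKC //.
    by rewrite -ltnS.
  rewrite (bigD1 (inord a)) //= big1 ?addr0 => [|k' nk].
    by rewrite inordK ?ltnS ?leq_addr // addKn !eqxx mulr1.
  rewrite (_ : (a == k' :> nat) = false) ?mulr0 //.
  apply: contraNF nk => /eqP e; apply/eqP/val_inj; rewrite /= inordK // ?ltnS ?leq_addr //.
case: (leqP k j) => kj.
  by rewrite coef_slice // subnKC //; case: eqP; rewrite ?coef0.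
rewrite coef_slice_gt //; case: eqP => [ji|_]; rewrite ?coef0 //.
by rewrite nth_default // (leq_trans sp) // -ji.
Qed.

Lemma fps2_componentE d (f : fps2 K) :
  fps2_component d f = hform (fps2X K : fps2 K) (fps2Y K) d (slice d f).
Proof.
apply: slice_inj => i; rewrite slice_hform ?size_slice //.
apply/polyP => k; case: (leqP k i) => ki; last first.
  by rewrite coef_slice_gt //; case: eqP => [<-|]; rewrite ?coef0 // coef_slice_gt.
rewrite coef_slice // /fps2_component subnKC //; case: eqP => [id_|]; rewrite ?coef0 //.
by rewrite -id_ coef_slice.
Qed.

Definition ord_ge n (f : fps2 K) := forall a b, (a + b < n)%N -> f a b = 0.

Lemma ord_geP n f : ord_ge n f <-> forall i, (i < n)%N -> slice i f = 0.
Proof.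
split=> [h i hi|h a b hab]; last first.
  by have := congr1 (fun p : {poly K} => p`_a) (h _ hab); rewrite coef_slice ?leq_addr // addKn coef0.
apply/polyP => k; rewrite coef0; case: (leqP k i) => ki; last by rewrite coef_slice_gt.
by rewrite coef_slice // h // subnKC.
Qed.

Lemma ord_ge_decomp n f : ord_ge n f ->
  exists h : nat -> fps2 K, f = \sum_(a < n.+1) fps2X K ^+ a * fps2Y K ^+ (n - a) * h a.
Proof.
move=> hf.
(* The monomial [x^i y^j] is assigned to [x^n] if [i >= n], and to [x^i y^(n-i)] otherwise. *)
exists (fun a k l => if a == n then f (n + k)%N l else if k == 0%N then f a (n - a + l)%N else 0).
apply/funext => i; apply/funext => j; rewrite fps2_sumE.
under eq_bigr => a _ do rewrite -fps2_monomialE fps2_monomial_mulE.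
rewrite big_ord_recr /= eqxx subnn subn0 /=.
case: (leqP n i) => ni /=; rewrite ?andbT.
  rewrite big1 ?add0r ?subnKC // => a _; rewrite ltn_eqF // (_ : (i - a == 0)%N = false) ?if_same //.
  by apply/negbTE; have := ltn_ord a; lia.
rewrite addr0 (bigD1 (Ordinal ni)) //= leqnn /= subnn eqxx ltn_eqF // big1 ?addr0.
  case: leqP => h; first by rewrite subnKC.
  by rewrite hf //; lia.
move=> a; rewrite -val_eqE /= => na; case: ifP => // /andP[ai _].
rewrite ltn_eqF ?ltn_ord // (_ : (i - a == 0)%N = false) //.
by apply/negbTE; move: na ai; lia.
Qed.

End BinaryForms.

(** * Homogeneous ideals and graded algebras *)

Section HomogeneousFrames.
Local Open Scope ring_scope.
Variable K : fieldType.

(* phi i presents the degree-i part of a homogeneous ideal as the kernel of a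
   surjection from the binary forms of degree i onto K^(t_i). *)
Definition hframe (T : seq nat) (phi : forall i, 'M[K]_(i.+1, nth 0%N T i)) : Prop :=
  (forall i, \rank (phi i) = nth 0%N T i) /\
  (forall i (p : {poly K}), (size p <= i.+1)%N -> poly_rV p *m phi i = 0 ->
     poly_rV p *m phi i.+1 = 0 /\ poly_rV ('X * p) *m phi i.+1 = 0).

Definition frame_ideal T (phi : forall i, 'M[K]_(i.+1, nth 0%N T i)) : set (fps2 K) :=
  [set f | forall i, poly_rV (slice i f) *m phi i = 0].

Lemma hframe_mulXn T (phi : forall i, 'M[K]_(i.+1, nth 0%N T i)) i j k (p : {poly K}) :
  hframe phi -> (k <= j)%N -> (size p <= i.+1)%N -> poly_rV p *m phi i = 0 ->
  poly_rV ('X^k * p) *m phi (j + i)%N = 0 .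
Proof.
move=> [_ h]; elim: j k => [|j IH] k kj sp hp.
  by move: kj; rewrite leqn0 => /eqP ->; rewrite expr0 mul1r.
have sX k' : (k' <= j)%N -> (size ('X^k' * p)%R <= (j + i).+1)%N.
  move=> kj'; apply: leq_trans (size_polyMleq _ _) _; rewrite size_polyXn.
  by move: sp; move: (size _) => u; lia.
case: k kj => [|k] kj.
  by have [h1 _] := h _ _ (sX 0%N isT) (IH 0%N isT sp hp).
by have [_ h2] := h _ _ (sX k kj) (IH k kj sp hp); rewrite exprS -mulrA.
Qed.

Lemma hframe_mul T (phi : forall i, 'M[K]_(i.+1, nth 0%N T i)) i j (p q : {poly K}) :
  hframe phi -> (size p <= i.+1)%N -> (size q <= j.+1)%N -> poly_rV p *m phi i = 0 ->
  poly_rV (q * p) *m phi (j + i)%N = 0.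
Proof.
move=> h sp sq hp; rewrite (poly_sumXn sq) mulr_suml raddf_sum mulmx_suml big1 // => k _.
rewrite -scalerAl /= linearZ -scalemxAl hframe_mulXn ?scaler0 //.
by rewrite -ltnS.
Qed.

Lemma frame_ideal_ideal T (phi : forall i, 'M[K]_(i.+1, nth 0%N T i)) :
  hframe phi -> fps2_ideal (frame_ideal phi).
Proof.
move=> h; split=> [i|f g hf hg i|f g hg i].
- by rewrite raddf0 raddf0 mul0mx.
- by rewrite !raddfD /= mulmxDl hf hg addr0.
rewrite slice_mul raddf_sum mulmx_suml big1 // => j _.
have := hframe_mul h (size_slice (i - j) g) (size_slice j f) (hg (i - j)%N).
by rewrite subnKC // -ltnS.
Qed.

Lemma frame_ideal_homogeneous T (phi : forall i, 'M[K]_(i.+1, nth 0%N T i)) :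
  fps2_homogeneous (frame_ideal phi).
Proof.
move=> f d hf i; rewrite fps2_componentE slice_hform ?size_slice //.
by case: eqP => [->|_]; rewrite ?raddf0 ?mul0mx.
Qed.

Lemma kernel_frame n t (U : {vspace 'rV[K]_n}) : (\dim U + t = n)%N ->
  exists2 A : 'M[K]_(n, t), \rank A = t & forall v, v *m A = 0 <-> v \in U.
Proof.
move=> dimU; pose B := \matrix_(j < \dim U) (vbasis U)`_j.
have inB v : (v <= B)%MS = (v \in U).
  apply/submxP/idP => [[D ->]|/coord_vbasis vU].
    rewrite mulmx_sum_row; apply: memv_suml => j _; rewrite rowK; apply: memvZ.
    by apply: vbasis_mem; rewrite mem_nth // size_tuple.
  exists (\row_j coord (vbasis U) j v); rewrite mulmx_sum_row [LHS]vU.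
  by apply: eq_bigr => j _; rewrite mxE rowK.
have rB : \rank B = \dim U.
  apply/eqP; rewrite -/(row_free B) -kermx_eq0; apply/rowV0P => v /sub_kermxP.
  rewrite mulmx_sum_row => h; apply/rowP => j; rewrite mxE.
  have /freeP := basis_free (vbasisP U); apply.
  by rewrite -[RHS]h; apply: eq_bigr => k _; rewrite rowK.
have rC : \rank (cokermx B) = t by rewrite mxrank_coker rB; lia.
move: t dimU rC => t dimU rC; subst t.
exists (col_base (cokermx B)) => [|v].
  exact/eqP/col_base_full.
have -> : (v \in U) = (v *m col_base (cokermx B) *m row_base (cokermx B) == 0).
  by rewrite -inB submxE -mulmxA mulmx_base.
split=> [->|/eqP h]; first by rewrite mul0mx.
have /row_freeP [D hD] := row_base_free (cokermx B).
by rewrite -[LHS]mulmx1 -hD mulmxA h mul0mx.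
Qed.

Section HomogeneousQuotient.
Variables (R : falgType K) (psi : {lrmorphism fps2 K -> R}).
Hypothesis surj : forall r, exists f, psi f = r.
Hypothesis hom : fps2_homogeneous [set f | psi f = 0].

Local Notation x := (psi (fps2X K)).
Local Notation y := (psi (fps2Y K)).

Lemma quotient_comm : commutative (@GRing.mul R).
Proof.
by move=> a b; have [f <-] := surj a; have [g <-] := surj b; rewrite -!rmorphM mulrC.
Qed.

Lemma psi_hform i (p : {poly K}) : psi (hform (fps2X K : fps2 K) (fps2Y K) i p) = hform x y i p.
Proof. exact: hform_rmorph. Qed.

(** Finite dimension gives a linear relation between the powers of [psi z]. As the kernel is
    homogeneous and the powers of [z] lie in distinct degrees, each term of the relation is in the
    kernel. *)
Lemma nilpotent_var (z : fps2 K) :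
  (forall n, z ^+ n = fps2_component n (z ^+ n)) ->
  (forall m n, m != n -> fps2_component m (z ^+ n) = 0) -> exists n, psi z ^+ n = 0.
Proof.
move=> h1 h2; pose n := (\dim {:R}).+1.
pose F (v : 'rV[K]_n) := \sum_(k < n) v 0 k *: psi z ^+ k.
have linF : linear F.
  move=> c u v; rewrite /F scaler_sumr -big_split; apply: eq_bigr => k _.
  by rewrite !mxE scalerDl scalerA.
pose lF : {linear 'rV[K]_n -> R} := HB.pack F (GRing.isLinear.Build _ _ _ _ F linF).
have /eqP : lker (linfun lF) != 0%VS.
  apply/eqP => h; have := limg_ker_dim (linfun lF) fullv.
  rewrite capfv h dimv0 add0n dimvf dim_matrix mul1r => e.
  by have := dimvS (subvf (limg (linfun lF))); rewrite e ltnn.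
move=> nz; have := memv_pick (lker (linfun lF)).
rewrite memv_ker lfunE /= => /eqP h.
have : vpick (lker (linfun lF)) != 0 by rewrite vpick0; apply/eqP.
case/rV0Pn => k vk; exists k.
set v := vpick _ in h vk.
have : psi (\sum_(k < n) v 0 k *: z ^+ k) = 0.
  by rewrite raddf_sum -[RHS]h; apply: eq_bigr => j _; rewrite /= linearZ rmorphXn.
move/(hom k); rewrite /= (_ : fps2_component _ _ = v 0 k *: z ^+ k).
  rewrite linearZ rmorphXn => /eqP; rewrite scaler_eq0 (negbTE vk) => /eqP.
  by [].
rewrite fps2_componentE raddf_sum raddf_sum /= (bigD1 k) //= [X in _ + X]big1 ?addr0.
  by rewrite !linearZ /= -fps2_componentE -h1.
by move=> j nj; rewrite !linearZ /= -fps2_componentE h2 ?scaler0 // eq_sym.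
Qed.

Lemma nilpotent_bound : exists L, forall a b, (L <= a + b)%N -> x ^+ a * y ^+ b = 0.
Proof.
have compE m a b : fps2_component m (fps2_monomial K a b) =
    if m == (a + b)%N then fps2_monomial K a b else 0.
  have E i j : fps2_component m (fps2_monomial K a b) i j =
      if m == (a + b)%N then fps2_monomial K a b i j else 0.
    rewrite /fps2_component /fps2_monomial.
    case: (i =P a) => [->|_]; last by rewrite /= !if_same.
    case: (j =P b) => [->|_]; last by rewrite /= !if_same.
    by rewrite eq_sym.
  by apply/funext => i; apply/funext => j; rewrite E; case: eqP.
have [m hm] : exists n, x ^+ n = 0.
  apply: nilpotent_var => [n|m n ne];
    rewrite -[_ ^+ n]mulr1 -(expr0 (fps2Y K)) -fps2_monomialE compE addn0.
    by rewrite eqxx.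
  by rewrite (negbTE ne).
have [n hn] : exists n, y ^+ n = 0.
  apply: nilpotent_var => [n|k n ne];
    rewrite -[_ ^+ n]mul1r -(expr0 (fps2X K)) -fps2_monomialE compE add0n.
    by rewrite eqxx.
  by rewrite (negbTE ne).
exists (m + n)%N => a b ab; case: (leqP m a) => ma.
  by rewrite -(subnK ma) exprD hm mulr0 mul0r.
have nb : (n <= b)%N by lia.
by rewrite -(subnK nb) exprD hn !mulr0.
Qed.

(** This replaces continuity of [psi], which is only assumed to be an algebra morphism: it reduces
    every statement on power series to finitely many homogeneous components. *)
Lemma psi_ord_ge : exists L, forall f, ord_ge L f -> psi f = 0.
Proof.
have [L hL] := nilpotent_bound; exists L => f /ord_ge_decomp [h ->].
rewrite raddf_sum big1 // => a _; rewrite /= !rmorphM !rmorphXn hL ?mul0r //.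
by rewrite subnKC // -ltnS.
Qed.

Lemma hform_psi_eq0 f i : psi f = 0 -> hform x y i (slice i f) = 0.
Proof. by move/(hom i); rewrite /= fps2_componentE psi_hform. Qed.

Lemma ord_ge_sub_forms L f :
  ord_ge L (f - \sum_(i < L) hform (fps2X K : fps2 K) (fps2Y K) i (slice i f)).
Proof.
apply/ord_geP => i iL; rewrite raddfB raddf_sum /= (bigD1 (Ordinal iL)) //=.
rewrite slice_hform ?size_slice // eqxx big1 ?addr0 ?subrr // => j.
by rewrite -val_eqE /= => ne; rewrite slice_hform ?size_slice // eq_sym (negbTE ne).
Qed.

Lemma psi_expand : exists L, forall n f, (L <= n)%N ->
  psi f = \sum_(i < n) hform x y i (slice i f).
Proof.
have [L hL] := psi_ord_ge; exists L => n f Ln; apply/eqP; rewrite -subr_eq0; apply/eqP.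
have := @ord_ge_sub_forms n f => /(fun h a b hab => h a b (leq_trans hab Ln)) /hL.
rewrite raddfB raddf_sum /= => E; rewrite -[RHS]E; congr (_ - _).
by apply: eq_bigr => i _; rewrite psi_hform.
Qed.

Lemma psi_eq0 f : psi f = 0 <-> forall i, hform x y i (slice i f) = 0.
Proof.
split=> [h i|h]; first exact: hform_psi_eq0.
by have [L hL] := psi_expand; rewrite (hL L) // big1.
Qed.

Definition formL i : 'Hom('rV[K]_i.+1, R) := linfun (hform x y i \o rVpoly).

Lemma formLE i (p : {poly K}) : (size p <= i.+1)%N -> formL i (poly_rV p) = hform x y i p.
Proof. by move=> sp; rewrite lfunE /= poly_rV_K. Qed.

Definition degree_part i : {vspace R} := limg (formL i).

Lemma degree_partP i u :
  reflect (exists2 p : {poly K}, (size p <= i.+1)%N & u = hform x y i p) (u \in degree_part i).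
Proof.
apply: (iffP idP) => [/memv_imgP [v _ ->]|[p sp ->]].
  by exists (rVpoly v); rewrite ?size_poly // lfunE.
by rewrite -formLE // memv_img // memvf.
Qed.

Lemma degree_part_mul i j u v :
  u \in degree_part i -> v \in degree_part j -> u * v \in degree_part (i + j).
Proof.
move=> /degree_partP [p sp ->] /degree_partP [q sq ->]; apply/degree_partP.
exists (p * q); last by rewrite hformM //; apply: quotient_comm.
by apply: leq_trans (size_polyMleq _ _) _; move: sp sq; move: (size _) (size _) => a b; lia.
Qed.

Lemma degree_part_eq0 : exists L, forall i, (L <= i)%N -> degree_part i = 0%VS.
Proof.
have [L hL] := psi_ord_ge; exists L => i Li; apply/eqP; rewrite -subv0; apply/subvP => u.
case/degree_partP => p sp ->; rewrite memv0 -psi_hform hL //.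
by apply/ord_geP => j jL; rewrite slice_hform // ltn_eqF // (leq_trans jL).
Qed.

Lemma dim_degree_part i :
  (\dim (degree_part i) + \dim (lker (formL i)) = i.+1)%N.
Proof.
have := limg_ker_dim (formL i) fullv; rewrite capfv addnC => ->.
by rewrite dimvf dim_matrix mul1r.
Qed.

(** For large [L], the image of the ideal [(x,y)^i]; the truncation only keeps the sum finite, since
    the components vanish in high degree. *)
Definition order_part L i : {vspace R} := (\sum_(j < L | (i <= j)%N) degree_part j)%VS.

Lemma order_partP : exists L, forall n i u, (L <= n)%N ->
  (u \in order_part n i) <-> exists2 f, ord_ge i f & u = psi f.
Proof.
have [L hL] := psi_expand; exists L => n i u Ln; split.
  case/memv_sumP => v hv ->.
  have ex (j : 'I_n) : exists p : {poly K}, (i <= j)%N ->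
      (size p <= j.+1)%N /\ v j = hform x y j p.
    case: (leqP i j) => ij; last by exists 0.
    by have /degree_partP [p sp e] := hv j ij; exists p.
  have [p hp] := choice ex.
  exists (\sum_(j < n | (i <= j)%N) hform (fps2X K : fps2 K) (fps2Y K) j (p j)).
    apply/ord_geP => k ki; rewrite raddf_sum big1 // => j ij /=.
    by rewrite slice_hform ?(hp j ij).1 // ltn_eqF // (leq_trans ki).
  by rewrite raddf_sum; apply: eq_bigr => j ij; rewrite /= psi_hform (hp j ij).2.
case=> f hf ->; rewrite (hL n) //.
rewrite (bigID (fun j : 'I_n => (i <= j)%N)) /= [X in _ + X]big1 ?addr0; last first.
  by move=> j; rewrite -ltnNge => ji; move/ord_geP: hf => /(_ _ ji) ->; rewrite raddf0.
apply: memv_sumr => j ij; apply/degree_partP; exists (slice j f) => //.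
exact: size_slice.
Qed.

End HomogeneousQuotient.
End HomogeneousFrames.

Section GradedAlgebras.
Local Open Scope ring_scope.
Variable K : fieldType.

Lemma maximal_ideal_uniq (R : falgType K) (m m' : {vspace R}) :
  is_maximal_ideal m -> is_maximal_ideal m' -> m = m'.
Proof.
move=> [i1 n1 h1] [i2 n2 h2]; apply/eqP; rewrite eqEsubv; apply/andP; split.
  exact: h2.
exact: h1.
Qed.

(** An element with nonzero scalar part is a unit, by the geometric series of its nilpotent part, so
    a proper ideal must lie in [S]. *)
Lemma nil_ideal_maximal (R : falgType K) (S : {vspace R}) :
  is_ideal S -> (forall u, u \in S -> exists n, u ^+ n = 0) ->
  ({:R} <= 1 + S)%VS -> is_maximal_ideal S.
Proof.
move=> idS nilS fullS; split=> //.
  move=> E; have [n] := nilS 1 ltac:(by rewrite E memvf).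
  by rewrite expr1n => /eqP; rewrite oner_eq0.
move=> J idJ nJ; apply/subvP => u uJ.
have /memv_addP [c /vlineP [k ->] [s sS uE]] : u \in (1 + S)%VS by apply: (subvP fullS); rewrite memvf.
have [k0|k0] := eqVneq k 0; first by rewrite uE k0 scale0r add0r.
case: nJ; apply/eqP; rewrite eqEsubv subvf /=; apply/subvP => v _.
pose w := - (k^-1 *: s).
have [n hn] : exists n, w ^+ n = 0 by apply: nilS; rewrite rpredN memvZ.
have E1 : (\sum_(i < n) w ^+ i) * (k^-1 *: u) = 1.
  have -> : k^-1 *: u = 1 - w.
    by rewrite uE scalerDr scalerA mulVf // scale1r opprK.
  have C : GRing.comm (1 - w) (\sum_(i < n) w ^+ i).
    apply: commr_sum => i _; apply: commrX; apply: commr_sym; apply: commrB.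
      exact: commr1.
    exact: commr_refl.
  rewrite -C; have /= := subrX1 w n; rewrite hn sub0r => /(congr1 -%R).
  by rewrite opprK -mulNr opprB => <-.
rewrite -[v]mulr1 -E1 mulrA -scalerAr memvZ //; apply: (subvP idJ).
by rewrite memv_mul // memvf.
Qed.

Lemma memv_expv (R : falgType K) (U : {vspace R}) u n : u \in U -> u ^+ n \in (U ^+ n)%VS.
Proof.
by move=> uU; elim: n => [|n IH]; rewrite ?expr0 ?expv0 ?memv_line // exprS expvSl memv_mul.
Qed.

Lemma ord_geM i j (f g : fps2 K) : ord_ge i f -> ord_ge j g -> ord_ge (i + j) (f * g).
Proof.
move=> /ord_geP hf /ord_geP hg; apply/ord_geP => k kij; rewrite slice_mul big1 // => a _.
case: (ltnP a i) => ai; first by rewrite hf ?mul0r.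
by rewrite hg ?mulr0 //; have := ltn_ord a; lia.
Qed.

Lemma ord_ge_var (f : fps2 K) : f = fps2X K \/ f = fps2Y K -> ord_ge 1 f.
Proof. by case=> -> [|a] [|b]. Qed.

Section HomogeneousQuotient.
Variables (R : falgType K) (psi : {lrmorphism fps2 K -> R}).
Hypothesis surj : forall r, exists f, psi f = r.
Hypothesis hom : fps2_homogeneous [set f | psi f = 0].

Local Notation x := (psi (fps2X K)).
Local Notation y := (psi (fps2Y K)).
Local Notation E := (degree_part psi).

(** Packages the filtration by order together with one bound [n] past which everything vanishes, so
    that no truncation has to be carried along later. *)
Lemma order_filtration : exists (Q : nat -> {vspace R}) n,
  [/\ forall i u, u \in Q i <-> exists2 f, ord_ge i f & u = psi f,
      forall f, ord_ge n f -> psi f = 0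
    & forall i, (n <= i)%N -> E i = 0%VS].
Proof.
have [L1 h1] := order_partP hom; have [L2 h2] := psi_ord_ge hom.
have [L3 h3] := degree_part_eq0 hom.
exists (order_part psi (L1 + L2 + L3)), (L1 + L2 + L3)%N; split=> [i u|f hf|i hi].
- by apply: h1; lia.
- by apply: h2 => a b ab; apply: hf; lia.
- by apply: h3; lia.
Qed.

Section Filtration.
Variables (Q : nat -> {vspace R}) (n : nat).
Hypothesis QP : forall i u, u \in Q i <-> exists2 f, ord_ge i f & u = psi f.
Hypothesis psi0 : forall f, ord_ge n f -> psi f = 0.

Lemma filtration_mul i j u v : u \in Q i -> v \in Q j -> u * v \in Q (i + j).
Proof.
move=> /QP [f hf ->] /QP [g hg ->]; apply/QP; exists (f * g); first exact: ord_geM.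
by rewrite rmorphM.
Qed.

Lemma filtration0 : Q 0 = fullv.
Proof.
apply/eqP; rewrite eqEsubv subvf; apply/subvP => u _; apply/QP.
by have [f <-] := surj u; exists f.
Qed.

Lemma filtration_ideal i : is_ideal (Q i).
Proof.
by apply/prodvP => u v _ vQ; apply: (@filtration_mul 0 i) => //; rewrite filtration0 memvf.
Qed.

Lemma filtration_maximal : is_maximal_ideal (Q 1).
Proof.
apply: nil_ideal_maximal; first exact: filtration_ideal.
  move=> _ /QP [f hf ->]; exists n; rewrite -(rmorphXn psi) /= psi0 //.
  suff H k : ord_ge k (f ^+ k) by apply: H.
  by elim: k => [|k IH] //; rewrite exprS; apply: (@ord_geM 1 k).
apply/subvP => u _; have [f <-] := surj u.
have -> : f = f 0%N 0%N *: 1 + (f - f 0%N 0%N *: 1) by rewrite addrC subrK.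
rewrite raddfD /= linearZ rmorph1; apply: memv_add; first by rewrite memvZ ?memv_line.
apply/QP; eexists; last by []; move=> [|a] [|b] // _.
by rewrite fps2_addE -scaleNr fps2_scaleE fps2_oneE mulr1 subrr.
Qed.

Lemma ideal_pow_filtration i : ideal_pow (Q 1) i = Q i.
Proof.
apply/eqP; rewrite eqEsubv; apply/andP; split.
  have H : (Q 1 ^+ i <= Q i)%VS.
    elim: i => [|i IH]; first by rewrite filtration0 subvf.
    rewrite expvSl; apply/prodvP => u v uQ vQ.
    by apply: (@filtration_mul 1 i) => //; apply: (subvP IH).
  by apply: subv_trans (prodvSr _ H) _; apply: filtration_ideal.
apply/subvP => u /QP [f /ord_ge_decomp [h ->] ->].
rewrite raddf_sum; apply: memv_suml => a _; rewrite /= mulrC rmorphM.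
apply: memv_mul; first exact: memvf.
have xQ : x \in Q 1 by apply/QP; exists (fps2X K) => //; apply: ord_ge_var; left.
have yQ : y \in Q 1 by apply/QP; exists (fps2Y K) => //; apply: ord_ge_var; right.
have ai : (a <= i)%N by rewrite -ltnS.
rewrite rmorphM !rmorphXn (_ : (Q 1 ^+ i)%VS = (Q 1 ^+ a * Q 1 ^+ (i - a))%VS).
  by rewrite memv_mul // memv_expv.
by rewrite -expvD subnKC.
Qed.

Lemma dim_filtration i : (\dim (Q i) = \dim (E i) + \dim (Q i.+1))%N.
Proof.
have dir : (E i :&: Q i.+1 = 0)%VS.
  apply/eqP; rewrite -subv0; apply/subvP => u; rewrite memv_cap => /andP[].
  move=> /degree_partP [p sp ->] /QP [f hf]; rewrite -psi_hform => e.
  have : psi (hform (fps2X K : fps2 K) (fps2Y K) i p - f) = 0 by rewrite raddfB /= e subrr.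
  move/(hform_psi_eq0 hom i); rewrite raddfB /= slice_hform // eqxx.
  by move/ord_geP: hf => -> //; rewrite subr0 psi_hform memv0 => ->.
rewrite -(dimv_disjoint_sum dir); congr (\dim _); apply/eqP; rewrite eqEsubv; apply/andP; split.
  apply/subvP => u /QP [f hf ->].
  have -> : f = hform (fps2X K : fps2 K) (fps2Y K) i (slice i f) +
       (f - hform (fps2X K : fps2 K) (fps2Y K) i (slice i f)) by rewrite addrC subrK.
  rewrite raddfD /=; apply: memv_add.
    by rewrite psi_hform; apply/degree_partP; eexists; [|by []]; exact: size_slice.
  apply/QP; eexists; last by []; apply/ord_geP => j; rewrite ltnS leq_eqVlt => /orP[/eqP ->|ji].
    by rewrite raddfB /= slice_hform ?size_slice // eqxx subrr.
  rewrite raddfB /= slice_hform ?size_slice // (ltn_eqF ji) subr0.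
  by move/ord_geP: hf => ->.
rewrite subv_add; apply/andP; split; apply/subvP => u.
  move=> /degree_partP [p sp ->]; apply/QP; rewrite -psi_hform; eexists; last by [].
  by apply/ord_geP => j ji; rewrite slice_hform // (ltn_eqF ji).
move=> /QP [f hf ->]; apply/QP; exists f => // a b ab; apply: hf; exact: ltnW.
Qed.

End Filtration.

(** The powers of the maximal ideal are the steps [Q i] of the order filtration, and [Q i] is the
    direct sum of [E i] and [Q i.+1]; so the sequence of a graded quotient is read off degree by
    degree. *)
Lemma HilbertSamuel_degree_part T :
  has_HilbertSamuel R T <-> 0%N \notin T /\ forall i, nth 0%N T i = \dim (E i).
Proof.
have [Q [n [QP psi0 _]]] := order_filtration; split=> [[_ [T0 [m hm h]]]|[T0 h]].
  split=> // i; rewrite h (maximal_ideal_uniq hm (filtration_maximal QP psi0)).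
  by rewrite !(ideal_pow_filtration QP) (dim_filtration QP i) addnK.
split; first exact: quotient_comm surj.
split=> //; exists (Q 1); first exact: filtration_maximal QP psi0.
by move=> i; rewrite !(ideal_pow_filtration QP) (dim_filtration QP i) addnK.
Qed.

Lemma hframe_of_quotient T : has_HilbertSamuel R T ->
  exists2 phi : (forall i, 'M[K]_(i.+1, nth 0%N T i)), hframe phi &
    forall f, psi f = 0 <-> frame_ideal phi f.
Proof.
move=> /HilbertSamuel_degree_part [_ hT].
have ex i : exists2 A : 'M[K]_(i.+1, nth 0%N T i), \rank A = nth 0%N T i &
    forall v, v *m A = 0 <-> v \in lker (formL psi i).
  by apply: kernel_frame; rewrite hT addnC dim_degree_part.
pose phi i := s2val (cid2 (ex i)).
have phiP i (p : {poly K}) : (size p <= i.+1)%N ->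
    poly_rV p *m phi i = 0 <-> hform x y i p = 0.
  move=> sp; rewrite (s2valP' (cid2 (ex i))) memv_ker formLE //.
  by split=> [/eqP|->].
exists phi; last first.
  move=> f; rewrite (psi_eq0 hom).
  by split=> h i; apply/phiP; rewrite ?size_slice.
split=> [i|i p sp]; first exact: (s2valP (cid2 (ex i))).
move=> /(phiP _ _ sp) h0; have xy : x * y = y * x by exact: quotient_comm.
have sX : (size ('X * p)%R <= i.+2)%N.
  by rewrite (leq_trans (size_polyMleq _ _)) // size_polyX.
split; apply/phiP; rewrite ?(leq_trans sp) //.
  by rewrite -[p]mul1r -add1n hformM ?size_poly1 // h0 mulr0.
by rewrite -add1n hformM ?size_polyX // h0 mulr0.
Qed.

Lemma quotient_standard_graded : standard_graded R.
Proof.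
have [Q [n [QP psi0 E0]]] := order_filtration.
have [L hL] := psi_expand hom.
pose N := (n + L)%N.
have fullE : (\sum_(i < N) E i)%VS = fullv.
  apply/eqP; rewrite eqEsubv subvf; apply/subvP => u _; have [f <-] := surj u.
  rewrite (hL N) ?leq_addl //; apply: memv_sumr => i _; apply/degree_partP.
  by exists (slice i f) => //; apply: size_slice.
exists E, N; split=> //.
- by move=> i Ni; apply: E0; apply: leq_trans Ni; apply: leq_addr.
- apply/directv_sum_independent => u hu u0 i _.
  have ex (j : 'I_N) : exists p : {poly K}, (size p <= j.+1)%N /\ u j = hform x y j p.
    by have /degree_partP [q sq e] := hu j isT; exists q.
  have [p hp] := choice ex.
  have : psi (\sum_(i < N) hform (fps2X K : fps2 K) (fps2Y K) i (p i)) = 0.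
    rewrite raddf_sum -[RHS]u0; apply: eq_bigr => j _ /=.
    by rewrite psi_hform (hp j).2.
  move/(hform_psi_eq0 hom i); rewrite raddf_sum (bigD1 i) //= slice_hform ?(hp i).1 //.
  rewrite eqxx big1 ?addr0 ?(hp i).2 // => j; rewrite -val_eqE /= => ne.
  by rewrite slice_hform ?(hp j).1 // eq_sym (negbTE ne).
- move=> i j; apply/prodvP => u v; exact: degree_part_mul.
apply/eqP; rewrite eqEsubv subvf -fullE; apply/subv_sumP => i _; apply/subvP => u.
case/degree_partP => p sp ->; apply: memv_suml => k _; apply: memvZ.
have A1 (q : {poly K}) : (size q <= 2)%N -> hform x y 1 q \in agenv (E 1).
  move=> sq; apply: (subvP (sub_agenv _)); apply/degree_partP; by exists q.
have xA : x \in agenv (E 1).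
  have <- : hform x y 1 'X = x by rewrite -['X]expr1 hformXn // subnn mulr1.
  by apply: A1; rewrite size_polyX.
have yA : y \in agenv (E 1).
  have <- : hform x y 1 1 = y by rewrite hform1.
  by apply: A1; rewrite size_poly1.
have XA z m : z \in agenv (E 1) -> z ^+ m \in agenv (E 1).
  move=> hz; elim: m => [|m IH]; last by rewrite exprS memvM.
  by apply: (subvP (_ : (1 <= agenv (E 1))%VS)); [rewrite agenvEl addvSl|rewrite memv_line].
by rewrite memvM // XA.
Qed.

End HomogeneousQuotient.
End GradedAlgebras.

(** * Quotients of the power series ring as finite-dimensional algebras *)

Section QuotientAlgebra.
Local Open Scope ring_scope.
Variables (K : fieldType) (N : nat).

(** Bundling the ideal with a frame makes ['rV[K]_N] a type indexed by the ideal, to which the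
    transported multiplication can be attached as an instance. *)
Record quotient_data := QuotientData {
  qd_ideal : set (fps2 K);
  qd_map : {linear fps2 K -> 'rV[K]_N};
  qd_frame : quotient_frame qd_ideal qd_map;
  qd_idealP : fps2_ideal qd_ideal;
  qd_proper : ~ qd_ideal 1 }.

Definition quotient_alg (d : quotient_data) : Type := 'rV[K]_N.
HB.instance Definition _ d := Vector.copy (quotient_alg d) 'rV[K]_N.

Section Multiplication.
Variable d : quotient_data.
Local Notation Q := (quotient_alg d).

Definition quotient_proj (f : fps2 K) : Q := qd_map d f.
Definition quotient_lift (v : Q) : fps2 K := projT1 (cid ((qd_frame d).1 v)).
Definition quotient_mul (v w : Q) : Q := quotient_proj (quotient_lift v * quotient_lift w).

Lemma quotient_liftK v : quotient_proj (quotient_lift v) = v.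
Proof. exact: projT2 (cid ((qd_frame d).1 v)). Qed.

Lemma quotient_proj_ker f : quotient_proj f = 0 <-> qd_ideal d f.
Proof. by split=> /(qd_frame d).2. Qed.

Lemma quotient_proj_is_linear : linear quotient_proj.
Proof. by move=> c f g; rewrite /quotient_proj linearP. Qed.
HB.instance Definition _ := GRing.isLinear.Build K (fps2 K) Q _ quotient_proj quotient_proj_is_linear.

Lemma quotient_projM f g : quotient_proj (f * g) = quotient_mul (quotient_proj f) (quotient_proj g).
Proof.
have [I0 ID IM] := qd_idealP d.
apply/eqP; rewrite -subr_eq0 -raddfB /=; apply/eqP/quotient_proj_ker.
have E u : qd_ideal d (u - quotient_lift (quotient_proj u)).
  by apply/quotient_proj_ker; rewrite raddfB /= quotient_liftK subrr.
set f' := quotient_lift _; set g' := quotient_lift _.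
have -> : f * g - f' * g' = g * (f - f') + f' * (g - g').
  by rewrite !mulrBr [g * f]mulrC [g * f']mulrC addrA subrK.
by apply: ID; apply: IM; apply: E.
Qed.

Lemma quotient_proj_surj v : exists f, quotient_proj f = v.
Proof. by exists (quotient_lift v); rewrite quotient_liftK. Qed.

Let mulA : associative quotient_mul.
Proof.
move=> u v w; have [f <-] := quotient_proj_surj u; have [g <-] := quotient_proj_surj v.
by have [h <-] := quotient_proj_surj w; rewrite -!quotient_projM mulrA.
Qed.

Let mulC : commutative quotient_mul.
Proof.
move=> u v; have [f <-] := quotient_proj_surj u; have [g <-] := quotient_proj_surj v.
by rewrite -!quotient_projM mulrC.
Qed.

Let mul1 : left_id (quotient_proj 1) quotient_mul.
Proof. by move=> u; have [f <-] := quotient_proj_surj u; rewrite -quotient_projM mul1r. Qed.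

Let mulDl : left_distributive quotient_mul +%R.
Proof.
move=> u v w; have [f <-] := quotient_proj_surj u; have [g <-] := quotient_proj_surj v.
have [h <-] := quotient_proj_surj w.
by rewrite -!quotient_projM -!raddfD /= -quotient_projM mulrDl.
Qed.

Let one_neq0 : quotient_proj 1 != 0.
Proof. by apply/eqP => /quotient_proj_ker; apply: qd_proper. Qed.

HB.instance Definition _ := GRing.Zmodule_isComNzRing.Build Q mulA mulC mul1 mulDl one_neq0.

Let scaleAl (a : K) (u v : Q) : a *: (u * v) = (a *: u) * v.
Proof.
have [f <-] := quotient_proj_surj u; have [g <-] := quotient_proj_surj v.
rewrite -[_ * _]/(quotient_mul _ _) -[RHS]/(quotient_mul _ _).
have Z h : quotient_proj (a *: h) = a *: quotient_proj h by rewrite linearZ.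
by rewrite -Z -!quotient_projM -Z scalerAl.
Qed.
HB.instance Definition _ := GRing.Lmodule_isLalgebra.Build K Q scaleAl.
HB.instance Definition _ := GRing.Lalgebra_isComAlgebra.Build K Q.
HB.instance Definition _ := Algebra_isFalgebra.Build K Q.

Lemma quotient_proj_is_monoid_morphism : monoid_morphism quotient_proj.
Proof. by split=> // f g; rewrite quotient_projM. Qed.
HB.instance Definition _ :=
  GRing.isMonoidMorphism.Build (fps2 K) Q quotient_proj quotient_proj_is_monoid_morphism.

End Multiplication.

Lemma quotient_alg_exists (I : set (fps2 K)) (phi : {linear fps2 K -> 'rV[K]_N}) :
  quotient_frame I phi -> fps2_ideal I -> ~ I 1 ->
  exists (R : falgType K) (psi : {lrmorphism fps2 K -> R}),
    (forall r, exists f, psi f = r) /\ (forall f, I f <-> psi f = 0).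
Proof.
move=> h1 h2 h3; pose d := QuotientData h1 h2 h3.
exists (quotient_alg d : falgType K), (@quotient_proj d); split.
  exact: quotient_proj_surj.
by move=> f; exact: iff_sym (@quotient_proj_ker d f).
Qed.

End QuotientAlgebra.

Section FrameIdealQuotient.
Local Open Scope ring_scope.
Variables (K : closedFieldType) (T : seq nat).
Local Notation t := (nth 0%N T).
Implicit Types phi : forall i, 'M[K]_(i.+1, t i).

Lemma sumn_ord : (\sum_(i < size T) t i)%N = sumn T.
Proof. by rewrite sumnE (big_nth 0%N) big_mkord. Qed.

(** The degreewise functionals side by side. Degrees from [size T] on contribute no column, since
    [t i = 0] there, and the cast turns the total width into [sumn T], the colength used for
    [Hilb]. *)
Definition frame_of phi (f : fps2 K) : 'rV[K]_(sumn T) :=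
  castmx (erefl, sumn_ord) (\mxrow_(i < size T) (poly_rV (slice i f) *m phi i)).

Lemma frame_of_is_linear phi : linear (frame_of phi).
Proof.
move=> c f g; rewrite /frame_of.
rewrite (eq_mxrow (fun i => _ : _ = c *: (poly_rV (slice i f) *m phi i) + poly_rV (slice i g) *m phi i)).
  by apply/rowP => j; rewrite !(mxE, castmxE).
by move=> i; rewrite linearP /= linearP /= mulmxDl -scalemxAl.
Qed.
HB.instance Definition _ phi := GRing.isLinear.Build K (fps2 K) 'rV[K]_(sumn T) _
  (frame_of phi) (frame_of_is_linear phi).

Lemma frame_of_eq0 phi f : frame_of phi f = 0 <-> frame_ideal phi f.
Proof.
split=> [h i|h].
  case: (ltnP i (size T)) => iT; last first.
    apply/rowP => j; suff: (j < 0)%N by [].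
    by rewrite -[X in (j < X)%N](nth_default 0%N iT).
  have : \mxrow_(i < size T) (poly_rV (slice i f) *m phi i) = 0.
    by rewrite -[LHS](castmxK (erefl 1%N) sumn_ord) -/(frame_of phi f) h; apply/rowP => j; rewrite castmxE !mxE.
  move/(congr1 (fun A => submxrow A (Ordinal iT))); rewrite mxrowK => ->.
  by apply/rowP => j; rewrite !mxE.
rewrite /frame_of (eq_mxrow (B_ := fun=> 0)) ?mxrow0 => [|i]; last exact: h.
by apply/rowP => j; rewrite castmxE !mxE.
Qed.

Lemma frame_of_surj phi : (forall i, \rank (phi i) = t i) ->
  forall v, exists f, frame_of phi f = v.
Proof.
move=> rk v; pose w := castmx (erefl, esym sumn_ord) v.
have ex (i : 'I_(size T)) : exists u, u *m phi i = submxrow w i.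
  by exists (submxrow w i *m pinvmx (phi i)); apply: mulmxKpV; apply: submx_full; rewrite /row_full rk.
pose u i := projT1 (cid (ex i)).
have hu i : u i *m phi i = submxrow w i := projT2 (cid (ex i)).
exists (\sum_(i < size T) hform (fps2X K : fps2 K) (fps2Y K) i (rVpoly (u i))).
rewrite /frame_of (_ : \mxrow_i _ = w) ?castmxKV //.
apply/mxrowP => i; rewrite mxrowK -hu raddf_sum (bigD1 i) //= slice_hform ?size_poly // eqxx.
rewrite big1 ?addr0 ?rVpolyK // => j; rewrite -val_eqE /= => ne.
by rewrite slice_hform ?size_poly // eq_sym (negbTE ne).
Qed.

Lemma frame_ofP phi : hframe phi -> quotient_frame (frame_ideal phi) (frame_of phi).
Proof.
by move=> [rk _]; split=> [|f]; [exact: frame_of_surj|exact: iff_sym (frame_of_eq0 _ _)].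
Qed.

Lemma leq_size_sumn : 0%N \notin T -> (size T <= sumn T)%N.
Proof.
elim: T => //= a s IH; rewrite inE negb_or => /andP[a0 /IH h].
by rewrite -add1n leq_add // lt0n eq_sym.
Qed.

(** The frame only sees degrees below [size T <= sumn T], so the monomials with both exponents below
    [sumn T], which index the rows of the frame matrix, already span the quotient. *)
Lemma frame_mx_full phi : (forall i, \rank (phi i) = t i) -> 0%N \notin T ->
  \rank (frame_mx (frame_of phi)) = sumn T.
Proof.
move=> rk T0; apply/eqP; rewrite -/(row_full _) -sub1mx; apply/row_subP => i.
have [f hf] := frame_of_surj rk (row i 1%:M); rewrite -{}hf.
set N := sumn T.
pose g := \sum_(a < N * N) f (a %/ N)%N (a %% N)%N *: fps2_monomial K (a %/ N) (a %% N).
have -> : frame_of phi f = frame_of phi g.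
  rewrite /frame_of; congr (castmx _ _); apply: eq_mxrow => j; congr (poly_rV _ *m _).
  apply/polyP => k; case: (leqP k j) => kj; last by rewrite !coef_slice_gt.
  have jN : (j < N)%N by apply: leq_trans (ltn_ord j) (leq_size_sumn T0).
  have h : (k * N + (j - k) < N * N)%N.
    apply: (@leq_trans (k.+1 * N)); last by rewrite leq_mul2r (leq_ltn_trans kj) ?orbT.
    by rewrite mulSnr ltn_add2l; lia.
  rewrite !coef_slice // /g fps2_sumE (bigD1 (Ordinal h)) //= big1 ?addr0 => [|a].
    rewrite fps2_scaleE /fps2_monomial divnMDl ?divn_small ?addn0; try lia.
    by rewrite modnMDl modn_small ?eqxx ?mulr1 //; lia.
  rewrite -val_eqE /= fps2_scaleE /fps2_monomial => ne.
  case: eqP => [e1|_]; last by rewrite mulr0.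
  case: eqP => [e2|_]; last by rewrite mulr0.
  by move: ne; rewrite (divn_eq a N) -e1 -e2 eqxx.
rewrite /g raddf_sum; apply: summx_sub => a _; rewrite /= linearZ scalemx_sub //.
by have := row_sub a (frame_mx (frame_of phi)); rewrite rowK.
Qed.

End FrameIdealQuotient.

Section PolynomialFrames.
Local Open Scope ring_scope.
Variables (K : closedFieldType) (T : seq nat).

Lemma polyfun_frame_mx n (phi : ('I_n -> K) -> forall i, 'M[K]_(i.+1, nth 0%N T i)) :
  (forall i k l, polyfun (fun u => phi u i k l)) ->
  forall a l, polyfun (fun u => frame_mx (frame_of (phi u)) a l).
Proof.
move=> h a l.
pose j := cast_ord (esym (sumn_ord T)) l.
pose m := fps2_monomial K (a %/ sumn T) (a %% sumn T).
apply: (polyfun_ext (f := fun u => (poly_rV (slice (tagnat.sig1 j) m) *m phi u (tagnat.sig1 j)) 0 (tagnat.sig2 j))).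
  move=> u; rewrite [RHS]mxE [RHS]castmxE [RHS]mxE /=.
  by rewrite cast_ord_id.
apply: polyfun_mulmx => k l' //; exact: polyfun_cst.
Qed.

End PolynomialFrames.

(** * Graded algebras as quotients of the power series ring *)

Section Evaluation.
Local Open Scope ring_scope.
Variables (K : fieldType) (R : falgType K) (x y : R) (n : nat).
Hypothesis xy : x * y = y * x.
Hypothesis xy0 : forall a b, (n <= a + b)%N -> x ^+ a * y ^+ b = 0.

Lemma hform_nilpotent i p : (n <= i)%N -> hform x y i p = 0.
Proof.
move=> ni; rewrite /hform big1 // => k _; rewrite xy0 ?scaler0 //.
by rewrite subnKC // -ltnS.
Qed.

Definition fps2_eval (f : fps2 K) : R := \sum_(i < n) hform x y i (slice i f).

Lemma fps2_eval_is_linear : linear fps2_eval.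
Proof.
move=> c f g; rewrite /fps2_eval scaler_sumr -big_split; apply: eq_bigr => i _ /=.
by rewrite linearP /= linearP.
Qed.

Lemma fps2_eval_is_monoid_morphism : monoid_morphism fps2_eval.
Proof.
have n0 : (0 < n)%N.
  rewrite lt0n; apply/eqP => n0; have := xy0 (_ : n <= 0 + 0)%N; rewrite n0 mul1r => /(_ isT) /eqP.
  by rewrite oner_eq0.
(* The homogeneous components become the coefficients of a polynomial in an auxiliary variable, so
   that the formula of [slice_mul] is multiplication of polynomials. *)
pose F f := \poly_(i < n) hform x y i (slice i f).
have FE f : fps2_eval f = (F f).[1].
  by rewrite horner_poly; apply: eq_bigr => i _; rewrite expr1n mulr1.
split.
  rewrite /fps2_eval (bigD1 (Ordinal n0)) //= big1 ?addr0.
    have -> : slice 0 (1 : fps2 K) = 1.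
      apply/polyP => k; case: k => [|k]; first by rewrite coef_slice // fps2_oneE coefC.
      by rewrite coef_slice_gt // coefC.
    by rewrite hform1.
  move=> i; rewrite -val_eqE /= => i0; suff -> : slice i (1 : fps2 K) = 0 by rewrite raddf0.
  apply/polyP => k; rewrite coef0; case: (leqP k i) => ki; last by rewrite coef_slice_gt.
  by rewrite coef_slice // fps2_oneE; case: eqP => //= k0; rewrite k0 subn0 (negbTE i0).
move=> f g; rewrite !FE -hornerM_comm; last by rewrite /comm_poly mulr1 mul1r.
congr horner; apply/polyP => i; rewrite coefM coef_poly.
have E (j : 'I_i.+1) : (F f)`_j * (F g)`_(i - j) = hform x y i (slice j f * slice (i - j) g).
  have ji : (j <= i)%N by rewrite -ltnS.
  rewrite -{4}(subnKC ji) hformM ?size_slice // !coef_poly.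
  case: (ltnP j n) => jn; last by rewrite [in RHS](hform_nilpotent _ jn) !mul0r.
  case: (ltnP (i - j) n) => // ijn.
  by rewrite (hform_nilpotent _ ijn).
under [RHS]eq_bigr => j _ do rewrite E.
rewrite -raddf_sum /= -slice_mul; case: ltnP => // ni.
by rewrite hform_nilpotent.
Qed.

Lemma fps2_eval_lrmorphism : exists psi : {lrmorphism fps2 K -> R}, forall f, psi f = fps2_eval f.
Proof.
pose psi : {lrmorphism fps2 K -> R} := HB.pack fps2_eval
  (GRing.isLinear.Build _ _ _ _ fps2_eval fps2_eval_is_linear)
  (GRing.isMonoidMorphism.Build _ _ fps2_eval fps2_eval_is_monoid_morphism).
by exists psi.
Qed.

End Evaluation.

Section StandardGraded.
Local Open Scope ring_scope.
Variables (K : fieldType) (R : falgType K) (T : seq nat).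
Hypotheses (std : standard_graded R) (HS : has_HilbertSamuel R T).
Hypothesis T1 : nth 0%N T 1 = 2%N.

(** Since [t 1 = 2], the space [A 1] lies in the span of two nilpotent elements [x], [y]. Evaluation
    at them is onto because [A 1] generates [R], and its kernel is homogeneous because the sum of
    the [A i] is direct. *)
Lemma standard_graded_quotient : exists psi : {lrmorphism fps2 K -> R},
  (forall r, exists f, psi f = r) /\ fps2_homogeneous [set f | psi f = 0].
Proof.
have [A [n [A0 fullA dirA mulA genA]]] := std.
have [commR [_ [m hm hT]]] := HS.
pose S i := (\sum_(j < n | (i <= j)%N) A j)%VS.
have AS i j : (j <= i)%N -> (A i <= S j)%VS.
  move=> ji; case: (ltnP i n) => [ni|/A0 ->]; last exact: sub0v.
  exact: (sumv_sup (Ordinal ni)).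
have mulAS i j u v : u \in A i -> v \in S j -> u * v \in S (i + j)%N.
  move=> uA /memv_sumP [w hw ->]; rewrite mulr_sumr; apply: memv_suml => k jk.
  apply: (subvP (AS (i + k)%N _ _)); first by rewrite leq_add2l.
  by apply: (subvP (mulA i k)); rewrite memv_mul // hw.
have mulS i j u v : u \in S i -> v \in S j -> u * v \in S (i + j)%N.
  move=> /memv_sumP [w hw ->] vS; rewrite mulr_suml; apply: memv_suml => k ik.
  have SS a b : (b <= a)%N -> (S a <= S b)%VS.
    by move=> ba; apply/subv_sumP => l al; apply: AS; apply: leq_trans al.
  by apply: (subvP (SS (k + j)%N _ _)); rewrite ?leq_add2r // mulAS // hw.
have S0 : S 0%N = fullv by rewrite -fullA.
(* The definition of a grading says nothing on [A 0]. That 1 and the positive degrees span [R] comes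
   from generation by [A 1], and it identifies the maximal ideal with [S 1]. *)
have full1 : ({:R} <= 1 + S 1%N)%VS.
  rewrite -genA; apply: agenv_sub_modl; first exact: addvSl.
  rewrite prodvDr prodv1 subv_add; apply/andP; split.
    by apply: subv_trans (addvSr _ _); apply: AS.
  apply: subv_trans (addvSr _ _); apply/prodvP => u v uA vS.
  have : u * v \in S 2%N by apply: (mulAS 1%N 1%N).
  by apply/subvP/subv_sumP => l al; apply: AS; apply: ltnW.
have nilS u : u \in S 1%N -> u ^+ n = 0.
  move=> uS; suff : u ^+ n \in S n.
    rewrite /S big_pred0 ?memv0 => [/eqP //|i]; by rewrite leqNgt ltn_ord.
  elim: (n) => [|k IH]; first by rewrite S0 memvf.
  by rewrite exprS; apply: (mulS 1%N k).
have one_notin : 1 \notin S 1%N.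
  by apply/negP => /nilS; rewrite expr1n => /eqP; rewrite oner_eq0.
have idS : is_ideal (S 1%N).
  by apply/prodvP => u v _ vS; apply: (mulS 0%N 1%N); rewrite ?S0 ?memvf.
have mS : m = S 1%N.
  apply: maximal_ideal_uniq hm _; apply: nil_ideal_maximal => // u uS.
  by exists n; apply: nilS.
have indep : forall u : 'I_n -> R, (forall i, u i \in A i) -> \sum_(i < n) u i = 0 -> forall i, u i = 0.
  move=> u hu u0 i; have /directv_sum_independent H := dirA; exact: H.
have dimA : (\dim (A 1%N) <= 2)%N.
  have cap0 : (A 1%N :&: S 2%N = 0)%VS.
    apply/eqP; rewrite -subv0; apply/subvP => u; rewrite memv_cap memv0 => /andP[uA /memv_sumP [w hw uw]].
    case: (ltnP 1 n) => n1; last by move: uA; rewrite A0 // memv0.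
    pose v (i : 'I_n) := (if i == Ordinal n1 then u else 0) - (if (2 <= i)%N then w i else 0).
    have /(_ (Ordinal n1)) : forall i, v i = 0; last by rewrite /v eqxx /= subr0 => ->.
    apply: indep => [i|].
      apply: rpredB; first by case: eqP => [->//|_]; rewrite mem0v.
      by case: ifP => [i2|_]; rewrite ?mem0v // hw.
    rewrite sumrB -!big_mkcond /= big_pred1_eq uw subrr //.
  have /andP[P1 P2] : (S 1%N <= ideal_pow m 1%N)%VS && (ideal_pow m 2%N <= S 2%N)%VS.
    rewrite /ideal_pow mS; apply/andP; split.
      by apply/subvP => u uS; rewrite -[u]mul1r memv_mul ?memvf // expv1.
    apply/prodvP => u v _ vS; apply: (mulS 0%N 2%N); first by rewrite S0 memvf.
    apply: subvP vS; rewrite expv2; apply/prodvP => a b; exact: (mulS 1%N 1%N).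
  have S12 : (A 1%N + S 2%N <= S 1%N)%VS.
    rewrite subv_add AS //=; apply/subv_sumP => l al; apply: AS; exact: ltnW.
  have := dimvS S12; rewrite dimv_disjoint_sum // => d1.
  have d2 := dimvS P1; have d3 := dimvS P2; have d4 := hT 1%N; rewrite T1 in d4.
  have d5 : (\dim (ideal_pow m 1%N) <= \dim (S 1%N))%N.
    rewrite dimvS // /ideal_pow mS expv1; exact: idS.
  by lia.
have [x [y [xA yA Axy]]] : exists x y, [/\ x \in A 1%N, y \in A 1%N & (A 1%N <= <[x]> + <[y]>)%VS].
  pose s := (vbasis (A 1%N) : seq R).
  have sA i : s`_i \in A 1%N.
    case: (ltnP i (size s)) => h; last by rewrite nth_default ?mem0v.
    by apply: vbasis_mem; rewrite mem_nth.
  exists s`_0, s`_1; split=> //; rewrite -(span_basis (vbasisP (A 1%N))) -/s.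
  apply/span_subvP => u us; rewrite -(nth_index 0 us).
  have : (index u s < 2)%N by rewrite (leq_trans _ dimA) // -(size_tuple (vbasis (A 1%N))) index_mem.
  case: (index u s) => [|[|//]] _.
    by apply: (subvP (addvSl _ _)); rewrite memv_line.
  by apply: (subvP (addvSr _ _)); rewrite memv_line.
have xy : x * y = y * x by exact: commR.
have expA z k : z \in A 1%N -> (0 < k)%N -> z ^+ k \in A k.
  move=> zA; case: k => // k _; elim: k => [|k IH]; first by rewrite expr1.
  by rewrite exprS; apply: (subvP (mulA 1%N k.+1)); rewrite memv_mul.
have xyA a b : (0 < a + b)%N -> x ^+ a * y ^+ b \in A (a + b)%N.
  case: a b => [|a] [|b] // _; rewrite ?mul1r ?mulr1 ?addn0; try exact: expA.
  by apply: (subvP (mulA a.+1 b.+1)); rewrite memv_mul // expA.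
have n0 : (0 < n)%N.
  rewrite lt0n; apply/eqP => n0; have := memvf (1 : R); rewrite -fullA n0 big_ord0 memv0.
  by rewrite oner_eq0.
have xy0 a b : (n <= a + b)%N -> x ^+ a * y ^+ b = 0.
  move=> h; have := xyA a b (leq_trans n0 h); rewrite A0 // memv0.
  by move/eqP.
have hformA i p : (0 < i)%N -> hform x y i p \in A i.
  move=> i0; apply: memv_suml => k _; apply: memvZ.
  have ki : (k <= i)%N by rewrite -ltnS.
  by have := xyA k (i - k)%N; rewrite subnKC //; apply.
have [psi psiE] := fps2_eval_lrmorphism xy xy0.
exists psi; split.
  pose U := (\sum_(i < n) limg (linfun (hform x y i \o (@rVpoly K i.+1))))%VS.
  have UP i (p : {poly K}) : (size p <= i.+1)%N -> hform x y i p \in U.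
    move=> sp; case: (ltnP i n) => ni; last by rewrite (hform_nilpotent xy0) ?mem0v.
    apply: (subvP (sumv_sup (Ordinal ni) _ (subvv _))) => //=.
    by rewrite -(poly_rV_K sp) -[hform _ _ _ _]/((hform x y i \o (@rVpoly K i.+1)) _) -lfunE memv_img // memvf.
  have UE u : u \in U -> exists p : 'I_n -> {poly K}, (forall i, size (p i) <= i.+1)%N /\
      u = \sum_(i < n) hform x y i (p i).
    move=> /memv_sumP [w hw ->].
    have ex (i : 'I_n) : exists p : {poly K}, (size p <= i.+1)%N /\ w i = hform x y i p.
      have /memv_imgP [v _ ->] := hw i isT; exists (rVpoly v).
      by rewrite size_poly lfunE.
    have [p hp] := choice ex; exists p; split=> [i|]; first exact: (hp i).1.
    by apply: eq_bigr => i _; exact: (hp i).2.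
  have fullU : (agenv (A 1%N) <= U)%VS.
    apply: agenv_sub_modl.
      by rewrite -memvE -[1](expr0 y) -(hform1 x y 0) UP // size_poly1.
    apply/prodvP => u v uA /UE [p [sp ->]].
    have /memv_addP [u1 /vlineP [a ->] [u2 /vlineP [b ->] ->]] := subvP Axy _ uA.
    rewrite mulr_sumr; apply: memv_suml => i _.
    have -> : a *: x + b *: y = hform x y 1 (a *: 'X + b%:P).
      rewrite raddfD /= linearZ /= -['X]expr1 hformXn // subnn mulr1; congr (_ + _).
      by rewrite -[b%:P]mulr1 mul_polyC linearZ /= hform1.
    have sab : (size (a *: 'X + b%:P)%R <= 2)%N.
      rewrite (leq_trans (size_polyD _ _)) // geq_max (leq_trans (size_scale_leq _ _)) ?size_polyX //.
      by rewrite (leq_trans (size_polyC_leq1 _)).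
    rewrite -hformM // UP // (leq_trans (size_polyMleq _ _)) //.
    by have := sp i; move: sab; move: (size _) (size _) => c d; lia.
  move=> r; have /UE [p [sp ->]] : r \in U by apply: (subvP fullU); rewrite genA memvf.
  exists (\sum_(i < n) hform (fps2X K : fps2 K) (fps2Y K) i (p i)).
  rewrite psiE /fps2_eval; apply: eq_bigr => i _; congr hform.
  rewrite raddf_sum (bigD1 i) //= slice_hform // eqxx big1 ?addr0 // => j.
  by rewrite -val_eqE /= => ne; rewrite slice_hform // eq_sym (negbTE ne).
move=> f d /=; rewrite !psiE => f0.
have zero : forall i : 'I_n, hform x y i (slice i f) = 0.
  (* The term of degree 0 is a scalar, but 1 is not known to lie in [A 0], so independence of the
     [A i] does not apply to it. It vanishes because it also lies in the nil ideal [S 1]. *)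
  have c0 : hform x y 0 (slice 0 f) = 0.
    have E : hform x y 0 (slice 0 f) = (slice 0 f)`_0 *: 1.
      by rewrite /hform big_ord1 mulr1.
    have : hform x y 0 (slice 0 f) \in S 1%N.
      move: f0; rewrite /fps2_eval (bigD1 (Ordinal n0)) //= => /eqP; rewrite addr_eq0 => /eqP ->.
      rewrite rpredN; apply: memv_suml => i; rewrite -val_eqE /= -lt0n => i0.
      by apply: (subvP (AS i 1%N i0)); apply: hformA.
    rewrite E; have [->|c0] := eqVneq (slice 0 f)`_0 0; first by rewrite scale0r.
    by move=> h; case/negP: one_notin; rewrite -[1]scale1r -(mulVf c0) -scalerA memvZ.
  move=> i; have [->//|i0] := eqVneq (val i) 0%N; rewrite -lt0n in i0.
  pose v (k : 'I_n) := if (0 < k)%N then hform x y k (slice k f) else 0.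
  have : v i = 0; last by rewrite /v i0.
  apply: indep => [k|]; rewrite /v.
    by case: ifP => [k0|]; [exact: hformA|rewrite mem0v].
  rewrite -[RHS]f0; apply: eq_bigr => k _; case: posnP => // k0.
  by rewrite k0 c0.
rewrite /fps2_eval big1 // => i _; rewrite fps2_componentE slice_hform ?size_slice //.
by case: eqP => [<-|_]; rewrite ?zero // raddf0.
Qed.

End StandardGraded.

(** * Linear substitutions, presentations and isomorphisms *)

Section LinearSubstitution.
Local Open Scope ring_scope.
Variable K : fieldType.
Implicit Types L p : {poly K}.

Lemma hform_hform (A : algType K) (x y : A) i L1 L2 p : x * y = y * x ->
  (size L1 <= 2)%N -> (size L2 <= 2)%N ->
  hform (hform x y 1 L1) (hform x y 1 L2) i p = hform x y i (hform L1 L2 i p).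
Proof.
move=> xy s1 s2.
have sX L k : (size L <= 2)%N -> (size (L ^+ k) <= k.+1)%N.
  move=> sL; apply: leq_trans (size_poly_exp_leq _ _) _; rewrite ltnS.
  rewrite -[leqRHS]mul1n leq_mul2r; apply/orP; right.
  by move: sL; case: (size L) => [|[|[|]]].
have X L k : (size L <= 2)%N -> hform x y k (L ^+ k) = hform x y 1 L ^+ k.
  move=> sL; elim: k => [|k IH]; first by rewrite !expr0 hform1.
  by rewrite !exprS -add1n hformM ?IH // sX.
rewrite [hform L1 L2 i p]/hform raddf_sum; apply: eq_bigr => k _ /=.
have ki : (k <= i)%N by rewrite -ltnS.
rewrite linearZ; congr (_ *: _).
have := hformM xy (sX L1 k s1) (sX L2 (i - k)%N s2).
by rewrite subnKC // (X L1 k s1) (X L2 _ s2).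
Qed.

Lemma hform_X1 i p : (size p <= i.+1)%N -> hform ('X : {poly K}) 1 i p = p.
Proof.
move=> sp; rewrite [RHS](poly_sumXn sp); apply: eq_bigr => k _.
by rewrite expr1n mulr1.
Qed.

Definition form_det L1 L2 : K := L1`_1 * L2`_0 - L1`_0 * L2`_1.

Definition subst_mx L1 L2 i : 'M[K]_i.+1 := \matrix_(k < i.+1) poly_rV (L1 ^+ k * L2 ^+ (i - k)).

Lemma poly_rV_subst L1 L2 i p : (size p <= i.+1)%N ->
  poly_rV p *m subst_mx L1 L2 i = poly_rV (hform L1 L2 i p).
Proof.
move=> sp; rewrite mulmx_sum_row /hform raddf_sum; apply: eq_bigr => k _.
by rewrite mxE rowK /= linearZ.
Qed.

Lemma subst_mx_unit L1 L2 i : (size L1 <= 2)%N -> (size L2 <= 2)%N ->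
  form_det L1 L2 != 0 -> subst_mx L1 L2 i \in unitmx.
Proof.
move=> s1 s2 D0; set D := form_det L1 L2 in D0.
(* [M1] and [M2] form the inverse substitution, by Cramer's rule. *)
pose M1 : {poly K} := D^-1 *: (L2`_0 *: 'X - (L1`_0)%:P).
pose M2 : {poly K} := D^-1 *: ((L1`_1)%:P - L2`_1 *: 'X).
have sM1 : (size M1 <= 2)%N.
  rewrite (leq_trans (size_scale_leq _ _)) // (leq_trans (size_polyD _ _)) // geq_max size_polyN.
  by rewrite (leq_trans (size_scale_leq _ _)) ?size_polyX // (leq_trans (size_polyC_leq1 _)).
have sM2 : (size M2 <= 2)%N.
  rewrite (leq_trans (size_scale_leq _ _)) // (leq_trans (size_polyD _ _)) // geq_max size_polyN.
  by rewrite (leq_trans (size_scale_leq _ _)) ?size_polyX // andbT (leq_trans (size_polyC_leq1 _)).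
have h1C c : hform L1 L2 1 c%:P = c *: L2.
  by rewrite -[c%:P]mulr1 mul_polyC linearZ /= hform1 expr1.
have h1X : hform L1 L2 1 'X = L1 by rewrite -['X]expr1 hformXn // subnn mulr1.
have hi L k : (size L <= 2)%N -> L`_k.+2 = 0 by move=> sL; rewrite nth_default // (leq_trans sL).
have E1 : hform L1 L2 1 M1 = 'X.
  rewrite /M1 linearZ raddfB /= linearZ /= h1X h1C.
  apply: (canLR (scalerK D0)); apply/polyP => k; rewrite coefB !coefZ coefX /D /form_det.
  case: k => [|[|k]] /=; last by rewrite !hi // !mulr0 subrr.
    by rewrite mulr0 [L2`_0 * _]mulrC subrr.
  by rewrite mulr1 [L2`_0 * _]mulrC.
have E2 : hform L1 L2 1 M2 = 1.
  rewrite /M2 linearZ raddfB /= linearZ /= h1X h1C.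
  apply: (canLR (scalerK D0)); apply/polyP => k; rewrite coefB !coefZ coef1 /D /form_det.
  case: k => [|[|k]] /=; last by rewrite !hi // !mulr0 subrr.
    by rewrite mulr1 [L2`_1 * _]mulrC.
  by rewrite mulr0 [L2`_1 * _]mulrC subrr.
suff /mulmx1_unit [] : subst_mx M1 M2 i *m subst_mx L1 L2 i = 1%:M by [].
apply/row_matrixP => k; rewrite row_mul rowK poly_rV_subst.
  rewrite -hformXn; last by rewrite -ltnS.
  rewrite -hform_hform ?E1 ?E2 ?hform_X1 ?size_polyXn // 1?mulrC //.
  by apply/rowP => j; rewrite !mxE coefXn eq_sym.
rewrite -hformXn; last by rewrite -ltnS.
exact: size_hform.
Qed.

End LinearSubstitution.

Section Presentations.
Local Open Scope ring_scope.
Variables (K : closedFieldType) (T : seq nat).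
Local Notation t := (nth 0%N T).
Local Notation family := (forall i, 'M[K]_(i.+1, t i)).
Implicit Types (phi : family) (p L : {poly K}).

Definition presents (R : falgType K) phi : Prop :=
  exists psi : {lrmorphism fps2 K -> R},
    (forall r, exists f, psi f = r) /\ (forall f, frame_ideal phi f <-> psi f = 0).

Lemma presents_hom (R : falgType K) phi (psi : {lrmorphism fps2 K -> R}) :
  (forall f, frame_ideal phi f <-> psi f = 0) -> fps2_homogeneous [set f | psi f = 0].
Proof. by move=> h f d /= /h /(frame_ideal_homogeneous d) /h. Qed.

Lemma presents_hform (R : falgType K) phi (psi : {lrmorphism fps2 K -> R}) i p :
  (forall f, frame_ideal phi f <-> psi f = 0) -> (size p <= i.+1)%N ->
  hform (psi (fps2X K)) (psi (fps2Y K)) i p = 0 <-> poly_rV p *m phi i = 0.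
Proof.
move=> h sp; rewrite -psi_hform -h; split=> [/(_ i)|h0 j]; rewrite slice_hform // ?eqxx //.
by case: eqP => [->//|_]; rewrite raddf0 mul0mx.
Qed.

Lemma HilbertSamuel_presents (R : falgType K) phi :
  0%N \notin T -> (forall i, \rank (phi i) = t i) -> presents R phi -> has_HilbertSamuel R T.
Proof.
move=> T0 rk [psi [surj ker]]; apply/(HilbertSamuel_degree_part surj (presents_hom ker)).
split=> // i.
have kerE v : v *m phi i = 0 <-> v \in lker (formL psi i).
  rewrite memv_ker lfunE /= -{1}(rVpolyK v).
  have <- := presents_hform ker (size_poly i.+1 _ : size (rVpoly v) <= _)%N.
  by split=> [->|/eqP].
have [|A rA hA] := @kernel_frame K i.+1 (\dim (degree_part psi i)) (lker (formL psi i)).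
  by rewrite addnC dim_degree_part.
rewrite -rA -(rk i).
have kE : (kermx (phi i) :=: kermx A)%MS.
  apply/eqmxP; apply/andP; split; apply/rV_subP => v /sub_kermxP hv; apply/sub_kermxP.
    by apply/hA/kerE.
  by apply/kerE/hA.
have := mxrank_ker (phi i); rewrite kE mxrank_ker.
by have := rank_leq_row A; have := rank_leq_row (phi i); lia.
Qed.

Lemma HilbertSamuel_head (R : falgType K) : has_HilbertSamuel R T -> nth 0%N T 1 = 2%N ->
  nth 0%N T 0 != 0%N.
Proof.
move=> [_ [T0 _]] T1; apply: contra T0 => /eqP h.
by rewrite -h mem_nth //; case: (T) T1.
Qed.

Lemma frame_ideal1 phi : (forall i, \rank (phi i) = t i) -> t 0 != 0%N -> ~ frame_ideal phi 1.
Proof.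
move=> rk t0 /(_ 0%N); have -> : slice 0 (1 : fps2 K) = 1.
  apply/polyP => k; case: k => [|k]; first by rewrite coef_slice // fps2_oneE coefC.
  by rewrite coef_slice_gt // coefC.
have -> : poly_rV 1 = 1%:M :> 'M[K]_1 by apply/matrixP => a b; rewrite !ord1 !mxE coefC.
by rewrite mul1mx => h; move: (rk 0%N); rewrite h mxrank0 => e; rewrite -e in t0.
Qed.

Lemma hframe_presents phi : hframe phi -> t 0 != 0%N -> exists R, presents R phi.
Proof.
move=> h t0; have [R [psi [surj ker]]] :=
  quotient_alg_exists (frame_ofP h) (frame_ideal_ideal h) (frame_ideal1 h.1 t0).
by exists R, psi.
Qed.

Lemma presents_standard_graded (R : falgType K) phi : presents R phi -> standard_graded R.
Proof. by move=> [psi [surj ker]]; apply: quotient_standard_graded (presents_hom ker). Qed.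

Lemma standard_graded_presents (R : falgType K) :
  standard_graded R -> has_HilbertSamuel R T -> nth 0%N T 1 = 2%N ->
  exists2 phi : family, hframe phi & presents R phi.
Proof.
move=> std HS T1; have [psi [surj hom]] := standard_graded_quotient std HS T1.
have [phi hphi ker] := hframe_of_quotient surj hom HS.
by exists phi => //; exists psi; split=> // f; apply: iff_sym.
Qed.

Lemma G_frame_ideal phi : hframe phi -> 0%N \notin T -> t 0 != 0%N -> G_ T (frame_ideal phi).
Proof.
move=> h T0 t0; have [R pR] := hframe_presents h t0.
have HS := HilbertSamuel_presents T0 h.1 pR.
split; first exact: frame_ideal_homogeneous.
by have [psi [surj ker]] := pR; exists R, psi.
Qed.

Lemma G_inv (I : set (fps2 K)) : G_ T I -> exists2 phi : family, hframe phi & I = frame_ideal phi.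
Proof.
move=> [hom [R [psi [surj ker HS]]]].
have hom' : fps2_homogeneous [set f | psi f = 0].
  by move=> f d /= /ker /(hom _ d) /ker.
have [phi hphi ker'] := hframe_of_quotient surj hom' HS.
exists phi => //; apply/funext => f; apply/propext.
exact: iff_trans (ker f) (ker' f).
Qed.

Lemma G_Hilb : 0%N \notin T -> (@G_ K T `<=` Hilb (sumn T))%classic.
Proof.
move=> T0 I /G_inv [phi h ->]; split; first exact: frame_ideal_ideal.
by exists (frame_of phi); apply: frame_ofP.
Qed.

Lemma presents_iso (R S : falgType K) phi phi' : presents R phi -> presents S phi' ->
  (forall f, frame_ideal phi f <-> frame_ideal phi' f) -> alg_isomorphic R S.
Proof.
move=> [psi [surj ker]] [psi' [surj' ker']] e.
have kk f : psi f = 0 <-> psi' f = 0.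
  by apply: iff_trans (iff_sym (ker f)) _; apply: iff_trans (e f) (ker' f).
pose lift (r : R) := projT1 (cid (surj r)).
have liftK r : psi (lift r) = r := projT2 (cid (surj r)).
pose g (r : R) : S := psi' (lift r).
have gE f : g (psi f) = psi' f.
  apply/eqP; rewrite -subr_eq0 -raddfB; apply/eqP/kk.
  by rewrite raddfB /= liftK subrr.
have glin : linear g.
  move=> c u v; have [a <-] := surj u; have [b <-] := surj v.
  have -> : c *: psi a + psi b = psi (c *: a + b) by rewrite linearP.
  by rewrite !gE linearP.
have gmul : monoid_morphism g.
  split=> [|u v]; first by rewrite -(rmorph1 psi) gE rmorph1.
  have [a <-] := surj u; have [b <-] := surj v.
  by rewrite -rmorphM !gE rmorphM.
pose G : {lrmorphism R -> S} := HB.pack g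
  (GRing.isLinear.Build _ _ _ _ g glin) (GRing.isMonoidMorphism.Build _ _ g gmul).
exists G; pose lift' (r : S) := projT1 (cid (surj' r)).
have liftK' r : psi' (lift' r) = r := projT2 (cid (surj' r)).
exists (fun s => psi (lift' s)) => [r|s]; last by rewrite -[LHS]/(g _) gE liftK'.
have [f <-] := surj r; rewrite -[G _]/(g _) gE.
by apply/eqP; rewrite -subr_eq0 -raddfB; apply/eqP/kk; rewrite raddfB /= liftK' subrr.
Qed.

Definition subst_frame L1 L2 phi : family := fun i => subst_mx L1 L2 i *m phi i.

Section Substitution.
Variables (L1 L2 : {poly K}).
Hypotheses (s1 : (size L1 <= 2)%N) (s2 : (size L2 <= 2)%N) (D0 : form_det L1 L2 != 0).

Lemma subst_frameE phi i p : (size p <= i.+1)%N ->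
  poly_rV p *m subst_frame L1 L2 phi i = poly_rV (hform L1 L2 i p) *m phi i.
Proof. by move=> sp; rewrite mulmxA poly_rV_subst. Qed.

Lemma subst_frame_hframe phi : hframe phi -> hframe (subst_frame L1 L2 phi).
Proof.
move=> h; split=> [i|i p sp].
  apply: etrans (h.1 i); rewrite /subst_frame (eqmxMfull (phi i)) // row_full_unit.
  exact: subst_mx_unit.
rewrite subst_frameE // => h0.
have sX : (size ('X * p)%R <= i.+2)%N.
  by rewrite (leq_trans (size_polyMleq _ _)) // size_polyX.
rewrite !subst_frameE ?(leq_trans sp) //.
have sh := size_hform i p s1 s2.
have E (q : {poly K}) : (size q <= 2)%N -> poly_rV (hform L1 L2 i.+1 (q * p)) *m phi i.+1 = 0.
  move=> sq; have -> : hform L1 L2 i.+1 (q * p) = hform L1 L2 1 q * hform L1 L2 i p.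
    by rewrite -hformM // mulrC.
  exact: (hframe_mul h sh (size_hform 1 q s1 s2) h0).
split; last by apply: E; rewrite size_polyX.
by rewrite -[p]mul1r E ?size_poly1.
Qed.

(** The algebra stays the same; its generators [x], [y] are replaced by the linear forms [L1], [L2]
    in them. *)
Lemma presents_subst (R : falgType K) phi :
  presents R phi -> presents R (subst_frame L1 L2 phi).
Proof.
move=> [psi [surj ker]]; have hom := presents_hom ker.
set x := psi (fps2X K); set y := psi (fps2Y K).
have xy : x * y = y * x by exact: quotient_comm surj _ _.
have [n hn] := psi_ord_ge hom.
have hform0 i p : (n <= i)%N -> (size p <= i.+1)%N -> hform x y i p = 0.
  move=> ni sp; rewrite -psi_hform hn //; apply/ord_geP => j jn.
  by rewrite slice_hform // ltn_eqF // (leq_trans jn).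
pose x' := hform x y 1 L1; pose y' := hform x y 1 L2.
have xy' : x' * y' = y' * x' by exact: quotient_comm surj _ _.
have subst i p : hform x' y' i p = hform x y i (hform L1 L2 i p) by exact: hform_hform.
have xy0 a b : (n <= a + b)%N -> x' ^+ a * y' ^+ b = 0.
  move=> nab; have := hformXn x' y' (leq_addr b a); rewrite addKn => <-.
  by rewrite subst hform0 // size_hform.
have [psi' psiE] := fps2_eval_lrmorphism xy' xy0.
have [L hL] := psi_expand hom.
exists psi'; split=> [r|f].
  have [g <-] := surj r; rewrite (hL (n + L)%N) ?leq_addl //.
  pose q i := rVpoly (poly_rV (slice i g) *m invmx (subst_mx L1 L2 i)).
  have qE i : hform L1 L2 i (q i) = slice i g.
    have := @poly_rV_subst K L1 L2 i (q i) (size_poly _ _).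
    rewrite rVpolyK mulmxKV ?subst_mx_unit // => /(congr1 rVpoly).
    by rewrite !poly_rV_K ?size_slice // size_hform.
  exists (\sum_(i < n + L) hform (fps2X K : fps2 K) (fps2Y K) i (q i)).
  rewrite psiE /fps2_eval [in RHS]big_split_ord /= [X in _ = _ + X]big1 ?addr0 => [|i _]; last first.
    by rewrite hform0 ?leq_addr // size_slice.
  apply: eq_bigr => i _; rewrite subst -qE; congr (hform _ _ _ (hform _ _ _ _)).
  rewrite raddf_sum (bigD1 (lshift L i)) //= slice_hform ?size_poly // eqxx big1 ?addr0 // => j.
  by rewrite -val_eqE /= => ne; rewrite slice_hform ?size_poly // eq_sym (negbTE ne).
pose g := \sum_(i < n) hform (fps2X K : fps2 K) (fps2Y K) i (hform L1 L2 i (slice i f)).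
have gE : psi' f = psi g.
  rewrite psiE /g raddf_sum; apply: eq_bigr => i _ /=.
  by rewrite psi_hform subst.
have slice_g (i : 'I_n) : slice i g = hform L1 L2 i (slice i f).
  rewrite /g raddf_sum (bigD1 i) //= slice_hform ?size_hform // eqxx big1 ?addr0 // => j.
  by rewrite -val_eqE /= => ne; rewrite slice_hform ?size_hform // eq_sym (negbTE ne).
rewrite gE; split=> [h|/ker h i].
  rewrite (psi_eq0 hom) => i; case: (ltnP i n) => ni; last by rewrite hform0 ?size_slice.
  apply/(presents_hform ker); first exact: size_slice.
  by rewrite (slice_g (Ordinal ni)) -subst_frameE ?size_slice //; apply: h.
rewrite subst_frameE ?size_slice //; case: (ltnP i n) => ni.
  by rewrite -(slice_g (Ordinal ni)); apply: h.
by apply/(presents_hform ker); [exact: size_hform|rewrite hform0 // size_hform].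
Qed.

End Substitution.

Lemma nilpotent_coef0 (R : falgType K) (psi : {lrmorphism fps2 K -> R}) F n :
  fps2_homogeneous [set f | psi f = 0] -> psi F ^+ n = 0 -> F 0%N 0%N = 0.
Proof.
move=> hom h.
have c0 (f g : fps2 K) : (f * g) 0%N 0%N = f 0%N 0%N * g 0%N 0%N.
  by rewrite fps2_mulE !big_ord1.
have pow k : (F ^+ k) 0%N 0%N = F 0%N 0%N ^+ k.
  by elim: k => [|k IH]; rewrite ?expr0 ?fps2_oneE // !exprS c0 IH.
have : psi (F ^+ n) = 0 by rewrite rmorphXn.
move/(hform_psi_eq0 hom 0); rewrite /hform big_ord1 mulr1 expr0 coef_slice // pow.
by move/eqP; rewrite scaler_eq0 oner_eq0 orbF expf_eq0 => /andP[_ /eqP].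
Qed.

Lemma ord_ge1 (F : fps2 K) : F 0%N 0%N = 0 -> ord_ge 1 F.
Proof. by move=> h [|a] [|b]. Qed.

Lemma slice_lead i j (f g : fps2 K) : ord_ge i f -> ord_ge j g ->
  slice (i + j) (f * g) = slice i f * slice j g.
Proof.
move=> /ord_geP hf /ord_geP hg; have ij : (i < (i + j).+1)%N by rewrite ltnS leq_addr.
rewrite slice_mul (bigD1 (Ordinal ij)) //= addKn big1 ?addr0 // => k.
rewrite -val_eqE /= neq_ltn => /orP[ki|ik]; first by rewrite hf ?mul0r.
by rewrite hg ?mulr0 //; have := ltn_ord k; lia.
Qed.

Lemma slice_hform_lead i p (F G : fps2 K) : ord_ge 1 F -> ord_ge 1 G ->
  slice i (hform F G i p) = hform (slice 1 F) (slice 1 G) i p.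
Proof.
move=> hF hG.
have X (H : fps2 K) k : ord_ge 1 H -> ord_ge k (H ^+ k) /\ slice k (H ^+ k) = slice 1 H ^+ k.
  move=> hH; elim: k => [|k [IH1 IH2]].
    split=> //; rewrite !expr0; apply/polyP => k; case: k => [|k].
      by rewrite coef_slice // fps2_oneE coefC.
    by rewrite coef_slice_gt // coefC.
  rewrite !exprS -add1n; split; first exact: ord_geM.
  by rewrite slice_lead // IH2.
rewrite /hform raddf_sum; apply: eq_bigr => k _ /=.
have ki : (k <= i)%N by rewrite -ltnS.
have := slice_lead (X F k hF).1 (X G (i - k)%N hG).1.
by rewrite subnKC // linearZ /= (X F k hF).2 (X G _ hG).2 => ->.
Qed.

(** The isomorphism need not respect the gradings, but its linear part does. The images of [x] and
    [y] are lifted to series [F], [G]; the leading form of [hform F G i p] depends only on their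
    linear parts, and it lies in the kernel because that is homogeneous. An inclusion of kernels is
    enough, as the dimensions agree. *)
Lemma iso_subst (R S : falgType K) phi phi' :
  hframe phi -> hframe phi' -> presents R phi -> presents S phi' -> t 1 = 2%N ->
  alg_isomorphic R S ->
  exists L1 L2, [/\ (size L1 <= 2)%N, (size L2 <= 2)%N, form_det L1 L2 != 0
    & forall i p, (size p <= i.+1)%N -> poly_rV p *m phi i = 0 ->
        poly_rV p *m subst_frame L1 L2 phi' i = 0].
Proof.
move=> h h' [psi [surj ker]] [psi' [surj' ker']] t1 [g bij].
have ginj := bij_inj bij.
have hom := presents_hom ker; have hom' := presents_hom ker'.
have [F hF] := surj' (g (psi (fps2X K))); have [G hG] := surj' (g (psi (fps2Y K))).
have [g' gK g'K] := bij.
have [F' hF'] := surj (g' (psi' (fps2X K))); have [G' hG'] := surj (g' (psi' (fps2Y K))).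
have gF' : g (psi F') = psi' (fps2X K) by rewrite hF' g'K.
have gG' : g (psi G') = psi' (fps2Y K) by rewrite hG' g'K.
have nil (A : falgType K) (f : {lrmorphism fps2 K -> A}) z :
    fps2_homogeneous [set u | f u = 0] -> ord_ge 1 z -> exists n, f z ^+ n = 0.
  move=> homf hz; have [n hn] := psi_ord_ge homf; exists n.
  rewrite -(rmorphXn f) /= hn //.
  have : forall k, ord_ge k (z ^+ k); last by apply.
  by elim=> [|k IH] //; rewrite exprS; apply: (@ord_geM _ 1 k).
have F1 : ord_ge 1 F.
  apply: ord_ge1; have [n hn] := nil _ _ _ hom (ord_ge_var (or_introl erefl)).
  by apply: (@nilpotent_coef0 _ psi' F n hom'); rewrite hF -(rmorphXn g) /= hn raddf0.
have G1 : ord_ge 1 G.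
  apply: ord_ge1; have [n hn] := nil _ _ _ hom (ord_ge_var (or_intror erefl)).
  by apply: (@nilpotent_coef0 _ psi' G n hom'); rewrite hG -(rmorphXn g) /= hn raddf0.
have F'1 : ord_ge 1 F'.
  apply: ord_ge1; have [n hn] := nil _ _ _ hom' (ord_ge_var (or_introl erefl)).
  by apply: (@nilpotent_coef0 _ psi F' n hom); apply: ginj; rewrite rmorphXn /= gF' hn raddf0.
have G'1 : ord_ge 1 G'.
  apply: ord_ge1; have [n hn] := nil _ _ _ hom' (ord_ge_var (or_intror erefl)).
  by apply: (@nilpotent_coef0 _ psi G' n hom); apply: ginj; rewrite rmorphXn /= gG' hn raddf0.
exists (slice 1 F), (slice 1 G); split; rewrite ?size_slice //; last first.
  move=> i p sp /(presents_hform ker sp) h0.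
  rewrite subst_frameE ?size_slice // -slice_hform_lead //.
  have /ker' : psi' (hform F G i p) = 0 by rewrite hform_rmorph hF hG -hform_rmorph h0 raddf0.
  by apply.
apply/negP => /eqP D0.
have [c [d [cd0 lin]]] : exists c d : K, (c, d) != (0, 0) /\ c *: slice 1 F + d *: slice 1 G = 0.
  have comb (a b : K) : a * (slice 1 F)`_0 + b * (slice 1 G)`_0 = 0 ->
      a * (slice 1 F)`_1 + b * (slice 1 G)`_1 = 0 -> a *: slice 1 F + b *: slice 1 G = 0.
    move=> e0 e1; apply/polyP => k; rewrite coefD !coefZ coef0.
    by case: k => [|[|k]] //; rewrite !coef_slice_gt // !mulr0 addr0.
  have := D0; rewrite /form_det => /eqP; rewrite subr_eq0 => /eqP e.
  have [F00|F00] := eqVneq (slice 1 F)`_0 0; last first.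
    exists (- (slice 1 G)`_0), (slice 1 F)`_0; split.
      by rewrite xpair_eqE negb_and F00 orbT.
    apply: comb; first by rewrite mulNr mulrC addNr.
    by rewrite mulNr mulrC e addNr.
  have [F10|F10] := eqVneq (slice 1 F)`_1 0; last first.
    exists (- (slice 1 G)`_1), (slice 1 F)`_1; split.
      by rewrite xpair_eqE negb_and F10 orbT.
    apply: comb; last by rewrite mulNr mulrC addNr.
    by rewrite mulNr e mulrC addNr.
  exists 1, 0; split; first by rewrite xpair_eqE negb_and oner_eq0.
  by apply: comb; rewrite ?F00 ?F10 !mul0r mulr0 addr0.
(* If the linear parts were dependent, [c F + d G] would have order at least 2. Carried back by the
   inverse isomorphism, [c x + d y] would agree in [R] with a series of order at least 2, against
   [t 1 = 2]. *)
have H2 : ord_ge 2 (c *: F + d *: G).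
  apply/ord_geP => -[|[|//]] _; last by rewrite raddfD /= !linearZ.
  by move/ord_geP: F1 => F1; move/ord_geP: G1 => G1; rewrite raddfD /= !linearZ /= F1 ?G1 // !scaler0 addr0.
have [u hu] := ord_ge_decomp H2.
pose lift' s := projT1 (cid (surj (g' (psi' s)))).
have lift'E s : g (psi (lift' s)) = psi' s by rewrite /lift' (projT2 (cid (surj _))) g'K.
pose W := \sum_(a < 3) F' ^+ a * G' ^+ (2 - a) * lift' (u a).
have W2 : ord_ge 2 W.
  have X (H : fps2 K) k : ord_ge 1 H -> ord_ge k (H ^+ k).
    by move=> hH; elim: k => [|k IH] //; rewrite exprS; apply: (@ord_geM _ 1 k).
  apply/ord_geP => k k2; rewrite raddf_sum big1 // => a _ /=.
  have a2 : (a <= 2)%N by rewrite -ltnS.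
  have /ord_geP -> // : ord_ge 2 (F' ^+ a * G' ^+ (2 - a) * lift' (u a)).
  apply: (@ord_geM _ 2 0) => //.
  by have := ord_geM (X F' a F'1) (X G' (2 - a)%N G'1); rewrite subnKC.
have : psi (c *: fps2X K + d *: fps2Y K - W) = 0.
  rewrite raddfB; apply/eqP; rewrite subr_eq0; apply/eqP; apply: ginj.
  rewrite raddfD /= !linearZ raddfD /= !linearZ /= -hF -hG -!linearZ -raddfD hu.
  rewrite /W !raddf_sum; apply: eq_bigr => a _ /=.
  by rewrite !rmorphM !rmorphXn /= gF' gG' lift'E.
move/ker/(_ 1%N); rewrite raddfB /= (_ : slice 1 W = 0); last by move/ord_geP: W2 => ->.
rewrite subr0 => h0.
have rf : row_free (phi 1%N) by rewrite /row_free h.1 t1.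
have : poly_rV (slice 1 (c *: fps2X K + d *: fps2Y K)) = 0 :> 'rV[K]_2.
  by apply: (row_free_inj rf); rewrite h0 mul0mx.
move=> e; have e0 := congr1 (fun v : 'rV[K]_2 => v 0 0) e.
have e1 := congr1 (fun v : 'rV[K]_2 => v 0 1) e.
move: e0 e1; rewrite !mxE !coef_slice // !fps2_addE !fps2_scaleE /fps2X /fps2Y /fps2_monomial /=.
rewrite !mulr0 !mulr1 add0r addr0 => d0 c0.
by rewrite d0 c0 eqxx in cd0.
Qed.

End Presentations.

(** * The associated graded algebra of a local algebra *)

Section LocalAlgebra.
Local Open Scope ring_scope.
Variables (K : fieldType) (R : falgType K) (m : {vspace R}).
Hypotheses (commR : commutative (@GRing.mul R)) (maxm : is_maximal_ideal m).
Local Notation P := (ideal_pow m).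

Lemma prodv_comm (U V : {vspace R}) : (U * V)%VS = (V * U)%VS.
Proof.
by apply/eqP; rewrite eqEsubv; apply/andP; split; apply/prodvP => u v hu hv;
  rewrite commR memv_mul.
Qed.

Lemma ideal_powS i : P i.+1 = (m * P i)%VS.
Proof.
have [idm _ _] := maxm; have fm : ({:R} * m)%VS = m.
  apply/eqP; rewrite eqEsubv idm /=; apply/subvP => u um.
  by rewrite -[u]mul1r memv_mul ?memvf.
by rewrite /ideal_pow expvSl [LHS]prodvA fm [RHS]prodvA [(m * {:R})%VS]prodv_comm fm.
Qed.

Lemma ideal_pow0 : P 0 = fullv.
Proof. by rewrite /ideal_pow expv0 prodv1. Qed.

Lemma ideal_pow_ideal i : ({:R} * P i <= P i)%VS.
Proof.
case: i => [|i]; first by rewrite ideal_pow0 subvf.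
by have [idm _ _] := maxm; rewrite ideal_powS prodvA prodvSl.
Qed.

Lemma ideal_pow_decr i : (P i.+1 <= P i)%VS.
Proof.
by rewrite ideal_powS; apply: subv_trans (ideal_pow_ideal i); rewrite prodvSl ?subvf.
Qed.

Lemma maximal_prime a b : a * b \in m -> a \in m \/ b \in m.
Proof.
move=> ab; have [|am] := boolP (a \in m); [by left|right].
have [idm nm max] := maxm.
have /memv_imgP [s _ hs] : 1 \in limg (linfun (a \o* idfun : R -> R)).
  rewrite -[_ \in _]/(1 \in _) (_ : limg _ = fullv) ?memvf //.
  apply: contrapT => nf; case/negP: am; apply: (subvP (max _ _ nf)); last first.
    by apply/memv_imgP; exists 1; rewrite ?memvf // lfunE /= mul1r.
  apply/prodvP => u _ _ /memv_imgP [v _ ->]; apply/memv_imgP; exists (u * v).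
    exact: memvf.
  by rewrite !lfunE /= mulrA.
move: hs; rewrite lfunE /= => hs.
by rewrite -[b]mul1r hs -mulrA; apply: (subvP idm); rewrite memv_mul ?memvf.
Qed.

Hypothesis residue : forall r, exists c : K, r - c%:A \in m.

(** A Hilbert-Samuel sequence may come from an algebra that is not graded. Its associated graded
    algebra has the same sequence: forms of degree [i] in two generators of [m], taken modulo
    [P i.+1], give the frame in degree [i]. *)
Lemma local_hframe T : has_HilbertSamuel R T -> nth 0%N T 1 = 2%N ->
  exists phi : (forall i, 'M[K]_(i.+1, nth 0%N T i)), hframe phi.
Proof.
move=> [_ [_ [m' maxm' hT]]] T1; rewrite -(maximal_ideal_uniq maxm maxm') in hT.
have P1 : P 1 = m.
  by rewrite ideal_powS ideal_pow0 prodv_comm; apply/eqP; rewrite eqEsubv; have [-> _ _] := maxm;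
   apply/subvP => u um; rewrite -[u]mul1r memv_mul ?memvf.
have [x [y [xm ym mxy]]] : exists x y, [/\ x \in m, y \in m & (m <= <[x]> + <[y]> + P 2%N)%VS].
  pose s := (vbasis (m :\: P 2%N) : seq R).
  have E : (m :\: P 2%N + P 2%N)%VS = m.
    by rewrite addv_diff; apply/addv_idPl; rewrite -[X in (_ <= X)%VS]P1 ideal_pow_decr.
  have dims : size s = 2%N.
    have dm := dimv_disjoint_sum (capv_diff m (P 2%N)); rewrite E in dm.
    have h := hT 1%N; rewrite T1 P1 in h.
    by rewrite size_tuple; move: dm h; lia.
  have sA i : s`_i \in m.
    apply: (subvP (diffvSl m (P 2%N))).
    case: (ltnP i (size s)) => h; last by rewrite nth_default ?mem0v.
    by apply: vbasis_mem; rewrite mem_nth.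
  exists s`_0, s`_1; split=> //; apply: subv_trans (_ : (m :\: P 2%N + P 2%N <= _)%VS); first by rewrite E.
  apply: addvS => //.
  rewrite -(span_basis (vbasisP (m :\: P 2%N))) -/s.
  apply/span_subvP => u us; rewrite -(nth_index 0 us).
  have : (index u s < 2)%N by rewrite -[X in (_ < X)%N]dims index_mem.
  case: (index u s) => [|[|//]] _.
    by apply: (subvP (addvSl _ _)); rewrite memv_line.
  by apply: (subvP (addvSr _ _)); rewrite memv_line.
have xy : x * y = y * x by exact: commR.
pose hv i : 'Hom('rV[K]_i.+1, R) := linfun (hform x y i \o (@rVpoly K i.+1)).
have hvE i (p : {poly K}) : (size p <= i.+1)%N -> hv i (poly_rV p) = hform x y i p.
  by move=> sp; rewrite lfunE /= poly_rV_K.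
have hformP i p : hform x y i p \in P i.
  apply: memv_suml => k _; apply: memvZ.
  have ki : (k <= i)%N by rewrite -ltnS.
  have XY a b : x ^+ a * y ^+ b \in P (a + b)%N.
    elim: a => [|a IH].
      rewrite mul1r; elim: b => [|b IH]; first by rewrite ideal_pow0 memvf.
      by rewrite exprS ideal_powS memv_mul.
    by rewrite exprS -mulrA addSn ideal_powS memv_mul.
  by rewrite -[X in P X](subnKC ki).
(* Modulo [P i.+1] the ideal [P i] is spanned by the forms of degree [i]; the base case is where
   scalars have to represent the residue field. *)
have gen i : (P i <= limg (hv i) + P i.+1)%VS.
  elim: i => [|i IH].
    apply/subvP => u _; have [c hc] := residue u.
    rewrite -[u](subrK (c%:A)) addrC; apply: memv_add; last by rewrite P1.
    have -> : c%:A = hv 0%N (poly_rV c%:P).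
      rewrite hvE; last by rewrite (leq_trans (size_polyC_leq1 _)).
      by rewrite /hform big_ord1 coefC mulr1.
    by rewrite memv_img // memvf.
  rewrite [X in (X <= _)%VS]ideal_powS; apply/prodvP => a w am wP.
  have /memv_addP [u /memv_addP [_ /vlineP [c ->] [_ /vlineP [d ->] ->]] [w2 w2P ->]] := subvP mxy _ am.
  have /memv_addP [h hh [w' w'P wE]] := subvP IH _ wP.
  have [v _ hE] := memv_imgP hh.
  have -> : (c *: x + d *: y + w2) * w =
     (c *: x + d *: y) * h + ((c *: x + d *: y) * w' + w2 * w) by rewrite wE mulrDl [(_ + _) * (_ + _)]mulrDr addrA.
  apply: memv_add; last first.
    apply: memvD.
      by rewrite [P i.+2]ideal_powS memv_mul // rpredD // memvZ.
    have -> : P i.+2 = (P 2%N * P i)%VS.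
      by rewrite !ideal_powS ideal_pow0 -!prodvA [(fullv * _)%VS](_ : _ = P i) // /ideal_pow prodvA prodv_id.
    by rewrite memv_mul.
  have sp : (size (c *: 'X + d%:P)%R <= 2)%N.
    rewrite (leq_trans (size_polyD _ _)) // geq_max (leq_trans (size_scale_leq _ _)) ?size_polyX //.
    by rewrite (leq_trans (size_polyC_leq1 _)).
  have -> : (c *: x + d *: y) * h = hv i.+1 (poly_rV ((c *: 'X + d%:P) * rVpoly v)).
    rewrite hvE.
      have -> := hformM xy sp (size_poly i.+1 _ : (size (rVpoly v) <= i.+1)%N).
      congr (_ * _); last by rewrite hE lfunE.
      rewrite raddfD /= linearZ /= -['X]expr1 hformXn // subnn mulr1; congr (_ + _).
      by rewrite -[d%:P]mulr1 mul_polyC linearZ /= hform1.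
    rewrite (leq_trans (size_polyMleq _ _)) //.
    by have := size_poly i.+1 (fun k => if insub k is Some i then v 0 i else 0);
      rewrite -[\poly_(k < _) _]/(rVpoly v); move: sp; move: (size _) (size _) => a' b'; lia.
  by rewrite memv_img // memvf.
have PE i : P i = (limg (hv i) + P i.+1)%VS.
  apply/eqP; rewrite eqEsubv gen subv_add ideal_pow_decr andbT; apply/subvP => u.
  by case/memv_imgP => v _ ->; rewrite lfunE; apply: hformP.
have ex i : exists2 A : 'M[K]_(i.+1, nth 0%N T i), \rank A = nth 0%N T i &
    forall v, v *m A = 0 <-> v \in (hv i @^-1: P i.+1)%VS.
  apply: kernel_frame; rewrite hT.
  set U := (hv i @^-1: _)%VS.
  have d1 : (\dim (lker (hv i)) + \dim (limg (hv i)) = i.+1)%N.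
    by have := limg_ker_dim (hv i) fullv; rewrite capfv => ->; rewrite dimvf dim_matrix mul1r.
  have d2 : (\dim (lker (hv i)) + \dim (P i.+1 :&: limg (hv i))%VS = \dim U)%N.
    have -> : lker (hv i) = (U :&: lker (hv i))%VS.
      by apply/esym/capv_idPr; rewrite -lpreim0 lpreimS ?sub0v.
    have -> : (P i.+1 :&: limg (hv i))%VS = (hv i @: U)%VS.
      by rewrite /U -lpreim_cap_limg lpreimK // capvSr.
    exact: limg_ker_dim.
  have d3 := dimv_sum_cap (limg (hv i)) (P i.+1); rewrite -PE capvC in d3.
  have d4 := dimvS (ideal_pow_decr i).
  have d5 := dimvS (capvSl (P i.+1) (limg (hv i))).
  have arith (k l n u c p q : nat) : (k + l = n -> k + c = u -> p + c = l + q ->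
      q <= p -> c <= q -> u + (p - q) = n)%N by lia.
  exact: arith d1 d2 d3 d4 d5.
pose phi i := s2val (cid2 (ex i)).
have phiP i (p : {poly K}) : (size p <= i.+1)%N ->
    poly_rV p *m phi i = 0 <-> hform x y i p \in P i.+1.
  by move=> sp; rewrite (s2valP' (cid2 (ex i))) -memv_preim hvE.
exists phi; split=> [i|i p sp]; first exact: (s2valP (cid2 (ex i))).
move=> /(phiP _ _ sp) h0.
have sX : (size ('X * p)%R <= i.+2)%N.
  by rewrite (leq_trans (size_polyMleq _ _)) // size_polyX.
split; apply/phiP; rewrite ?(leq_trans sp) //.
  rewrite -[p]mul1r -add1n hformM ?size_poly1 // hform1 expr1 ideal_powS memv_mul //.
rewrite -add1n hformM ?size_polyX // -['X]expr1 hformXn // subnn mulr1 expr1.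
by rewrite ideal_powS memv_mul.
Qed.

End LocalAlgebra.

Section ClosedResidueField.
Local Open Scope ring_scope.

(** An annihilating polynomial of [r] splits into linear factors over [K], and one of these factors,
    evaluated at [r], lies in the prime ideal [m]. *)
Lemma residue_field (K : closedFieldType) (R : falgType K) (m : {vspace R}) (r : R) :
  is_maximal_ideal m -> exists c : K, r - c%:A \in m.
Proof.
move=> maxm.
have [idm nm max] := maxm.
have one_m : 1 \notin m.
  apply/negP => h; apply: nm; apply/eqP; rewrite eqEsubv subvf; apply/subvP => u _.
  by rewrite -[u]mulr1; apply: (subvP idm); rewrite memv_mul ?memvf.
pose n := (\dim {:R}).+1.
pose F (v : 'rV[K]_n) : R := horner_alg r (rVpoly v).
have linF : linear F.
  move=> c u v; rewrite /F [rVpoly _]linearP /= rmorphD /= -mul_polyC rmorphM /= horner_algC.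
  by rewrite -scalerAl mul1r.
pose lF : {linear 'rV[K]_n -> R} := HB.pack F (GRing.isLinear.Build _ _ _ _ F linF).
have nz : lker (linfun lF) != 0%VS.
  apply/eqP => h; have := limg_ker_dim (linfun lF) fullv.
  rewrite capfv h dimv0 add0n dimvf dim_matrix mul1r => e.
  by have := dimvS (subvf (limg (linfun lF))); rewrite e ltnn.
have := memv_pick (lker (linfun lF)); rewrite memv_ker lfunE => /eqP h.
set v := vpick _ in h; pose p := rVpoly v; rewrite -[LHS]/(horner_alg r p) in h.
have p0 : p != 0.
  apply: contraNneq nz => p0; rewrite -vpick0 -/v -[v]rVpolyK -/p p0 raddf0 //.
have [s ps] := closed_field_poly_normal p.
have : horner_alg r (\prod_(z <- s) ('X - z%:P)) \in m.
  move: h; rewrite ps -mul_polyC rmorphM /= horner_algC -scalerAl mul1r => /eqP; rewrite scaler_eq0 lead_coef_eq0 (negbTE p0) => /eqP ->.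
  exact: mem0v.
elim: s {ps} => [|z s IH]; first by rewrite big_nil rmorph1 (negbTE one_m).
rewrite big_cons rmorphM rmorphB /= horner_algX horner_algC => /(maximal_prime maxm) [hz|/IH //].
by exists z.
Qed.

Lemma HilbertSamuel_hframe (K : closedFieldType) (T : seq nat) :
  HilbertSamuel_sequence K T -> nth 0%N T 1 = 2%N ->
  exists phi : (forall i, 'M[K]_(i.+1, nth 0%N T i)), hframe phi.
Proof.
move=> [R HS] T1; have [commR [_ [m maxm _]]] := HS.
by apply: (local_hframe commR maxm _ HS T1) => r; apply: residue_field.
Qed.

End ClosedResidueField.

(** * The structure of homogeneous ideals *)

Section HomogeneousStructure.
Local Open Scope ring_scope.
Variables (K : closedFieldType) (T : seq nat).
Local Notation t := (nth 0%N T).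
Variable phi : forall i, 'M[K]_(i.+1, t i).
Hypothesis hphi : hframe phi.
Implicit Types p q f g h : {poly K}.

Definition in_ker i p := (size p <= i.+1)%N /\ poly_rV p *m phi i = 0.

Lemma in_kerD i p q : in_ker i p -> in_ker i q -> in_ker i (p + q).
Proof.
move=> [sp hp] [sq hq]; split; last by rewrite raddfD /= mulmxDl hp hq addr0.
by rewrite (leq_trans (size_polyD _ _)) // geq_max sp.
Qed.

Lemma in_kerZ i c p : in_ker i p -> in_ker i (c *: p).
Proof.
move=> [sp hp]; split; first exact: leq_trans (size_scale_leq _ _) sp.
by rewrite linearZ -scalemxAl hp scaler0.
Qed.

Lemma in_kerB i p q : in_ker i p -> in_ker i q -> in_ker i (p - q).
Proof. by move=> hp hq; rewrite -scaleN1r; apply: in_kerD => //; apply: in_kerZ. Qed.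

Lemma in_ker_sum i n (F : 'I_n -> {poly K}) : (forall k, in_ker i (F k)) ->
  in_ker i (\sum_(k < n) F k).
Proof.
move=> h; elim/big_rec: _ => [|k p _]; last exact: in_kerD.
by split; [rewrite size_poly0|rewrite raddf0 mul0mx].
Qed.

Lemma in_kerS i p : in_ker i p -> in_ker i.+1 p.
Proof. by move=> [sp hp]; split; [exact: leqW|exact: (hphi.2 i p sp hp).1]. Qed.

Lemma in_kerX i p : in_ker i p -> in_ker i.+1 ('X * p).
Proof.
move=> [sp hp]; split; last exact: (hphi.2 i p sp hp).2.
by rewrite (leq_trans (size_polyMleq _ _)) // size_polyX.
Qed.

Lemma in_kerM i k p q : in_ker i p -> (size q <= k.+1)%N -> in_ker (k + i) (q * p).
Proof.
move=> [sp hp] sq; split; last exact: hframe_mul.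
by rewrite (leq_trans (size_polyMleq _ _)) //; move: sp sq; move: (size _) (size _) => a b; lia.
Qed.

Lemma leq_frame i : (t i <= i.+1)%N.
Proof. by rewrite -[X in (X <= _)%N](hphi.1 i); apply: rank_leq_row. Qed.

Definition multiples_mx i n f : 'M[K]_(n, i.+1) := \matrix_(k < n) poly_rV ('X^k * f).

Lemma mul_multiples_mx i n f (v : 'rV_n) : v *m multiples_mx i n f = poly_rV (rVpoly v * f).
Proof.
rewrite mulmx_sum_row (poly_sumXn (size_poly n _ : size (rVpoly v) <= n)%N) mulr_suml raddf_sum.
apply: eq_bigr => k _; rewrite rowK -scalerAl /= linearZ; congr (_ *: _).
by rewrite coef_rVpoly_ord.
Qed.

Lemma multiples_mx_free i n f : f != 0 -> (size f + n <= i.+2)%N -> row_free (multiples_mx i n f).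
Proof.
move=> f0 sf; rewrite -kermx_eq0; apply/rowV0P => v /sub_kermxP.
rewrite mul_multiples_mx => /(congr1 rVpoly); rewrite raddf0 poly_rV_K.
  by move/eqP; rewrite mulf_eq0 (negbTE f0) orbF => /eqP v0; rewrite -[v]rVpolyK v0 raddf0.
have := size_poly n (fun k => if insub k is Some i then v 0 i else 0).
rewrite -[\poly_(k < _) _]/(rVpoly v) => sv.
rewrite (leq_trans (size_polyMleq _ _)) //.
by have := lt0n (size f); rewrite size_poly_eq0 f0; move: sv sf; move: (size _) (size _) => a b; lia.
Qed.

Lemma rank_ker i : \rank (kermx (phi i)) = (i.+1 - t i)%N.
Proof. by rewrite mxrank_ker hphi.1. Qed.

Lemma multiples_in_ker i n f : (size f + n <= i.+2)%N -> (forall k, (k < n)%N -> in_ker i ('X^k * f)) ->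
  forall h, (size h <= n)%N -> in_ker i (h * f).
Proof.
move=> sf hf h sh; rewrite (poly_sumXn sh) mulr_suml; apply: in_ker_sum => k.
by rewrite -scalerAl; apply: in_kerZ; apply: hf.
Qed.

(** The [n] multiples [X^k f] are independent and lie in the kernel, whose dimension [i.+1 - t i] is
    at most [n]. *)
Lemma ker_multiples i n f : f != 0 -> (size f + n <= i.+2)%N ->
  (forall k, (k < n)%N -> in_ker i ('X^k * f)) -> (i.+1 - t i <= n)%N ->
  forall p, in_ker i p <-> exists2 h : {poly K}, (size h <= n)%N & p = h * f.
Proof.
move=> f0 sf hf nr p; split=> [[sp hp]|[h sh ->]]; last exact: multiples_in_ker hf _ sh.
have sub : (multiples_mx i n f <= kermx (phi i))%MS.
  by apply/row_subP => k; rewrite rowK; have [sk hk] := hf k (ltn_ord k); apply/sub_kermxP.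
have rk : \rank (multiples_mx i n f) = n by apply/eqP; exact: multiples_mx_free.
have eqm : (kermx (phi i) <= multiples_mx i n f)%MS.
  have := mxrank_leqif_sup sub; rewrite rk rank_ker => -[le <-].
  by rewrite eqn_leq le.
have /submxP [v hv] : (poly_rV p <= multiples_mx i n f)%MS.
  by apply: submx_trans eqm; apply/sub_kermxP.
exists (rVpoly v); first exact: size_poly.
have := congr1 rVpoly hv; rewrite mul_multiples_mx !poly_rV_K //.
have := size_poly n (fun k => if insub k is Some i then v 0 i else 0).
rewrite -[\poly_(k < _) _]/(rVpoly v) => sv; rewrite (leq_trans (size_polyMleq _ _)) //.
by have := lt0n (size f); rewrite size_poly_eq0 f0; move: sv sf; move: (size _) (size _) => a b; lia.
Qed.

Lemma in_ker_exists i : (t i <= i)%N -> exists2 p, in_ker i p & p != 0.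
Proof.
move=> ti; have : kermx (phi i) != 0 by rewrite -mxrank_eq0 rank_ker subn_eq0 -ltnNge ltnS.
case/rowV0Pn => v /sub_kermxP hv v0; exists (rVpoly v).
  by split; [exact: size_poly|rewrite rVpolyK].
by apply: contraNneq v0 => h; rewrite -[v]rVpolyK h raddf0.
Qed.

Lemma in_ker_extremal i : (t i <= i)%N ->
  (exists2 g, in_ker i g & g != 0 /\ forall p, in_ker i p -> (size p <= size g)%N) /\
  (exists2 f, in_ker i f & f != 0 /\ forall p, in_ker i p -> p != 0 -> (size f <= size p)%N).
Proof.
move=> ti; have [p0 hp0 p00] := in_ker_exists ti.
pose P n := `[< exists2 g, in_ker i g & g != 0 /\ size g = n >].
have ex : exists n, P n by exists (size p0); apply/asboolP; exists p0.
split.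
  have ub n : P n -> (n <= i.+1)%N by move=> /asboolP [g [sg _] [_ <-]].
  case: (ex_maxnP ex ub) => n /asboolP [g hg [g0 sg]] max; exists g => //; split=> // p hp.
  have [->|pn0] := eqVneq p 0; first by rewrite size_poly0.
  by rewrite sg; apply: max; apply/asboolP; exists p.
case: (ex_minnP ex) => n /asboolP [g hg [g0 sg]] min; exists g => //; split=> // p hp pn0.
by rewrite sg; apply: min; apply/asboolP; exists p.
Qed.

Section MaximalDegree.
Variables (i : nat) (g : {poly K}).
Hypotheses (hg : in_ker i g) (g0 : g != 0).
Hypothesis gmax : forall p, in_ker i p -> (size p <= size g)%N.

(** Multiplication by [y], which does not change the polynomial encoding a form; below, [U] is
    [y V_i]. *)
Let inc : 'M[K]_(i.+1, i.+2) := \matrix_(k < i.+1) poly_rV 'X^k.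

Let mul_inc (v : 'rV[K]_i.+1) : v *m inc = poly_rV (rVpoly v).
Proof.
have -> : inc = multiples_mx i.+1 i.+1 1 by apply/row_matrixP => k; rewrite !rowK mulr1.
by rewrite mul_multiples_mx mulr1.
Qed.

Let inc_free : row_free inc.
Proof.
have -> : inc = multiples_mx i.+1 i.+1 1 by apply/row_matrixP => k; rewrite !rowK mulr1.
by apply: multiples_mx_free; rewrite ?oner_eq0 // size_poly1; lia.
Qed.

Let U := kermx (phi i) *m inc.

Let rankU : \rank U = (i.+1 - t i)%N.
Proof. by rewrite mxrankMfree // rank_ker. Qed.

Let subU p : (poly_rV p <= U)%MS -> (size p <= i.+2)%N -> in_ker i p.
Proof.
move=> /submxP [v hv] sp; have := congr1 rVpoly hv; rewrite mulmxA mul_inc !poly_rV_K //.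
  move=> ->; split; first exact: size_poly.
  by rewrite rVpolyK; apply/sub_kermxP; rewrite submxMl.
exact: leq_trans (size_poly _ _) _.
Qed.

Let Xg_notin : ~~ (poly_rV ('X * g) <= U)%MS.
Proof.
apply/negP => /subU h; have [sXg _] := in_kerX hg.
by have := gmax (h sXg); rewrite mulrC size_mulX // ltnn.
Qed.

Let UX_sub : (U + (poly_rV ('X * g) : 'rV_i.+2) <= kermx (phi i.+1))%MS.
Proof.
rewrite addsmx_sub; apply/andP; split; last first.
  by apply/sub_kermxP; exact: (in_kerX hg).2.
apply/rV_subP => v /submxP [w ->]; rewrite /U mulmxA mul_inc.
apply/sub_kermxP; apply: (in_kerS _).2; split; first exact: size_poly.
by rewrite rVpolyK; apply/sub_kermxP; rewrite submxMl.
Qed.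

Let rankUX : ((i.+1 - t i).+1 <= \rank (U + (poly_rV ('X * g) : 'rV_i.+2))%MS)%N.
Proof.
rewrite -rankU; apply: rank_ltmx; rewrite /ltmx addsmxSl /=.
by apply: contra Xg_notin => h; apply: submx_trans h; apply: addsmxSr.
Qed.

(** [X g] exceeds every element of [y V_i] in size, so [V_(i+1)] has larger dimension than [V_i]. *)
Lemma ker_growth : (t i <= i)%N -> (t i.+1 <= t i)%N.
Proof.
move=> ti; have := leq_trans rankUX (mxrankS UX_sub); rewrite rank_ker.
by have := leq_frame i.+1; lia.
Qed.

(** If [t] does not drop, [V_(i+1)] is exactly [y V_i] plus the line of [X g], and an element no
    longer than [g] cannot involve [X g]. *)
Lemma ker_descend p : t i.+1 = t i -> (t i <= i)%N -> in_ker i.+1 p -> (size p <= size g)%N -> in_ker i p.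
Proof.
move=> te ti [sp hp] spg.
have eqm : (kermx (phi i.+1) <= U + (poly_rV ('X * g) : 'rV_i.+2))%MS.
  have := mxrank_leqif_sup UX_sub => -[le <-]; rewrite eqn_leq le /= rank_ker te.
  by apply: leq_trans rankUX; lia.
have /sub_addsmxP [[a c] /= e] : (poly_rV p <= U + (poly_rV ('X * g) : 'rV_i.+2))%MS.
  by apply: submx_trans eqm; apply/sub_kermxP.
pose v := rVpoly (a *m U).
have hv : in_ker i v.
  by apply: subU; rewrite ?rVpolyK ?submxMl // size_poly.
have pE : p = v + c 0 0 *: ('X * g).
  have := congr1 rVpoly e; rewrite poly_rV_K // => ->.
  rewrite raddfD /=; congr (_ + _); rewrite [c]mx11_scalar mul_scalar_mx linearZ /= poly_rV_K //.
    by rewrite mxE eqxx mulr1n.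
  exact: (in_kerX hg).1.
have [c0|c0] := eqVneq (c 0 0) 0; first by rewrite pE c0 scale0r addr0.
have : (size (c 0%R 0%R *: ('X * g)) <= size g)%N.
  have -> : c 0 0 *: ('X * g) = p - v by rewrite pE addrC addKr.
  by rewrite (leq_trans (size_polyD _ _)) // geq_max spg size_polyN gmax.
by rewrite size_scale // mulrC size_mulX // ltnn.
Qed.

End MaximalDegree.

Lemma hframe_decr i : (t i <= i)%N -> (t i.+1 <= t i)%N.
Proof.
move=> ti; have [[g hg [g0 gmax]] _] := in_ker_extremal ti.
exact: (ker_growth hg g0 gmax ti).
Qed.

(** By [ker_descend] the element [f] of least size may be multiplied by [X] until it reaches the
    size of [g]. Division by [f] then leaves remainders in the kernel, so [f] divides everything.
    The size of [f] may be less than [(t i).+1]: the missing degree is the multiplicity of the root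
    at infinity. *)
Lemma ker_structure_right i : t i.+1 = t i -> (t i <= i)%N ->
  exists f, [/\ f != 0, (size f <= (t i).+1)%N &
    forall p, in_ker i p <-> exists2 h : {poly K}, (size h <= i.+1 - t i)%N & p = h * f].
Proof.
move=> te ti; have [[g hg [g0 gmax]] [f hf [f0 fmin]]] := in_ker_extremal ti.
have sfg := fmin _ hg g0; have [sg _] := hg.
have hX k : (size f + k <= size g)%N -> in_ker i ('X^k * f).
  elim: k => [|k IH] hk; first by rewrite mul1r.
  apply: (ker_descend hg g0 gmax te ti).
    by rewrite exprS -mulrA; apply: in_kerX; apply: IH; lia.
  by rewrite size_monicM ?monicXn // size_polyXn; lia.
pose n := (size g - size f).+1.
have fpos : (0 < size f)%N by rewrite lt0n size_poly_eq0.
have sfn : (size f + n <= i.+2)%N by rewrite /n; lia.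
have hXn k : (k < n)%N -> in_ker i ('X^k * f) by move=> kn; apply: hX; rewrite /n in kn; lia.
have arith (a b c : nat) : (a <= c -> b <= c -> 0 < b -> a - b.-1 <= (c - b).+1)%N by lia.
have div p : in_ker i p -> p = (p %/ f) * f.
  move=> hp; have hr : in_ker i (p %% f).
    have -> : p %% f = p - (p %/ f) * f by rewrite {2}(divp_eq p f) addrC addKr.
    apply: in_kerB => //; apply: (multiples_in_ker sfn hXn).
    rewrite size_divp // /n; exact: arith _ _ _ (gmax _ hp) sfg fpos.
  rewrite {1}(divp_eq p f); have [->|r0] := eqVneq (p %% f) 0; first by rewrite addr0.
  by have := fmin _ hr r0; rewrite leqNgt ltn_modp f0.
have le_n : (i.+1 - t i <= n)%N.
  rewrite -rank_ker; have sub : (kermx (phi i) <= multiples_mx i n f)%MS.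
    apply/rV_subP => v hv; have hp : in_ker i (rVpoly v).
      by split; [exact: size_poly|rewrite rVpolyK; apply/sub_kermxP].
    rewrite -[v]rVpolyK (div _ hp).
    have sq : (size (rVpoly v %/ f)%R <= n)%N by rewrite size_divp // /n; exact: arith _ _ _ (gmax _ hp) sfg fpos.
    by rewrite -(poly_rV_K sq) -mul_multiples_mx submxMl.
  by apply: leq_trans (mxrankS sub) (rank_leq_row _).
have ker := ker_multiples f0 sfn hXn le_n.
have n_le : (n <= i.+1 - t i)%N.
  rewrite -rank_ker -[X in (X <= _)%N](eqP (multiples_mx_free f0 sfn)); apply: mxrankS.
  by apply/row_subP => k; rewrite rowK; apply/sub_kermxP; exact: (hXn k (ltn_ord k)).2.
have nE : n = (i.+1 - t i)%N by apply/eqP; rewrite eqn_leq n_le.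
exists f; split=> //; last by rewrite -nE.
by move: sg sfg nE; rewrite /n; lia.
Qed.

(** If there is no drop just before [i], the common factor is inherited from degree [i - 1]; if the
    kernel is zero there, the kernel in degree [i] is a line and its generator is the factor. *)
Lemma ker_structure i : (t i <= i)%N -> t i.+1 = t i \/ (exists2 k, i = k.+1 & t k = t i) ->
  exists f, [/\ f != 0, (size f <= (t i).+1)%N &
    forall p, in_ker i p <-> exists2 h : {poly K}, (size h <= i.+1 - t i)%N & p = h * f].
Proof.
move=> ti [te|[k ik tk]]; first exact: ker_structure_right.
subst i; have [tkk|tkk] := leqP (t k) k.
  have [f [f0 sf hf]] := ker_structure_right (esym tk) tkk.
  rewrite tk in sf hf; exists f; split=> //; apply: ker_multiples => //; first by lia.
  move=> j jn; case: j jn => [|j] jn.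
    rewrite mul1r; apply: in_kerS; apply/hf; exists 1; rewrite ?mul1r // size_poly1; lia.
  rewrite exprS -mulrA; apply: in_kerX; apply/hf; exists 'X^j => //.
  by rewrite size_polyXn; lia.
have e : t k.+1 = k.+1 by have := leq_frame k; lia.
have [p [sp hp] p0] := in_ker_exists ti.
exists p; split=> //; first by rewrite e.
have -> : (k.+2 - t k.+1 = 1)%N by lia.
apply: ker_multiples => //; [lia| |lia].
by case=> // _; rewrite mul1r.
Qed.

End HomogeneousStructure.

(** * Explicit families of homogeneous ideals *)

Section RootsPolynomial.
Local Open Scope ring_scope.
Variable K : fieldType.

(** A single sequence of roots serves all degrees, so that the divisibility between the forms of an
    ideal holds by construction. *)
Definition roots_poly (u : nat -> K) n : {poly K} := \prod_(k < n) ('X - (u k)%:P).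

Lemma roots_polyS u n : roots_poly u n.+1 = roots_poly u n * ('X - (u n)%:P).
Proof. by rewrite /roots_poly big_ord_recr. Qed.

Lemma roots_poly_monic u n : roots_poly u n \is monic.
Proof. by apply: monic_prod => k _; apply: monicXsubC. Qed.

Lemma size_roots_poly u n : size (roots_poly u n) = n.+1.
Proof. by rewrite /roots_poly size_prod_XsubC /index_enum -enumT size_enum_ord. Qed.

Lemma roots_poly_neq0 u n : roots_poly u n != 0.
Proof. exact: monic_neq0 (roots_poly_monic u n). Qed.

Lemma dvdp_roots_poly u m n : (m <= n)%N -> roots_poly u m %| roots_poly u n.
Proof.
elim: n => [|n IH]; first by rewrite leqn0 => /eqP ->.
rewrite leq_eqVlt => /orP[/eqP -> //|]; rewrite ltnS => /IH h.
by rewrite roots_polyS dvdp_mulr.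
Qed.

Lemma roots_poly_eq u v n : (forall k, (k < n)%N -> u k = v k) -> roots_poly u n = roots_poly v n.
Proof. by move=> h; apply: eq_bigr => k _; rewrite h. Qed.

Lemma roots_poly0 u n : (forall k, (k < n)%N -> u k = 0) -> roots_poly u n = 'X^n.
Proof.
move=> h; rewrite (@roots_poly_eq u (fun=> 0)) // /roots_poly.
by under eq_bigr => k _ do rewrite subr0; rewrite prodr_const card_ord.
Qed.

End RootsPolynomial.

Section StandardFamily.
Local Open Scope ring_scope.
Variables (K : closedFieldType) (T : seq nat).
Local Notation t := (nth 0%N T).
Variables (j b c : nat) (u : nat -> K) (Z : nat -> nat -> K).
Local Notation f := (roots_poly u).
Implicit Types p q : {poly K}.

(* For i <> j the functionals cut out the multiples of f_(t_i).  In the exceptional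
   degree j they cut out the multiples f_b q of f_b such that q, reduced modulo
   f_c / f_b, is orthogonal to the columns of Z. *)
Definition functional i l p : K :=
  if i != j then (p %% f (t i))`_l
  else if (l < b)%N then (p %% f b)`_l
  else \sum_(m < c - b) ((p %% f c) %/ f b)`_m * Z m (l - b).

Lemma functional_is_linear i l : linear_for *%R (functional i l).
Proof.
move=> a p q; rewrite /functional; case: ifP => _.
  by rewrite modpD modpZl coefD coefZ.
case: ifP => _; first by rewrite modpD modpZl coefD coefZ.
rewrite mulr_sumr -big_split; apply: eq_bigr => m _ /=.
by rewrite modpD modpZl divpD divpZl coefD coefZ mulrDl mulrA.
Qed.
HB.instance Definition _ i l :=
  GRing.isLinear.Build K {poly K} K *%R (functional i l) (functional_is_linear i l).

Lemma functionalZ i l a p : functional i l (a *: p) = a * functional i l p.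
Proof. by have := functional_is_linear i l a p 0; rewrite raddf0 !addr0. Qed.

Definition std_frame i : 'M[K]_(i.+1, t i) := \matrix_(k, l) functional i l 'X^k.

Lemma std_frameE i p l : (size p <= i.+1)%N ->
  (poly_rV p *m std_frame i) 0 l = functional i l p.
Proof.
move=> sp; rewrite [in RHS](poly_sumXn sp) raddf_sum mxE; apply: eq_bigr => k _.
by rewrite !mxE /= functionalZ.
Qed.

Lemma std_frame_eq0 i p : (size p <= i.+1)%N ->
  poly_rV p *m std_frame i = 0 <-> forall l, (l < t i)%N -> functional i l p = 0.
Proof.
move=> sp; split=> [h l lt|h].
  by rewrite -(std_frameE (Ordinal lt) sp) h mxE.
by apply/rowP => l; rewrite std_frameE // h // mxE.
Qed.

Lemma modp_coef_eq0 n p : (forall l, (l < n)%N -> (p %% f n)`_l = 0) <-> f n %| p.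
Proof.
split=> [h|/eqP h l _]; last by rewrite h coef0.
apply/eqP/polyP => l; rewrite coef0; case: (ltnP l n) => ln; first exact: h.
rewrite nth_default // (leq_trans _ ln) // -ltnS -(size_roots_poly u n) ltn_modp.
exact: roots_poly_neq0.
Qed.

Lemma std_frame_ker i p : i != j -> (size p <= i.+1)%N ->
  poly_rV p *m std_frame i = 0 <-> f (t i) %| p.
Proof. by move=> ij sp; rewrite std_frame_eq0 // /functional ij; apply: modp_coef_eq0. Qed.

Lemma std_frame_ker_exceptional i p : i = j -> (b <= t j)%N -> (size p <= i.+1)%N ->
  poly_rV p *m std_frame i = 0 <-> f b %| p /\
    forall l, (l < t j - b)%N -> \sum_(m < c - b) ((p %% f c) %/ f b)`_m * Z m l = 0.
Proof.
move=> -> bt sp; rewrite std_frame_eq0 // /functional eqxx /= -modp_coef_eq0; split=> [h|[h1 h2] l lt].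
  split=> [l lb|l lt]; first by have := h l (leq_trans lb bt); rewrite lb.
  have := h (l + b)%N; rewrite (_ : (l + b < b)%N = false); last by lia.
  by rewrite addnK; apply; lia.
case: ltnP => lb; first exact: h1.
by apply: h2; lia.
Qed.

Hypothesis shape : forall i, (t i.+1 <= t i)%N \/ t i = i.+1.
Hypothesis tle : forall i, (t i <= i.+1)%N.
Hypotheses (tb : (b <= t j)%N) (tjS : (t j.+1 <= b)%N) (bc : (b <= c)%N).
Hypothesis tj : forall i, i.+1 = j -> (c <= t i)%N \/ t i = i.+1.

Lemma roots_poly_dvd_small n p : (size p <= n)%N -> f n %| p -> p = 0.
Proof.
move=> sp /dvdp_leq h; apply/eqP; apply: contraT => p0.
by have := h p0; rewrite size_roots_poly => h'; have := leq_trans h' sp; rewrite ltnn.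
Qed.

(** Away from degree [j] this is divisibility among the [f_n]. The part of degree [j] contains the
    multiples of [f_c], which include everything coming from degree [j - 1] by [tj], and consists of
    multiples of [f_b], all of which lie in the next degree since [t j.+1 <= b]. *)
Lemma std_frame_closed i p q : (size p <= i.+1)%N -> (size q <= i.+2)%N -> p %| q ->
  poly_rV p *m std_frame i = 0 -> poly_rV q *m std_frame i.+1 = 0.
Proof.
move=> sp sq pq.
have zero : (p = 0 -> poly_rV q *m std_frame i.+1 = 0).
  by move=> p0; move: pq; rewrite p0 dvd0p => /eqP ->; rewrite raddf0 mul0mx.
have [ij|ij] := eqVneq i j.
  subst i; rewrite std_frame_ker_exceptional // => -[h _].
  rewrite std_frame_ker ?gtn_eqF //; apply: dvdp_trans pq; apply: dvdp_trans h.
  exact: dvdp_roots_poly.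
rewrite std_frame_ker // => h.
have [iSj|iSj] := eqVneq i.+1 j; last first.
  rewrite std_frame_ker //; case: (shape i) => [le|e].
    by apply: dvdp_trans pq; apply: dvdp_trans h; apply: dvdp_roots_poly.
  by apply/std_frame_ker => //; move: h; rewrite e => /(roots_poly_dvd_small sp) /zero h;
     move: h; rewrite std_frame_ker.
case: (tj iSj) => [le|e]; last by apply: zero; move: h; rewrite e; exact: roots_poly_dvd_small.
have cq : f c %| q by apply: dvdp_trans pq; apply: dvdp_trans h; apply: dvdp_roots_poly.
apply/(std_frame_ker_exceptional iSj) => //; split.
  by apply: dvdp_trans cq; apply: dvdp_roots_poly.
by move=> l _; rewrite (eqP cq) div0p big1 // => m _; rewrite coef0 mul0r.
Qed.

Lemma std_frame_rank i : i != j -> \rank (std_frame i) = t i.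
Proof.
move=> ij; apply/eqP; rewrite -/(row_full _) -sub1mx; apply/row_subP => l.
have -> : row l 1%:M = poly_rV 'X^l *m std_frame i.
  apply/rowP => k; rewrite std_frameE; last by rewrite size_polyXn (leq_trans (ltn_ord l) (tle i)).
  rewrite /functional ij modp_small; last by rewrite size_polyXn size_roots_poly ltnS.
  by rewrite coefXn !mxE eq_sym.
exact: submxMl.
Qed.

Lemma std_frame_rank_exceptional : (c <= j.+1)%N -> (t j <= c)%N ->
  (forall m l, (m < t j - b)%N -> (l < t j - b)%N -> Z m l = (m == l)%:R) ->
  \rank (std_frame j) = t j.
Proof.
move=> cj tc hZ; apply/eqP; rewrite -/(row_full _) -sub1mx; apply/row_subP => l.
(* A dual basis of the functionals: [X^l] for the remainders modulo [f_b], and [f_b X^(l-b)] for the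
   identity block of [Z]. *)
pose p := if (l < b)%N then 'X^l else f b * 'X^(l - b) : {poly K}.
have lt := ltn_ord l.
have sp : (size p <= l.+1)%N.
  rewrite /p; case: ltnP => lb; first by rewrite size_polyXn.
  by rewrite size_Mmonic ?monicXn ?roots_poly_neq0 // size_roots_poly size_polyXn; lia.
have -> : row l 1%:M = poly_rV p *m std_frame j.
  apply/rowP => k; rewrite std_frameE; last by rewrite (leq_trans sp) //; lia.
  have pc : p %% f c = p by rewrite modp_small // size_roots_poly (leq_ltn_trans sp) // ltnS; lia.
  rewrite /functional eqxx /= !mxE pc; case: (ltnP k b) => kb; rewrite /p; case: (ltnP l b) => lb.
  - by rewrite modp_small ?coefXn 1?eq_sym // size_polyXn size_roots_poly; lia.
  - rewrite modp_mulr coef0 -val_eqE /=.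
    by rewrite (_ : (l == k :> nat) = false) //; apply/negbTE; lia.
  - rewrite divp_small; last by rewrite size_polyXn size_roots_poly; lia.
    rewrite big1 => [|m _]; last by rewrite coef0 mul0r.
    by rewrite -val_eqE /= (_ : (l == k :> nat) = false) //; apply/negbTE; lia.
  - rewrite mulKp ?roots_poly_neq0 //.
    have lbc : (l - b < c - b)%N by lia.
    rewrite (bigD1 (Ordinal lbc)) //= coefXn eqxx mul1r big1 ?addr0 => [|m]; last first.
      by rewrite -val_eqE /= coefXn => /negbTE ->; rewrite mul0r.
    rewrite hZ ?ltn_sub2r //; try lia.
    by rewrite -val_eqE /=; congr (_%:R); apply/eqP/eqP; lia.
exact: submxMl.
Qed.

Lemma std_frame_hframe : \rank (std_frame j) = t j -> hframe std_frame.
Proof.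
move=> rj; split=> [i|i p sp h].
  by have [->|ij] := eqVneq i j; [exact: rj|exact: std_frame_rank].
split; apply: (std_frame_closed sp _ _ h) => //; first exact: leqW.
  by rewrite (leq_trans (size_polyMleq _ _)) // size_polyX.
exact: dvdp_mull.
Qed.

End StandardFamily.

Section PolynomialCoefficients.
Local Open Scope ring_scope.
Variables (K : closedFieldType) (n : nat).
Implicit Types g h : ('I_n -> K) -> {poly K}.

Definition polycoef g := forall k, polyfun (fun v => (g v)`_k).

Lemma polycoef_cst (p : {poly K}) : polycoef (fun=> p).
Proof. by move=> k; apply: polyfun_cst. Qed.

Lemma polycoef_C (c : ('I_n -> K) -> K) : polyfun c -> polycoef (fun v => (c v)%:P).
Proof.
move=> hc [|k]; first by apply: polyfun_ext hc => v; rewrite coefC.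
by apply: (polyfun_ext _ (polyfun_cst _ 0)) => v; rewrite coefC.
Qed.

Lemma polycoef_add g h : polycoef g -> polycoef h -> polycoef (fun v => g v + h v).
Proof. by move=> hg hh k; apply: polyfun_ext (polyfun_add (hg k) (hh k)) => v; rewrite coefD. Qed.

Lemma polycoef_opp g : polycoef g -> polycoef (fun v => - g v).
Proof. by move=> hg k; apply: polyfun_ext (polyfun_opp (hg k)) => v; rewrite coefN. Qed.

Lemma polycoef_mul g h : polycoef g -> polycoef h -> polycoef (fun v => g v * h v).
Proof.
move=> hg hh k; apply: (polyfun_ext (fun v => esym (coefM _ _ _))).
by apply: polyfun_sum => i; apply: polyfun_mul.
Qed.

Lemma polycoef_scale c g : polyfun c -> polycoef g -> polycoef (fun v => c v *: g v).
Proof. by move=> hc hg k; apply: polyfun_ext (polyfun_mul hc (hg k)) => v; rewrite coefZ. Qed.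

Lemma polycoef_ext g h : g =1 h -> polycoef g -> polycoef h.
Proof. by move=> e hg k; apply: polyfun_ext (hg k) => v; rewrite e. Qed.

Lemma polycoef_sum (I : Type) (r : seq I) (F : I -> ('I_n -> K) -> {poly K}) :
  (forall i, polycoef (F i)) -> polycoef (fun v => \sum_(i <- r) F i v).
Proof.
move=> hF; elim: r => [|i r IH].
  by apply: (polycoef_ext _ (polycoef_cst 0)) => v; rewrite big_nil.
by apply: (polycoef_ext _ (polycoef_add (hF i) IH)) => v; rewrite big_cons.
Qed.

Lemma polycoef_exp g k : polycoef g -> polycoef (fun v => g v ^+ k).
Proof.
move=> hg; elim: k => [|k IH]; first exact: polycoef_cst.
by apply: (polycoef_ext _ (polycoef_mul hg IH)) => v; rewrite exprS.
Qed.

Lemma polycoef_roots (u : ('I_n -> K) -> nat -> K) k : (forall m, polyfun (fun v => u v m)) ->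
  polycoef (fun v => roots_poly (u v) k).
Proof.
move=> hu; elim: k => [|k IH].
  by apply: (polycoef_ext _ (polycoef_cst 1)) => v; rewrite /roots_poly big_ord0.
apply: (polycoef_ext (fun v => esym (roots_polyS _ _))); apply: polycoef_mul => //.
by apply: polycoef_add; [exact: polycoef_cst|apply: polycoef_opp; apply: polycoef_C].
Qed.

(** Long division by a monic polynomial, one power of [X] at a time: only the top coefficient of the
    remainder enters, so remainder and quotient depend polynomially on [f]. *)
Lemma divXn_step (f : {poly K}) s k : f \is monic -> size f = s.+1 ->
  'X^(k.+1) %% f = 'X * ('X^k %% f) - ('X^k %% f)`_s.-1 *: f /\
  'X^(k.+1) %/ f = 'X * ('X^k %/ f) + (('X^k %% f)`_s.-1)%:P.
Proof.
move=> mf sf; have f0 : f != 0 by rewrite monic_neq0.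
set r := 'X^k %% f; set Q := 'X^k %/ f.
have sr : (size r <= s)%N by rewrite -ltnS -sf ltn_modp.
have E : 'X^(k.+1) = ('X * Q + (r`_s.-1)%:P) * f + ('X * r - r`_s.-1 *: f).
  rewrite exprS {1}(divp_eq 'X^k f) -/r -/Q mulrDr mulrDl mulrA -addrA; congr (_ + _).
  by rewrite mul_polyC addrC subrK.
have small : (size ('X * r - r`_s.-1 *: f)%R < size f)%N.
  rewrite sf ltnS; apply/leq_sizeP => m hm; rewrite coefB coefZ coefXM.
  case: m hm => [|m] hm.
    have s0 : s = 0%N by apply/eqP; rewrite -leqn0.
    have r0 : r = 0 by apply/eqP; rewrite -size_poly_leq0 -s0.
    by rewrite /= s0 r0 coef0 mul0r subrr.
  rewrite /= leq_eqVlt in hm; case/orP: hm => [/eqP e|lt].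
    have -> : f`_m.+1 = 1 by rewrite -e; move: mf; rewrite monicE lead_coefE sf => /eqP.
    by rewrite e /= mulr1 subrr.
  rewrite (nth_default 0 (s := f)) ?sf // mulr0 subr0 nth_default //.
  by rewrite (leq_trans sr) // -ltnS.
by split; rewrite {1}E ?modp_addl_mul_small ?divp_addl_mul_small.
Qed.

Lemma polycoef_divXn f s k : (forall v, f v \is monic) -> (forall v, size (f v) = s.+1) ->
  polycoef f -> polycoef (fun v => 'X^k %% f v) /\ polycoef (fun v => 'X^k %/ f v).
Proof.
move=> mf sf pf; elim: k => [|k [IH1 IH2]].
  case: s sf => [|s] sf.
    have f1 v : f v = 1.
      by have := mf v; rewrite monicE; have /eqP/size_poly1P [c c0 ->] := sf v; rewrite lead_coefC => /eqP ->.
    split; [apply: (polycoef_ext _ (polycoef_cst 0))|apply: (polycoef_ext _ (polycoef_cst 1))] => v;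
      by rewrite f1 ?modp1 ?divp1.
  split; [apply: (polycoef_ext _ (polycoef_cst 1))|apply: (polycoef_ext _ (polycoef_cst 0))] => v;
    by rewrite expr0 ?modp_small ?divp_small // sf size_poly1.
split.
  apply: (polycoef_ext (fun v => esym (divXn_step k (mf v) (sf v)).1)).
  apply: polycoef_add; first by apply: polycoef_mul => //; apply: polycoef_cst.
  by apply: polycoef_opp; apply: polycoef_scale.
apply: (polycoef_ext (fun v => esym (divXn_step k (mf v) (sf v)).2)).
apply: polycoef_add; first by apply: polycoef_mul => //; apply: polycoef_cst.
exact: polycoef_C.
Qed.

Lemma polyfun_std_frame (T : seq nat) j b c (u : ('I_n -> K) -> nat -> K)
    (Z : ('I_n -> K) -> nat -> nat -> K) :
  (forall m, polyfun (fun v => u v m)) -> (forall m l, polyfun (fun v => Z v m l)) ->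
  forall i k l, polyfun (fun v => std_frame T j b c (u v) (Z v) i k l).
Proof.
move=> hu hZ i k l.
have hmod s k' := (polycoef_divXn k' (fun v => roots_poly_monic (u v) s)
   (fun v => size_roots_poly (u v) s) (polycoef_roots s hu)).1.
have hdiv s k' := (polycoef_divXn k' (fun v => roots_poly_monic (u v) s)
   (fun v => size_roots_poly (u v) s) (polycoef_roots s hu)).2.
have [ij|ij] := boolP (i != j).
  by apply: polyfun_ext (hmod (nth 0%N T i) k l) => v; rewrite mxE /functional ij.
have [lb|lb] := boolP (l < b)%N.
  by apply: polyfun_ext (hmod b k l) => v; rewrite mxE /functional (negbTE ij) lb.
apply: (polyfun_ext (f := fun v => \sum_(m < c - b)
    (('X^k %% roots_poly (u v) c) %/ roots_poly (u v) b)`_m * Z v m (l - b)%N)) => [v|].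
  by rewrite mxE /functional (negbTE ij) (negbTE lb).
apply: polyfun_sum => m; apply: polyfun_mul => //.
have E v : ('X^k %% roots_poly (u v) c) %/ roots_poly (u v) b =
    \sum_(k' < c) ('X^k %% roots_poly (u v) c)`_k' *: ('X^k' %/ roots_poly (u v) b).
  rewrite {1}(@poly_sumXn K c ('X^k %% roots_poly (u v) c)); last first.
    by rewrite -ltnS -(size_roots_poly (u v) c) ltn_modp roots_poly_neq0.
  by rewrite (big_morph (fun p => p %/ _) (fun p q => divpD _ p q) (div0p _)); apply: eq_bigr => k' _; rewrite divpZl.
apply: (polycoef_ext (fun v => esym (E v))).
apply: polycoef_sum => k'; apply: polycoef_scale; last exact: hdiv.
exact: hmod.
Qed.

End PolynomialCoefficients.

Section HomogeneousIdealsDimension.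
Local Open Scope ring_scope.
Variables (K : closedFieldType) (charK0 : [pchar K]%R =i pred0) (T : seq nat).
Local Notation t := (nth 0%N T).
Local Notation family := (forall i, 'M[K]_(i.+1, t i)).
Hypothesis T0 : 0%N \notin T.

Lemma same_ker_hframe (phi psi : family) : hframe phi ->
  (forall i (p : {poly K}), (size p <= i.+1)%N -> poly_rV p *m phi i = 0 <-> poly_rV p *m psi i = 0) ->
  hframe psi /\ frame_ideal phi = frame_ideal psi.
Proof.
move=> h e; split; last first.
  by apply/funext => f; apply/propext; split=> H i; apply/(e i _ (size_slice i f)).
split=> [i|i p sp /e - /(_ sp) /(h.2 i p sp) [h1 h2]]; last first.
  have sX : (size ('X * p)%R <= i.+2)%N by rewrite (leq_trans (size_polyMleq _ _)) // size_polyX.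
  by split; apply/e => //; apply: leqW.
have kE : (kermx (phi i) :=: kermx (psi i))%MS.
  apply/eqmxP; apply/andP; split; apply/rV_subP => v /sub_kermxP hv; apply/sub_kermxP;
    by rewrite -[v]rVpolyK; apply/(e i _ (size_poly _ _)); rewrite rVpolyK.
have := mxrank_ker (phi i); rewrite kE mxrank_ker h.1.
have arith (a b n : nat) : (a <= n -> b <= n -> n - b = n - a -> b = a)%N by lia.
by have r1 := rank_leq_row (phi i); rewrite h.1 in r1 => e'; apply: arith r1 (rank_leq_row _) e'.
Qed.

Lemma G_krull_le d r (phi : 'I_r -> ('I_d -> K) -> family) :
  (forall a i k l, polyfun (fun u => phi a u i k l)) ->
  (forall psi : family, hframe psi -> exists a u, forall i (p : {poly K}), (size p <= i.+1)%N ->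
     poly_rV p *m psi i = 0 <-> poly_rV p *m phi a u i = 0) ->
  forall e Z, irreducible_chain (@Hilb_closed K (sumn T)) (@G_ K T) e Z -> (e <= d)%N.
Proof.
move=> pphi cover; apply: (irreducible_chain_le charK0 (A := fun a u => frame_mx (frame_of (phi a u)))).
- by move=> a i k; apply: polyfun_frame_mx.
- exact: G_Hilb.
move=> I /G_inv [psi hpsi ->]; have [a [u e]] := cover psi hpsi.
have [h ->] := same_ker_hframe hpsi e.
exists (frame_of (phi a u)), a, u; split=> //; first exact: frame_ofP.
exact: frame_mx_full h.1 T0.
Qed.

(** The determinant of such a matrix is the diagonal entry of the replaced row. All rank conditions
    separating the members of chains are brought to this shape, so that each becomes a single
    equation. *)
Lemma replaced_row_free n (D : 'M[K]_n) l0 : (forall l, l != l0 -> row l D = delta_mx 0 l) ->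
  row_free D = (D l0 l0 != 0).
Proof.
move=> h; apply/idP/idP => [rf|nz].
  apply/eqP => z.
  have E : row l0 D *m D = row l0 D.
    rewrite mulmx_sum_row [RHS]row_sum_delta; apply: eq_bigr => l _.
    have [->|nl] := eqVneq l l0; last by rewrite (h l nl).
    by rewrite [row l0 D 0 l0]mxE z !scale0r.
  have : delta_mx 0 l0 - row l0 D = 0 :> 'rV[K]_n.
    by apply: (row_free_inj rf); rewrite /= mulmxBl E -rowE subrr mul0mx.
  move/(congr1 (fun v : 'rV[K]_n => v 0 l0)); rewrite !mxE !eqxx z subr0 => /eqP.
  by rewrite oner_eq0.
rewrite -kermx_eq0; apply/rowV0P => v /sub_kermxP hv.
have vE l : l != l0 -> (v *m D) 0 l = v 0 l + v 0 l0 * D l0 l.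
  move=> nl; rewrite mxE (bigD1 l0) //= (bigD1 l) //= big1 ?addr0 => [|k /andP[k0 kl]].
    have -> : D l l = 1 by have := congr1 (fun w : 'rV_n => w 0 l) (h l nl); rewrite !mxE !eqxx.
    by rewrite mulr1 addrC.
  have -> : D k l = 0 by have := congr1 (fun w : 'rV_n => w 0 l) (h k k0); rewrite !mxE eqxx eq_sym (negbTE kl).
  by rewrite mulr0.
have v0 : v 0 l0 = 0.
  have := congr1 (fun w : 'rV[K]_n => w 0 l0) hv; rewrite !mxE (bigD1 l0) //= big1 ?addr0.
    by move=> /eqP; rewrite mulf_eq0 (negbTE nz) orbF => /eqP.
  move=> k k0; have := congr1 (fun w : 'rV_n => w 0 l0) (h k k0).
  by rewrite !mxE eqxx eq_sym (negbTE k0) => ->; rewrite mulr0.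
apply/rowP => l; rewrite mxE; have [->//|nl] := eqVneq l l0.
by have := congr1 (fun w : 'rV[K]_n => w 0 l) hv; rewrite vE // v0 mul0r addr0 !mxE.
Qed.

(** The separating closed sets are loci where [t (deg k)] chosen monomials of degree [deg k] become
    dependent in the quotient; [sel k l] is the exponent of [x] in the [l]-th of them. *)
Lemma G_krull_chain d (phi : ('I_d -> K) -> family) (deg : nat -> nat) (sel : nat -> nat -> nat) :
  t 0 != 0%N ->
  (forall i k l, polyfun (fun u => phi u i k l)) -> (forall u, hframe (phi u)) ->
  (forall k l, (k < d)%N -> (l < t (deg k))%N -> (sel k l <= deg k)%N) ->
  (forall k (u : 'I_d -> K), (k < d)%N -> (forall i : 'I_d, (k <= i)%N -> u i = 0) ->
     ~~ row_free (\matrix_(l < t (deg k)) (poly_rV 'X^(sel k l) *m phi u (deg k)))) ->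
  (forall k, (k < d)%N -> exists2 u : 'I_d -> K, (forall i : 'I_d, (k < i)%N -> u i = 0) &
     row_free (\matrix_(l < t (deg k)) (poly_rV 'X^(sel k l) *m phi u (deg k)))) ->
  exists Z, irreducible_chain (@Hilb_closed K (sumn T)) (@G_ K T) d Z.
Proof.
move=> t0 pphi hphi hsel dep indep.
pose g k (l : 'I_(t (deg k))) := (sel k l, deg k - sel k l)%N.
(* If [t (deg k)] were 0, the empty family of monomials would be independent, against [dep]. This
   keeps the exponents below [sumn T]. *)
have degT k : (k < d)%N -> (deg k < size T)%N.
  move=> kd; rewrite ltnNge; apply/negP => h.
  have := dep k (fun=> 0) kd (fun _ _ => erefl); case/negP.
  rewrite /row_free eqn_leq rank_leq_row /=.
  by rewrite -[X in (X <= _)%N]/(t (deg k)) [X in (X <= _)%N](nth_default 0%N h).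
have key k (u : 'I_d -> K) : (k < d)%N ->
    dependent_locus (sumn T) (g k) (frame_ideal (phi u)) <->
    ~~ row_free (\matrix_(l < t (deg k)) (poly_rV 'X^(sel k l) *m phi u (deg k))).
  move=> kd; set M := \matrix_(l < _) _.
  have E (v : 'rV[K]_(t (deg k))) :
      frame_ideal (phi u) (\sum_l v 0 l *: fps2_monomial K (g k l).1 (g k l).2) <-> v *m M = 0.
    have hs i : slice i (\sum_l v 0 l *: fps2_monomial K (g k l).1 (g k l).2) =
        if i == deg k then \sum_l v 0 l *: 'X^(sel k l) else 0.
      rewrite raddf_sum /=; have h l : slice i (v 0 l *: fps2_monomial K (g k l).1 (g k l).2) =
         if i == deg k then v 0 l *: 'X^(sel k l) else 0.
        have sl := hsel k l kd (ltn_ord l).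
        rewrite linearZ /= fps2_monomialE -hformXn // slice_hform ?size_polyXn //.
        by case: eqP; rewrite ?scaler0.
      have [e|ne] := eqVneq i (deg k); last by apply: big1 => l _; rewrite h (negbTE ne).
      by apply: eq_bigr => l _; rewrite h; case: eqP.
    have vM : v *m M = poly_rV (\sum_l v 0 l *: 'X^(sel k l)) *m phi u (deg k).
      rewrite mulmx_sum_row raddf_sum mulmx_suml; apply: eq_bigr => l _.
      by rewrite rowK /= linearZ -scalemxAl.
    rewrite vM; split=> [/(_ (deg k))|h i]; rewrite hs ?eqxx //.
    by case: eqP => [->//|_]; rewrite raddf0 mul0mx.
  split=> [[_ [v v0 /E hv]]|nf].
    rewrite -kermx_eq0; apply: contra v0 => /eqP k0.
    by have : (v <= kermx M)%MS; [apply/sub_kermxP|rewrite k0 submx0].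
  split; first by split; [exact: frame_ideal_ideal|exists (frame_of (phi u)); apply: frame_ofP].
  have : kermx M != 0 by rewrite kermx_eq0.
  by case/rowV0Pn => v /sub_kermxP hv v0; exists v => //; apply/E.
apply: (family_chain charK0 (I := fun u => frame_ideal (phi u))
  (phi := fun u => frame_of (phi u)) _ _ _ _ (C := fun k => dependent_locus (sumn T) (g k))).
- exact: G_Hilb.
- by move=> u; apply: G_frame_ideal.
- by move=> u; apply: frame_ofP.
- move=> q; apply: polyfun_mxcoords => a l; exact: polyfun_frame_mx.
- move=> k kd; apply: dependent_locus_closed => l /=.
  have := degT k kd; have := leq_size_sumn T0; have := hsel k l kd (ltn_ord l); lia.
- by move=> k u kd hu; apply/key => //; apply: dep.
by move=> k kd; have [u hu rf] := indep k kd; exists u => //; move/(key k u kd); rewrite rf.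
Qed.

End HomogeneousIdealsDimension.

(** * Sequences of infinite type *)

Section StandardChain.
Local Open Scope ring_scope.
Variables (K : closedFieldType) (charK0 : [pchar K]%R =i pred0) (T : seq nat).
Local Notation t := (nth 0%N T).
Hypotheses (T0 : 0%N \notin T) (t0 : t 0 != 0%N).
Hypothesis shape : forall i, (t i.+1 <= t i)%N \/ t i = i.+1.
Hypothesis tle : forall i, (t i <= i.+1)%N.
Variables (j b c q r i0 : nat).
Hypotheses (tb : (b <= t j)%N) (tc : (t j <= c)%N) (cj : (c <= j.+1)%N) (tjS : (t j.+1 <= b)%N).
Hypothesis tj : forall i, i.+1 = j -> (c <= t i)%N \/ t i = i.+1.
Hypothesis ri0 : (0 < r)%N -> [/\ i0 != j, t i0 = r & (r <= i0)%N].
Local Notation a := (t j - b)%N.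
Hypothesis qle : (q <= a * (c - t j))%N.

(* The first q parameters are the free entries of the matrix Z, whose top block is the
   identity; the last r ones are the roots, which are visible in degree i0. *)
Let vget (v : 'I_(q + r) -> K) n : K := oapp v 0 (insub n).
Let Zf v m l : K :=
  if (m < a)%N then (m == l)%:R
  else if (l < a)%N && ((m - a) * a + l < q)%N then vget v ((m - a) * a + l)%N else 0.
Let uf v k : K := if (k < r)%N then vget v (q + k)%N else 0.
Let phi v := std_frame T j b c (uf v) (Zf v).

Let vget_poly n : polyfun (fun v => vget v n).
Proof. by rewrite /vget; case: insub => [i|]; [exact: polyfun_var|exact: polyfun_cst]. Qed.

Let phi_poly i k l : polyfun (fun v => phi v i k l).
Proof.
apply: polyfun_std_frame => [m|m l'].
  have [mr|mr] := boolP (m < r)%N.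
    by apply: polyfun_ext (vget_poly (q + m)%N) => v; rewrite /uf mr.
  by apply: polyfun_ext (polyfun_cst _ 0) => v; rewrite /uf (negbTE mr).
have [ma|ma] := boolP (m < a)%N.
  by apply: polyfun_ext (polyfun_cst _ (m == l')%:R) => v; rewrite /Zf ma.
have [h|h] := boolP ((l' < a)%N && ((m - a) * a + l' < q)%N).
  by apply: polyfun_ext (vget_poly ((m - a) * a + l')%N) => v; rewrite /Zf (negbTE ma) h.
by apply: polyfun_ext (polyfun_cst _ 0) => v; rewrite /Zf (negbTE ma) (negbTE h).
Qed.

Let phi_hframe v : hframe (phi v).
Proof.
have bc : (b <= c)%N by exact: leq_trans tc.
apply: std_frame_hframe => //.
apply: std_frame_rank_exceptional => // m l ma la.
by rewrite /Zf ma.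
Qed.

Let functional_small v i s l : i != j -> (s < t i)%N -> functional T j b c (uf v) (Zf v) i l 'X^s = (s == l)%:R.
Proof.
move=> ij si; rewrite /functional ij modp_small; first by rewrite coefXn eq_sym.
by rewrite size_polyXn size_roots_poly ltnS.
Qed.

Let functional_j v s l : (forall k, uf v k = 0) -> (s < c)%N ->
  functional T j b c (uf v) (Zf v) j l 'X^s =
  if (s < b)%N then (s == l)%:R else if (l < b)%N then 0 else Zf v (s - b)%N (l - b)%N.
Proof.
move=> u0 sc; rewrite /functional eqxx /= !roots_poly0 //.
rewrite [('X^s %% 'X^c)]modp_small ?size_polyXn //.
case: (ltnP s b) => sb; case: (ltnP l b) => lb.
- by rewrite modp_small ?size_polyXn // coefXn eq_sym.
- rewrite divp_small ?size_polyXn // big1 => [|m _]; last by rewrite coef0 mul0r.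
  by rewrite (_ : (s == l) = false) //; apply/negbTE; lia.
- by rewrite -(subnK sb) exprD modp_mull coef0.
rewrite -{1}(subnK sb) exprD mulpK ?expf_neq0 ?polyX_eq0 //.
have h : (s - b < c - b)%N by lia.
rewrite (bigD1 (Ordinal h)) //= coefXn eqxx mul1r big1 ?addr0 // => m.
by rewrite -val_eqE /= coefXn => /negbTE ->; rewrite mul0r.
Qed.

Let roots_poly_split (u : nat -> K) k n : (k <= n)%N -> (forall m, (k <= m < n)%N -> u m = 0) ->
  roots_poly u n = roots_poly u k * 'X^(n - k).
Proof.
elim: n => [|n IH] kn h.
  by move: kn; rewrite leqn0 => /eqP ->; rewrite mulr1.
move: kn; rewrite leq_eqVlt => /orP[/eqP ->|kn]; first by rewrite subnn mulr1.
rewrite roots_polyS IH => [|//|m /andP[km mn]]; last by apply: h; rewrite km ltnW.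
by rewrite h ?ltnSn ?andbT // polyC0 subr0 -mulrA -exprSr subSn.
Qed.

Let mod_top (u : nat -> K) n : (0 < n)%N -> 'X^n %% roots_poly u n = 'X^n - roots_poly u n.
Proof.
case: n => // n _; have [-> _] := divXn_step n (roots_poly_monic u n.+1) (size_roots_poly u n.+1).
by rewrite modp_small ?size_polyXn ?size_roots_poly // coefXn eqxx scale1r exprS.
Qed.

(** Each parameter is detected by altering the monomials [X^0, ..., X^(t-1)] in one place. For an
    entry of [Z], [X^(b + k %% a)] is replaced by [X^(t j + k %/ a)], whose functional is that
    entry; for a root, [X^(r - (k-q) - 1)] is replaced by [X^r], which reads off a coefficient of
    the polynomial of the roots. *)
Let deg k := if (k < q)%N then j else i0.
Let sel k l := if (k < q)%N then (if l == b + k %% a then t j + k %/ a else l)%N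
  else (if l == r - (k - q) - 1 then r else l)%N.
Let D k v : 'M[K]_(t (deg k)) := \matrix_(l < t (deg k)) (poly_rV 'X^(sel k l) *m phi v (deg k)).

Let q_pos k : (k < q)%N -> [/\ 0 < a, k %% a < a, k %/ a < c - t j & b + a = t j]%N.
Proof.
move=> kq; have a0 : (0 < a)%N by case: (posnP a) qle => // ->; lia.
split=> //; [by rewrite ltn_mod|rewrite ltn_divLR // mulnC; lia|by rewrite subnKC].
Qed.

Let selP k l : (k < q + r)%N -> (l < t (deg k))%N -> (sel k l <= deg k)%N.
Proof.
rewrite /sel /deg; case: (ltnP k q) => kq kr lt.
  have [a0 h1 h2 h3] := q_pos kq.
  by case: eqP => _; lia.
have [ij ti ri] : [/\ i0 != j, t i0 = r & (r <= i0)%N] by apply: ri0; lia.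
by case: eqP => _ //; rewrite ti in lt; lia.
Qed.

Let D_entry k v l l' : (k < q + r)%N ->
  D k v l l' = functional T j b c (uf v) (Zf v) (deg k) l' 'X^(sel k l).
Proof. by move=> kr; rewrite mxE std_frameE // size_polyXn ltnS selP. Qed.

Let D_free_z k v : (k < q)%N -> (forall m, uf v m = 0) -> row_free (D k v) = (vget v k != 0).
Proof.
move=> kq u0; have kr : (k < q + r)%N by lia.
have [a0 h1 h2 h3] := q_pos kq.
have dE : deg k = j by rewrite /deg kq.
have fE n p : functional T j b c (uf v) (Zf v) (deg k) n p = functional T j b c (uf v) (Zf v) j n p.
  by rewrite dE.
have lj (l : 'I_(t (deg k))) : (l < t j)%N by apply: leq_trans (ltn_ord l) _; rewrite dE.
have lt0 : (b + k %% a < t (deg k))%N by rewrite dE; lia.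
rewrite (@replaced_row_free _ _ _ (Ordinal lt0)).
  rewrite D_entry // fE /sel kq eqxx functional_j //=; last by lia.
  have A1 : (t j + k %/ a < b)%N = false by move: (k %/ a)%N => x; lia.
  have A2 : (b + k %% a < b)%N = false by move: (k %% a)%N => x; lia.
  have A3 : (t j + k %/ a - b < a)%N = false by move: (k %/ a)%N => x; lia.
  rewrite A1 A2 /Zf A3.
  have -> : (t j + k %/ a - b - a = k %/ a)%N by move: (k %/ a)%N => x; lia.
  have -> : (b + k %% a - b = k %% a)%N by move: (k %% a)%N => x; lia.
  by rewrite -divn_eq h1 kq.
move=> l; rewrite -val_eqE /= => nl; apply/rowP => l'.
have la : (l < b + a)%N by have := lj l; lia.
rewrite mxE D_entry // fE /sel kq (negbTE nl) functional_j //; last by lia.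
transitivity ((l == l' :> nat)%:R : K); last by rewrite !mxE eqxx /= -val_eqE /= eq_sym.
case: ltnP => lb //; case: ltnP => l'b.
  by have -> : (l == l' :> nat) = false; [apply/eqP => e; move: lb l'b; rewrite e; lia|].
have A1 : (l - b < a)%N by lia.
rewrite /Zf A1 -(eqn_add2r b) !subnK //.
Qed.

(** Up to sign this coefficient is the elementary symmetric function of degree [k - q + 1] of the
    roots, so it vanishes when at most [k - q] of them are nonzero. *)
Let D_free_u k v : (q <= k < q + r)%N ->
  row_free (D k v) = ((roots_poly (uf v) r)`_(r - (k - q) - 1) != 0).
Proof.
move=> /andP[qk kr]; have r0 : (0 < r)%N by lia.
have [ij ti ri] := ri0 r0.
have dE : deg k = i0 by rewrite /deg ltnNge qk.
have fE n p : functional T j b c (uf v) (Zf v) (deg k) n p = functional T j b c (uf v) (Zf v) i0 n p.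
  by rewrite dE.
have lj (l : 'I_(t (deg k))) : (l < t i0)%N by apply: leq_trans (ltn_ord l) _; rewrite dE.
have lt0 : (r - (k - q) - 1 < t (deg k))%N by rewrite dE ti; lia.
rewrite (@replaced_row_free _ _ _ (Ordinal lt0)).
  rewrite D_entry // fE /sel ltnNge qk /= eqxx /functional ij ti mod_top // coefB coefXn.
  rewrite (_ : (_ == r) = false) ?sub0r ?oppr_eq0 //; apply/negbTE; lia.
move=> l; rewrite -val_eqE /= => nl; apply/rowP => l'.
rewrite mxE D_entry // fE /sel ltnNge qk /= (negbTE nl) functional_small //.
by rewrite !mxE eqxx /= -val_eqE /= eq_sym.
Qed.

Let vgetE v n (h : (n < q + r)%N) : vget v n = v (Ordinal h).
Proof. by rewrite /vget insubT. Qed.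

Lemma std_chain : exists Z, irreducible_chain (@Hilb_closed K (sumn T)) (@G_ K T) (q + r) Z.
Proof.
apply: (G_krull_chain charK0 T0 (phi := phi) (deg := deg) (sel := sel)) => //.
  move=> k v kr hv; rewrite -/(D k v); case: (ltnP k q) => kq.
    rewrite D_free_z // ?vgetE ?hv ?eqxx // => m; rewrite /uf; case: ltnP => // mr.
    have h : (q + m < q + r)%N by lia.
    by rewrite vgetE hv //=; lia.
  rewrite D_free_u ?kq // (@roots_poly_split _ (k - q)); try lia.
    by rewrite coefMXn ifT ?eqxx //; lia.
  move=> m /andP[km mr]; rewrite /uf mr; have h : (q + m < q + r)%N by lia.
  by rewrite vgetE hv //=; lia.
move=> k kr; case: (ltnP k q) => kq.
  exists (fun i => (i == k :> nat)%:R) => [i ki|]; first by rewrite gtn_eqF.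
  rewrite -/(D k _) D_free_z // ?vgetE /= ?eqxx ?oner_eq0 // => m; rewrite /uf; case: ltnP => // mr.
  have h : (q + m < q + r)%N by lia.
  by rewrite vgetE /= (_ : (_ == k) = false) //; apply/negbTE; lia.
(* The roots with index at most [k - q] are 1 and the others 0, which makes the symmetric function
   of degree [k - q + 1] nonzero. *)
pose v (i : 'I_(q + r)) : K := (q <= i <= k)%N%:R.
exists v => [i ki|]; first by rewrite /v [(i <= k)%N]leqNgt ki andbF.
rewrite -/(D k v) D_free_u ?kq // (@roots_poly_split _ (k - q).+1); try lia.
  rewrite coefMXn.
  have -> : (r - (k - q) - 1 < r - (k - q).+1)%N = false by lia.
  have -> : (r - (k - q) - 1 - (r - (k - q).+1) = 0)%N by lia.
  rewrite -horner_coef0 /roots_poly horner_prod; apply/prodf_neq0 => m _.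
  rewrite !hornerE oppr_eq0 /uf ifT; last by have := ltn_ord m; lia.
  have h : (q + m < q + r)%N by have := ltn_ord m; lia.
  rewrite vgetE /v /= leq_addr (_ : (q + m <= k)%N) ?oner_eq0 //.
  by have := ltn_ord m; lia.
move=> m /andP[km mr]; rewrite /uf mr; have h : (q + m < q + r)%N by lia.
by rewrite vgetE /v /= (_ : (q + m <= k)%N = false) ?andbF //; apply/negbTE; lia.
Qed.

End StandardChain.

(** * Combinatorics of the admissible sequences *)

Section Sequences.
Implicit Types (T s : seq nat).

Lemma sorted_small_seq s : sorted geq s -> all (fun x => 0 < x <= 3) s ->
  exists a b c, s = nseq a 3 ++ nseq b 2 ++ nseq c 1.
Proof.
elim: s => [|x s IH]; first by exists 0, 0, 0.
move=> /= xs /andP[hx hs]; have [a [b [c e]]] := IH (path_sorted xs) hs.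
have hall y : y \in s -> y <= x.
  have tr : transitive geq by move=> u v w /= h1 h2; exact: leq_trans h2 h1.
  by move: xs; rewrite path_sortedE // => /andP[/allP h _] /h.
have x3 : [|| x == 3, x == 2 | x == 1] by lia.
case/or3P: x3 => /eqP ex; subst x.
- by exists a.+1, b, c; rewrite e.
- case: a e => [|a] e; last by have := hall 3; rewrite e mem_head => /(_ isT).
  by exists 0, b.+1, c; rewrite e.
case: a e => [|a] e; last by have := hall 3; rewrite e mem_head => /(_ isT).
case: b e => [|b] e; last by have := hall 2; rewrite e mem_head => /(_ isT).
by exists 0, 0, c.+1; rewrite e.
Qed.

(** [d] is the initial degree of the ideal, the first one where [t] falls short of [i + 1]; from
    there on [t] can no longer rise. *)
Lemma shape_cat T : 0 \notin T -> nth 0 T 1 = 2 ->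
  (forall i, nth 0 T i.+1 <= nth 0 T i \/ nth 0 T i = i.+1) -> (forall i, nth 0 T i <= i.+1) ->
  exists d s, [/\ T = iota 1 d ++ s, 2 <= d, sorted geq s, nth 0 s 0 <= d & 0 \notin s].
Proof.
move=> T0 t1 shape tle; set t := nth 0 T in t1 shape tle *.
have ex : exists i, t i != i.+1 by exists (size T); rewrite /t nth_default.
case: (ex_minnP ex) => d td dmin; have low i : i < d -> t i = i.+1.
  by move=> id; apply/eqP; apply: contraTT id => /dmin; rewrite -leqNgt.
have d2 : 1 < d.
  rewrite ltnNge; apply/negP => d1.
  have t0 : t 0 = 1.
    have := shape 0; rewrite t1 => -[|//] h; have := tle 0; lia.
  by case: d d1 td {dmin low} => [|[|d]] // _; rewrite ?t0 ?t1.
have dT : d <= size T.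
  have := low d.-1; rewrite /t; case: (ltnP d.-1 (size T)) => h; first by lia.
  by rewrite nth_default // => /(_ _); lia.
have high i : t (d + i).+1 <= t (d + i).
  have [//|e] := shape (d + i).
  have : t (d + i) <= d; last by lia.
  elim: i {e} => [|i IH]; first by rewrite addn0; have := tle d; move/eqP: td; lia.
  by rewrite addnS; have := shape (d + i); lia.
have nd i : nth 0 (drop d T) i = t (d + i) by rewrite nth_drop.
exists d, (drop d T); split=> //.
- have <- : take d T = iota 1 d; last by rewrite cat_take_drop.
  apply: (@eq_from_nth _ 0) => [|i]; rewrite size_takel // ?size_iota // => id.
  by rewrite nth_take // nth_iota // -/(t i) low.
- by apply/(sortedP 0) => i _; rewrite /= !nd addnS.
- by rewrite nd addn0; have := tle d; move/eqP: td; lia.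
by apply: contra T0 => /mem_drop.
Qed.

(** After the rise to [d] only the values 3, 2, 1 remain to be studied, since a larger value there
    leaves at least four roots free. *)
Definition profile d a b c : seq nat := iota 1 d ++ nseq a 3 ++ nseq b 2 ++ nseq c 1.

Lemma nth_profile d a b c i : nth 0 (profile d a b c) i =
  if i < d then i.+1 else if i < d + a then 3 else if i < d + a + b then 2
  else if i < d + a + b + c then 1 else 0.
Proof.
rewrite !nth_cat !nth_nseq size_iota !size_nseq.
case: (ltnP i d) => h1; first by rewrite nth_iota.
case: (ltnP i (d + a)) => h2; first by have -> : i - d < a by lia.
rewrite (_ : i - d < a = false); last by lia.
case: (ltnP i (d + a + b)) => h3; first by have -> : i - d - a < b by lia.
rewrite (_ : i - d - a < b = false); last by lia.
by have -> : (i - d - a - b < c) = (i < d + a + b + c) by lia.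
Qed.

(* The numerical conditions for a chain of length at least 4 in the family with an
   exceptional degree j, q parameters in that degree and r visible roots. *)
Definition wild (t : nat -> nat) : Prop := exists j b c q r i0,
  [/\ [/\ b <= t j, t j <= c, c <= j.+1 & t j.+1 <= b],
      forall i, i.+1 = j -> c <= t i \/ t i = i.+1,
      0 < r -> [/\ i0 != j, t i0 = r & r <= i0],
      q <= (t j - b) * (c - t j)
    & 4 <= q + r].

Ltac wild_with j b c q r i0 :=
  apply: Or32; let t := fresh "t" in let E := fresh "E" in
  match goal with |- wild (nth 0 (profile ?d ?a ?b ?c)) =>
    have E := nth_profile d a b c; set t := nth 0 (profile d a b c) in E *; clearbody t end;
  exists j, b, c, q, r, i0; split;
  [split; rewrite ?E; repeat (case: ifP => ?); lia
  | intros ? ?; rewrite ?E; repeat (case: ifP => ?); lia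
  | intros ?; split; rewrite ?E; repeat (case: ifP => ?); lia
  | rewrite !E; repeat (case: ifP => ?); lia | lia].

(** Each witness singles out a degree [j] with a drop on both sides. Right after the rise such a
    degree carries a Grassmannian of functionals of large dimension; further on, it adds one
    parameter to three roots visible in degree [d]. The only sequence that is neither listed nor
    reached by these counts is [(1,2,3,2,1)], where two adjacent degrees are exceptional. *)
Lemma profile_cases d a b c : 2 <= d -> (0 < a -> 3 <= d) ->
  [\/ exists n, listed (profile d a b c) n, wild (nth 0 (profile d a b c))
    | profile d a b c = [:: 1; 2; 3; 2; 1]].
Proof.
move=> d2 a3.
have L n T : profile d a b c = T -> listed T n ->
   [\/ exists n, listed (profile d a b c) n, wild (nth 0 (profile d a b c))
    | profile d a b c = [:: 1; 2; 3; 2; 1]].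
  by move=> -> h; apply: Or31; exists n.
case: a a3 L => [|a] a3 L.
  case: b L => [|[|b]] L.
  - case: c L => [|[|c]] L.
    + by apply: L (listed_T1 d2); rewrite /profile /= cats0.
    + case: d d2 {a3} L => [|[|[|[|d]]]] // d2 L.
      * exact: L listed_T2.
      * exact: L listed_T3.
      by wild_with d.+4 0 d.+4.+1 d.+4 0 0.
    by apply: L (listed_T5 (k := c.+1) d2 isT).
  - case: d d2 {a3} L => [|[|[|d]]] // d2 L.
      case: c L => [|c] L; first exact: L (@listed_T6 1 1 isT isT).
      exact: L (@listed_T7 1 1 c.+1 isT isT isT).
    case: c L => [|c] L; first by wild_with d.+3 0 d.+4 (2 * d.+2) 0 0.
    case: d d2 L => [|d] d2 L; last by wild_with d.+4 1 d.+4.+1 d.+3 1 d.+4.+1.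
    case: c L => [|c] L; first exact: Or33.
    exact: L (@listed_T4 c.+1 isT).
  have d1 := ltnW d2; case: c L => [|c] L.
    by apply: L (@listed_T6 d b.+1 d1 isT); rewrite /profile /= cats0.
  exact: L (@listed_T7 d b.+1 c.+1 d1 isT isT).
(* A single 3 after a rise to [d >= 4] has a drop on its left; for [d = 3] it prolongs the last
   value of the rise and gives no such drop. *)
have d3 := a3 isT; have cc : a.+1 = 1 /\ 4 <= d \/ (2 <= a.+1 \/ d = 3) by lia.
case: b L => [|[|b]] L.
- case: c L => [|[|c]] L.
  + case: cc => [[a1 d4]|cc]; first by wild_with d 0 d.+1 (3 * d.-2) 0 0.
    case: (ltnP 1 a.+1) cc => [a2 _|a2 [|d3']]; try lia.
      by apply: L (@listed_T8 d a d2 a2); rewrite /profile /= !cats0.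
    have a0 : a = 0 by lia.
    by subst; apply: L (@listed_T8 2 1 isT isT).
  + by wild_with (d + a.+1) 0 3 1 3 d.
  case: cc => [[a1 d4]|cc]; first by wild_with d 1 d.+1 (2 * d.-2) 0 0.
  case: (ltnP 1 a.+1) cc => [a2 _|a2 [|d3']]; try lia.
    exact: L (@listed_T9 d a c.+2 d2 a2 isT).
  have a0 : a = 0 by lia.
  by subst; apply: L (@listed_T9 2 1 c.+2 isT isT isT).
- by wild_with (d + a.+1) (minn c 1) 3 1 3 d.
case: c L => [|[|c]] L.
- case: cc => [[a1 d4]|cc]; first by wild_with d 2 d.+1 d.-2 2 d.+1.
  case: (ltnP 1 a.+1) cc => [a2 _|a2 [|d3']]; try lia.
    by apply: L (@listed_T10 d a b.+2 d2 a2 isT); rewrite /profile /= !cats0.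
  have a0 : a = 0 by lia.
  by subst; apply: L (@listed_T10 2 1 b.+2 isT isT isT); rewrite /profile /= cats0.
- by wild_with (d + a.+1 + b.+2) 0 2 1 3 d.
case: cc => [[a1 d4]|cc]; first by wild_with d 2 d.+1 d.-2 2 d.+1.
case: (ltnP 1 a.+1) cc => [a2 _|a2 [|d3']]; try lia.
  exact: L (@listed_T11 d a b.+2 c.+2 d2 a2 isT isT).
have a0 : a = 0 by lia.
by subst; apply: L (@listed_T11 2 1 b.+2 c.+2 isT isT isT isT).
Qed.

Lemma listed_or_wild T : 0 \notin T -> nth 0 T 1 = 2 ->
  (forall i, nth 0 T i.+1 <= nth 0 T i \/ nth 0 T i = i.+1) -> (forall i, nth 0 T i <= i.+1) ->
  [\/ exists n, listed T n, wild (nth 0 T) | T = [:: 1; 2; 3; 2; 1]].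
Proof.
move=> T0 t1 shape tle; have [d [s [-> d2 so hs s0]]] := shape_cat T0 t1 shape tle.
case: (ltnP 3 (nth 0 s 0)) => s3.
  have ds : nth 0 (iota 1 d ++ s) d = nth 0 s 0 by rewrite nth_cat size_iota ltnn subnn.
  (* A value of at least 4 in degree [d] means that many free roots; the exceptional degree is put
     at the end of the sequence, where it is void. *)
  apply: Or32; exists (size (iota 1 d ++ s)), 0, 0, 0, (nth 0 s 0), d.
  split=> //; [by split=> //; rewrite nth_default | by move=> i _; left |].
  move=> _; split=> //; rewrite size_cat size_iota.
  case: s s3 {so hs s0 ds} => [|x s] //= _; lia.
have [a [b [c e]]] : exists a b c, s = nseq a 3 ++ nseq b 2 ++ nseq c 1.
  apply: sorted_small_seq => //; apply/(all_nthP 0) => i si; apply/andP; split.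
    by rewrite lt0n; apply: contra s0 => /eqP <-; rewrite mem_nth.
  apply: leq_trans s3; elim: i si => [//|i IH] si.
  by apply: leq_trans (IH (ltnW si)); apply: (sortedP 0 so).
rewrite e; apply: profile_cases => // a0.
by move: hs; rewrite e; case: a a0 {e}.
Qed.

End Sequences.

Section FunctionalMatrices.
Local Open Scope ring_scope.
Variables (K : fieldType) (i n : nat) (F : nat -> {poly K} -> K).
Hypothesis linF : forall l a p q, F l (a *: p + q) = a * F l p + F l q.

Definition functional_mx : 'M[K]_(i.+1, n) := \matrix_(k, l) F l 'X^k.

Let F0 l : F l 0 = 0.
Proof. by have := linF l (-1) 0 0; rewrite scaler0 addr0 mulN1r addNr. Qed.

Lemma functional_mxE (p : {poly K}) (l : 'I_n) : (size p <= i.+1)%N -> (poly_rV p *m functional_mx) 0 l = F l p.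
Proof.
move=> sp; have sumF (r : seq 'I_i.+1) (c : 'I_i.+1 -> K) : F l (\sum_(k <- r) c k *: 'X^k) = \sum_(k <- r) c k * F l 'X^k.
  by elim: r => [|k r IH]; rewrite ?big_nil // !big_cons linF IH.
rewrite [in RHS](poly_sumXn sp) sumF mxE; apply: eq_bigr => k _.
by rewrite !mxE.
Qed.

Lemma functional_mx_eq0 (p : {poly K}) : (size p <= i.+1)%N ->
  poly_rV p *m functional_mx = 0 <-> forall l, (l < n)%N -> F l p = 0.
Proof.
move=> sp; split=> [h l lt|h].
  by rewrite -(functional_mxE (Ordinal lt) sp) h mxE.
by apply/rowP => l; rewrite functional_mxE // h // mxE.
Qed.

Lemma functional_mx_rank : (forall l, (l < n)%N -> exists2 p : {poly K}, (size p <= i.+1)%N &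
  forall l', (l' < n)%N -> F l' p = (l == l')%:R) -> \rank functional_mx = n.
Proof.
move=> h; apply/eqP; rewrite -/(row_full _) -sub1mx; apply/row_subP => l.
have [p sp hp] := h l (ltn_ord l).
have -> : row l 1%:M = poly_rV p *m functional_mx.
  by apply/rowP => k; rewrite functional_mxE // hp // !mxE.
exact: submxMl.
Qed.

End FunctionalMatrices.

(** * The sequence [(1,2,3,2,1)] *)

Section SpecialChain.
Local Open Scope ring_scope.
Variables (K : closedFieldType) (charK0 : [pchar K]%R =i pred0).
Let T := [:: 1; 2; 3; 2; 1]%N.
Local Notation t := (nth 0%N T).

(* The ideals are the annihilators of a quartic Lam under apolarity.  The normalisation
   lam 3 = 1, lam 4 = 0 keeps the rank in degree 3 equal to 2 but costs one parameter,
   which is recovered as the shift in F. *)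
Let lam (v : 'I_4 -> K) m : K :=
  if m is 3 then 1 else if (m < 3)%N then v (inord m) else 0.
Let Lam v (p : {poly K}) : K := \sum_(m < 5) p`_m * lam v m.
Let F v i l (p : {poly K}) : K :=
  if (i < 3)%N then p`_l else Lam v ('X^l * (p \Po ('X + (v (inord 3))%:P))).

Let phi (v : 'I_4 -> K) i : 'M[K]_(i.+1, t i) := functional_mx i (t i) (F v i).

Let Lam_linear v a p q : Lam v (a *: p + q) = a * Lam v p + Lam v q.
Proof.
by rewrite /Lam mulr_sumr -big_split; apply: eq_bigr => m _; rewrite coefD coefZ mulrDl mulrA.
Qed.

Let F_linear v i l a p q : F v i l (a *: p + q) = a * F v i l p + F v i l q.
Proof.
rewrite /F; case: ifP => _; first by rewrite coefD coefZ.
by rewrite comp_polyD comp_polyZ mulrDr -scalerAr Lam_linear.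
Qed.

Let Lam_Xn v s : Lam v 'X^s = if (s < 5)%N then lam v s else 0.
Proof.
rewrite /Lam; case: ltnP => s5.
  rewrite (bigD1 (Ordinal s5)) //= coefXn eqxx mul1r big1 ?addr0 // => m.
  by rewrite -val_eqE /= coefXn => /negbTE ->; rewrite mul0r.
rewrite big1 // => m _; rewrite coefXn (_ : (m == s :> nat) = false) ?mul0r //.
by apply/negbTE; rewrite neq_ltn (leq_trans (ltn_ord m) s5).
Qed.

Let phi_poly i k l : polyfun (fun v => phi v i k l).
Proof.
have [i3|i3] := boolP (i < 3)%N.
  by apply: (polyfun_ext _ (polyfun_cst _ ('X^k)`_l)) => v; rewrite mxE /F i3.
apply: (polyfun_ext (f := fun v => \sum_(m < 5) ('X^l * ('X + (v (inord 3))%:P) ^+ k)`_m * lam v m)).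
  by move=> v; rewrite mxE /F (negbTE i3) comp_Xn_poly.
apply: polyfun_sum => m; apply: polyfun_mul.
  have : polycoef (fun v : 'I_4 -> K => 'X^l * ('X + (v (inord 3))%:P) ^+ k); last exact.
  apply: polycoef_mul; first exact: polycoef_cst.
  apply: polycoef_exp; apply: polycoef_add; first exact: polycoef_cst.
  by apply: polycoef_C; apply: polyfun_var.
rewrite /lam; case: m => [[|[|[|[|m]]]] /= _]; try exact: polyfun_cst; try exact: polyfun_var.
Qed.

Let comp_shift (c : K) p : (p \Po ('X - c%:P)) \Po ('X + c%:P) = p.
Proof. by rewrite -comp_polyA comp_polyB comp_polyC comp_polyX addrK comp_polyXr. Qed.

Let phi_hframe v : hframe (phi v).
Proof.
set c := v (inord 3).
split=> [i|i p sp].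
  apply: functional_mx_rank => [l a p q|l lt]; first exact: F_linear.
  have [i3|i3] := boolP (i < 3)%N.
    exists 'X^l => [|l' lt']; last by rewrite /F i3 coefXn eq_sym.
    rewrite size_polyXn (leq_trans lt) //.
    by case: i i3 {lt} => [|[|[|]]].
  have sc (q : {poly K}) : size (q \Po ('X - c%:P)) = size q.
    by rewrite size_comp_poly2 // size_XsubC.
  (* With [lam 3 = 1] and [lam 4 = 0], the shifted [X^3] and [X^2 - lam 2 X^3] are dual to the
     functionals, so the rank does not depend on the parameters. *)
  case: l lt => [|l] lt.
    exists ('X^3 \Po ('X - c%:P)) => [|l' lt']; first by rewrite sc size_polyXn ltnS leqNgt.
    rewrite /F (negbTE i3) comp_shift -exprD Lam_Xn.
    by case: i {sc} i3 lt lt' => [|[|[|[|[|i]]]]] //= _; case: l' => [|[|l']] //=; rewrite nth_nil.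
  have i4 : i = 3 by case: i {sc} i3 lt => [|[|[|[|[|i]]]]] //=; rewrite nth_nil.
  subst i; case: l lt => [|[]] // _.
  exists (('X^2 - (v (inord 2)) *: 'X^3) \Po ('X - c%:P)) => [|l' lt'].
    rewrite sc (leq_trans (size_polyD _ _)) // geq_max size_polyXn /= size_polyN.
    by rewrite (leq_trans (size_scale_leq _ _)) // size_polyXn.
  have Lz p q : Lam v (p - v (inord 2) *: q) = Lam v p - v (inord 2) * Lam v q.
    by rewrite addrC -scaleNr Lam_linear mulNr addrC.
  rewrite /F /= comp_shift mulrBr -scalerAr -!exprD Lz !Lam_Xn.
  by case: l' lt' => [|[|]] //= _; rewrite ?mulr1 ?subrr ?mulr0 ?subr0.
have sX : (size ('X * p)%R <= i.+2)%N.
  by rewrite (leq_trans (size_polyMleq _ _)) // size_polyX.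
rewrite !functional_mx_eq0; try (exact: F_linear); try exact: leqW; try done.
move=> h; suff : forall l, (l < t i.+1)%N -> F v i.+1 l p = 0 /\ F v i.+1 l ('X * p) = 0.
  by move=> H; split=> l /H [].
move=> l lt; have [i3|i3] := boolP (i < 3)%N.
  suff -> : p = 0 by rewrite mulr0; have := F_linear v i.+1 l (-1) 0 0; rewrite scaler0 addr0 mulN1r addNr.
  apply/polyP => m; rewrite coef0; case: (ltnP m i.+1) => mi; last by rewrite nth_default // (leq_trans sp).
  have := h m; rewrite /F i3; apply.
  by case: i i3 mi {sp sX h lt} => [|[|[|]]].
have i4 : i = 3 by case: i i3 lt {sp sX h} => [|[|[|[|[|i]]]]] //=; rewrite nth_nil.
subst i; case: l lt => [|[]] // _.
have h0 := h 0%N isT; have h1 := h 1%N isT; move: h0 h1.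
rewrite /F /= expr0 !mul1r expr1 comp_polyM comp_polyX => h0 h1; split=> //.
by rewrite mulrDl mul_polyC addrC Lam_linear h0 h1 mulr0 addr0.
Qed.

(** In degree 4 the monomials [1], [X], [X^2] read off [lam 0], [lam 1], [lam 2] when the shift is
    0. The shift [s] itself is read off from [X^4]: [Lam] of [(X + s)^4] is [4 s] once the other
    parameters vanish. *)
Let sel (k l : nat) : nat := if (k < 3)%N then k else 4.

Let D_free k v : row_free (\matrix_(l < t 4) (poly_rV 'X^(sel k l) *m phi v 4)) =
  (Lam v (('X + (v (inord 3))%:P) ^+ sel k 0) != 0).
Proof.
rewrite (@replaced_row_free _ _ _ ord0) => [|l]; last by rewrite ord1 eqxx.
rewrite mxE functional_mxE; first by rewrite /F /= mul1r comp_Xn_poly.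
  by move=> *; apply: F_linear.
by rewrite size_polyXn /sel; case: ifP => // k3; apply: leq_trans k3 _.
Qed.

Lemma special_chain : exists Z, irreducible_chain (@Hilb_closed K (sumn T)) (@G_ K T) 4 Z.
Proof.
apply: (G_krull_chain charK0 _ (phi := phi) (deg := fun=> 4) (sel := sel)) => //.
- by move=> k l _ _; rewrite /sel; case: ltnP => // /ltnW/leqW.
- move=> k v k4 hv; rewrite D_free negbK (hv (inord 3)) ?inordK // polyC0 addr0 Lam_Xn /sel.
  case: (ltnP k 3) => k3 //=; rewrite (leq_trans k3) // /lam.
  by case: k k3 hv {k4} => [|[|[|]]] //= _ hv; rewrite hv ?inordK.
move=> k k4; exists (fun i => (i == k :> nat)%:R) => [i ki|]; first by rewrite gtn_eqF.
rewrite D_free inordK //; case: k k4 => [|[|[|[|]]]] //= _; rewrite ?polyC0 ?addr0 ?Lam_Xn /=.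
- by rewrite /lam /= inordK // oner_eq0.
- by rewrite /lam /= inordK // oner_eq0.
- by rewrite /lam /= inordK // oner_eq0.
have -> : Lam (fun i : 'I_4 => (i == 3 :> nat)%:R) (('X + 1%:P) ^+ 4) = 4%:R.
  rewrite /Lam !big_ord_recr big_ord0 /= /lam /= !inordK // !mulr0 !add0r mulr1 addr0.
  rewrite polyC1 addrC exprDn coef_sum (bigD1 (inord 3)) //= big1.
    by rewrite inordK // expr1n mul1r coefMn coefXn eqxx addr0.
  move=> m; rewrite -val_eqE /= inordK // expr1n mul1r coefMn coefXn => /negbTE m3.
  by rewrite eq_sym m3 mul0rn.
have /pcharf0P -> // := charK0.
Qed.

End SpecialChain.

(** * The bound 3 for sequences of finite type *)

Section FiniteTypeDimension.
Local Open Scope ring_scope.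
Variables (K : closedFieldType) (charK0 : [pchar K]%R =i pred0) (T : seq nat).
Local Notation t := (nth 0%N T).
Local Notation family := (forall i, 'M[K]_(i.+1, t i)).
Hypotheses (T0 : 0%N \notin T) (t0 : t 0 != 0%N) (t1 : t 1 = 2%N).

Lemma presents_transport (R S : falgType K) (phi : family) :
  presents R phi -> alg_isomorphic R S -> presents S phi.
Proof.
move=> [psi [surj ker]] [f [g fK gK]]; exists (f \o psi : {lrmorphism fps2 K -> S}); split.
  by move=> s; have [a ea] := surj (g s); exists a; rewrite /= ea gK.
move=> a; rewrite ker /=; split=> [->|]; first exact: raddf0.
by rewrite -[in X in _ = X](raddf0 f) => /(can_inj fK).
Qed.

(** Both kernels have dimension [i.+1 - t i], so an inclusion is an equality. *)
Lemma hframe_ker_sub (phi psi : family) : hframe phi -> hframe psi ->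
  (forall i (p : {poly K}), (size p <= i.+1)%N -> poly_rV p *m phi i = 0 -> poly_rV p *m psi i = 0) ->
  forall i (p : {poly K}), (size p <= i.+1)%N -> poly_rV p *m phi i = 0 <-> poly_rV p *m psi i = 0.
Proof.
move=> h1 h2 sub i p sp; split; first exact: sub.
have le : (kermx (phi i) <= kermx (psi i))%MS.
  apply/rV_subP => v /sub_kermxP hv; apply/sub_kermxP.
  by rewrite -[v]rVpolyK; apply: (sub i _ (size_poly _ _)); rewrite rVpolyK.
have /eqmxP e : (kermx (phi i) == kermx (psi i))%MS.
  by rewrite -(geq_leqif (mxrank_leqif_eq le)) !rank_ker.
by move/sub_kermxP; rewrite -e => /sub_kermxP.
Qed.

Lemma hform_scale (c : K) (L1 L2 : {poly K}) i (p : {poly K}) :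
  hform (c *: L1) (c *: L2) i p = c ^+ i *: hform L1 L2 i p.
Proof.
rewrite /hform scaler_sumr; apply: eq_bigr => k _.
rewrite !exprZn -scalerAl -scalerAr !scalerA; congr (_ *: _).
by rewrite -mulrA -exprD subnKC 1?mulrC // -ltnS.
Qed.

Lemma subst_frame_scale (c : K) (L1 L2 : {poly K}) (phi : family) i (p : {poly K}) : c != 0 -> (size p <= i.+1)%N ->
  poly_rV p *m subst_frame (c *: L1) (c *: L2) phi i = 0 <-> poly_rV p *m subst_frame L1 L2 phi i = 0.
Proof.
move=> c0 sp; rewrite !subst_frameE // hform_scale linearZ /= -scalemxAl.
split=> [/eqP|->]; last by rewrite scaler0.
by rewrite scaler_eq0 expf_eq0 (negbTE c0) andbF => /eqP.
Qed.

Lemma polyfun_subst_frame n (L1 L2 : ('I_n -> K) -> {poly K}) (phi : ('I_n -> K) -> family) :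
  polycoef L1 -> polycoef L2 -> (forall i k l, polyfun (fun v => phi v i k l)) ->
  forall i k l, polyfun (fun v => subst_frame (L1 v) (L2 v) (phi v) i k l).
Proof.
move=> p1 p2 pphi i k l.
apply: (@polyfun_ext K n (fun v => \sum_(m < i.+1) (L1 v ^+ k * L2 v ^+ (i - k))`_m * phi v i m l)) => [v|].
  by rewrite !mxE; apply: eq_bigr => m _; rewrite !mxE.
apply: polyfun_sum => m; apply: polyfun_mul => //.
have : polycoef (fun v => L1 v ^+ k * L2 v ^+ (i - k)); last exact.
by apply: polycoef_mul; apply: polycoef_exp.
Qed.

Lemma linear_poly (L : {poly K}) : (size L <= 2)%N -> L = L`_1 *: 'X + (L`_0)%:P.
Proof.
move=> sL; rewrite {1}(poly_sumXn sL) !big_ord_recr big_ord0 /= add0r addrC expr1.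
by rewrite ?expr0 alg_polyC.
Qed.

(* Up to a scalar, an invertible linear substitution has leading entry 1, so the frames
   equivalent to one of finitely many form finitely many 3-parameter families. *)
Lemma finite_type_krull_le : homogeneous_finite_type K T ->
  forall e Z, irreducible_chain (@Hilb_closed K (sumn T)) (@G_ K T) e Z -> (e <= 3)%N.
Proof.
move=> [n [S hS]].
have ex k : exists phi : family, (exists2 psi : family, hframe psi & presents (S k) psi) ->
    hframe phi /\ presents (S k) phi.
  have [[psi h1 h2]|no] := pselect (exists2 psi : family, hframe psi & presents (S k) psi).
    by exists psi.
  (* A dummy frame for those [S k] that have no presentation of this kind; an algebra isomorphic to
     some presented [R] is never among them. *)
  by exists (fun i => 0).
pose rep k := projT1 (cid (ex k)); have repP k := projT2 (cid (ex k)).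
pose w (m : nat) (v : 'I_3 -> K) : K := v (inord m).
pose L (b : bool) v : {poly K} := if b then 'X + (w 0 v)%:P else 1.
pose L' v : {poly K} := w 1 v *: 'X + (w 2 v)%:P.
pose fam (a : 'I_(n + n)) v : family :=
  match fintype.split a with inl k => subst_frame (L true v) (L' v) (rep k)
                   | inr k => subst_frame (L false v) (L' v) (rep k) end.
have pw m : polyfun (w m) by apply: polyfun_var.
have pL' : polycoef L'.
  apply: polycoef_add; last exact: polycoef_C.
  by apply: polycoef_scale => //; apply: polycoef_cst.
have pL b : polycoef (L b).
  case: b; last exact: polycoef_cst.
  by apply: polycoef_add; [exact: polycoef_cst|exact: polycoef_C].
apply: (G_krull_le charK0 T0 (phi := fam)) => [a i k l|psi hpsi].
  rewrite /fam; case: (fintype.split a) => m;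
    by apply: polyfun_subst_frame => // *; apply: polyfun_cst.
have [R pR] := hframe_presents hpsi t0.
have HR : has_HilbertSamuel R T by apply: HilbertSamuel_presents pR => //; exact: hpsi.1.
have [k iso] := hS R (presents_standard_graded pR) HR.
have [hr pr] : hframe (rep k) /\ presents (S k) (rep k).
  by apply: repP; exists psi => //; apply: presents_transport pR iso.
have [L1 [L2 [s1 s2 D0 sub]]] := iso_subst hpsi hr pR pr t1 iso.
have hsub := subst_frame_hframe s1 s2 D0 hr.
have E i p sp := hframe_ker_sub hpsi hsub sub (i := i) (p := p) sp.
have key (b : bool) (c : K) (v : 'I_3 -> K) : c != 0 -> L1 = c *: L b v -> L2 = c *: L' v ->
    forall i (p : {poly K}), (size p <= i.+1)%N ->
    poly_rV p *m psi i = 0 <-> poly_rV p *m subst_frame (L b v) (L' v) (rep k) i = 0.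
  by move=> c0 e1 e2 i p sp; rewrite E // e1 e2; apply: subst_frame_scale.
pose vec (x y z : K) (i : 'I_3) : K := [:: x; y; z]`_i.
have wvec x y z : (w 0 (vec x y z) = x) * (w 1 (vec x y z) = y) * (w 2 (vec x y z) = z).
  by rewrite /w /vec !inordK.
(* The leading entry of the substitution is the coefficient of [X] in [L1], or its constant term if
   that coefficient is zero; dividing by it gives a member of the family [L true] or [L false]. *)
have [l10|l10] := eqVneq (L1`_1) 0.
  have l00 : L1`_0 != 0 by apply: contraNneq D0 => h; rewrite /form_det l10 h !mul0r subrr.
  exists (rshift n k), (vec 0 (L2`_1 / L1`_0) (L2`_0 / L1`_0)); rewrite /fam.
  have -> : fintype.split (rshift n k) = inr k by exact: (unsplitK (inr k)).
  apply: (key false L1`_0) => //; rewrite /L /L' ?wvec.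
    by rewrite {1}(linear_poly s1) l10 scale0r add0r alg_polyC.
  rewrite {1}(linear_poly s2) scalerDr scalerA -[_ *: _%:P]mul_polyC -polyCM.
  by rewrite ![L1`_0 * _]mulrC !divfK.
exists (lshift n k), (vec (L1`_0 / L1`_1) (L2`_1 / L1`_1) (L2`_0 / L1`_1)); rewrite /fam.
have -> : fintype.split (lshift n k) = inl k by exact: (unsplitK (inl k)).
apply: (key true L1`_1) => //; rewrite /L /L' ?wvec.
  rewrite {1}(linear_poly s1) scalerDr -[_ *: _%:P]mul_polyC -polyCM.
  by rewrite ![L1`_1 * _]mulrC !divfK.
rewrite {1}(linear_poly s2) scalerDr scalerA -[_ *: _%:P]mul_polyC -polyCM.
by rewrite ![L1`_1 * _]mulrC !divfK.
Qed.

End FiniteTypeDimension.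

Section InfiniteType.
Local Open Scope ring_scope.
Variables (K : closedFieldType) (charK0 : [pchar K]%R =i pred0) (T : seq nat).
Local Notation t := (nth 0%N T).

Lemma hframe_shape (phi : forall i, 'M[K]_(i.+1, t i)) : hframe phi ->
  (forall i, t i.+1 <= t i \/ t i = i.+1)%N /\ (forall i, t i <= i.+1)%N.
Proof.
move=> h; have le i : (t i <= i.+1)%N := leq_frame h i.
split=> // i; case: (ltnP i (t i)) => ti; last by left; apply: hframe_decr h _ ti.
by right; apply/eqP; rewrite eqn_leq le.
Qed.

Lemma finite_type_listed : HilbertSamuel_sequence K T -> t 1 = 2%N ->
  homogeneous_finite_type K T -> exists d, listed T d.
Proof.
move=> HS t1 fin; have [R HR] := HS; have t0 := HilbertSamuel_head HR t1.
have T0 := HR.2.1; have [phi hphi] := HilbertSamuel_hframe HS t1.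
have le3 := finite_type_krull_le charK0 T0 t0 t1 fin.
have [shape tle] := hframe_shape hphi.
case: (listed_or_wild T0 t1 shape tle) => // [[j [b [c [q [r [i0 [[tb tc cj tjS] tj ri qle q4]]]]]]]|e].
  have [Z hZ] := std_chain charK0 T0 t0 shape tle tb tc cj tjS tj ri qle.
  by have := leq_trans q4 (le3 _ _ hZ).
by have [Z hZ] := special_chain charK0; rewrite -e in hZ; have := le3 _ _ hZ.
Qed.

End InfiniteType.

(** * Dimensions *)

Section Flip.
Local Open Scope ring_scope.
Variables (K : closedFieldType) (T : seq nat).
Local Notation t := (nth 0%N T).
Local Notation family := (forall i, 'M[K]_(i.+1, t i)).

(* The involution (x, y) |-> (c x + (1 - c^2) y, x - c y) exchanges the points
   (c : 1) and (1 : 0). *)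
Definition flip1 (c : K) : {poly K} := c *: 'X + (1 - c ^+ 2)%:P.
Definition flip2 (c : K) : {poly K} := 'X - c%:P.

Lemma size_flip1 c : (size (flip1 c) <= 2)%N.
Proof.
rewrite (leq_trans (size_polyD _ _)) // geq_max (leq_trans (size_scale_leq _ _)) ?size_polyX //=.
by rewrite (leq_trans (size_polyC_leq1 _)).
Qed.

Lemma size_flip2 c : (size (flip2 c) <= 2)%N.
Proof. by rewrite size_XsubC. Qed.

Lemma coef_flip c : ((flip1 c)`_0 = 1 - c ^+ 2) * ((flip1 c)`_1 = c) * ((flip2 c)`_0 = - c) * ((flip2 c)`_1 = 1).
Proof. by rewrite !coefD !coefN !coefZ !coefC !coefX /= mulr0 mulr1 addr0 add0r subr0 sub0r. Qed.

Lemma flip_det c : form_det (flip1 c) (flip2 c) != 0.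
Proof.
rewrite /form_det !coef_flip (_ : _ - _ = -1) ?oppr_eq0 ?oner_eq0 //; ring.
Qed.

Lemma flipK c i (p : {poly K}) : (size p <= i.+1)%N ->
  hform (flip1 c) (flip2 c) i (hform (flip1 c) (flip2 c) i p) = p.
Proof.
move=> sp; rewrite -hform_hform ?size_flip1 ?size_flip2 //; last exact: mulrC.
have E (q : {poly K}) : hform (flip1 c) (flip2 c) 1 q = q`_0 *: flip2 c + q`_1 *: flip1 c.
  by rewrite /hform !big_ord_recr big_ord0 /= add0r !expr1 !expr0 mul1r mulr1.
rewrite !E !coef_flip -[RHS](hform_X1 sp); congr (hform _ _ i p); rewrite /flip1 /flip2.
  by rewrite expr2 -!mul_polyC !polyCB !polyCM !polyC1; ring.
by rewrite expr2 -!mul_polyC polyCN !polyCB !polyCM !polyC1; ring.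
Qed.

Definition flip c (phi : family) : family := subst_frame (flip1 c) (flip2 c) phi.

Lemma flip_hframe c phi : hframe phi -> hframe (flip c phi).
Proof. by apply: subst_frame_hframe; rewrite ?size_flip1 ?size_flip2 ?flip_det. Qed.

Lemma flip_ker c phi i (p : {poly K}) : (size p <= i.+1)%N ->
  in_ker (flip c phi) i p <-> in_ker phi i (hform (flip1 c) (flip2 c) i p).
Proof.
move=> sp; rewrite /in_ker /flip subst_frameE //; split=> -[_ h]; split=> //.
by apply: size_hform; rewrite ?size_flip1 ?size_flip2.
Qed.

Lemma flip_ker_inv c phi i (p : {poly K}) :
  in_ker phi i p -> in_ker (flip c phi) i (hform (flip1 c) (flip2 c) i p).
Proof.
move=> h; apply/flip_ker; first by apply: size_hform; rewrite ?size_flip1 ?size_flip2.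
by rewrite flipK //; exact: h.1.
Qed.

Lemma coefM_top (p q : {poly K}) m n : (size p <= m.+1)%N -> (size q <= n.+1)%N ->
  (p * q)`_(m + n) = p`_m * q`_n.
Proof.
move=> sp sq; have mn : (m < (m + n).+1)%N by rewrite ltnS leq_addr.
rewrite coefM (bigD1 (Ordinal mn)) //= addKn big1 ?addr0 // => k; rewrite -val_eqE /= => km.
case: (ltngtP k m) km => // [lt|gt] _.
  rewrite [q`_(m + n - k)]nth_default ?mulr0 // (leq_trans sq) //.
  by move: (nat_of_ord k) lt => k' lt; lia.
by rewrite [p`_k]nth_default ?mul0r // (leq_trans sp).
Qed.

Lemma coefX_top (p : {poly K}) n : (size p <= 2)%N -> (p ^+ n)`_n = p`_1 ^+ n /\ (size (p ^+ n)%R <= n.+1)%N.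
Proof.
move=> sp; elim: n => [|n [IH1 IH2]]; first by rewrite !expr0 coefC size_poly1.
split; first by rewrite !exprS -add1n coefM_top // IH1.
rewrite exprS (leq_trans (size_polyMleq _ _)) //; move: sp IH2.
by move: (size p) (size (p ^+ n)) => a b; lia.
Qed.

Lemma hform_top (L1 L2 : {poly K}) i (p : {poly K}) : (size L1 <= 2)%N -> (size L2 <= 2)%N ->
  (hform L1 L2 i p)`_i = \sum_(k < i.+1) p`_k * (L1`_1 ^+ k * L2`_1 ^+ (i - k)).
Proof.
move=> s1 s2; rewrite /hform coef_sum; apply: eq_bigr => k _; rewrite coefZ; congr (_ * _).
have ki : (k <= i)%N by rewrite -ltnS.
have [e1 h1] := coefX_top k s1; have [e2 h2] := coefX_top (i - k) s2.
by have := coefM_top h1 h2; rewrite subnKC // e1 e2.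
Qed.

(** [flip] exchanges the point [(c : 1)] with the point at infinity, so a form that does not vanish
    at [c] becomes one without a root at infinity. *)
Lemma size_flip c i (p : {poly K}) : (size p <= i.+1)%N -> p.[c] != 0 ->
  size (hform (flip1 c) (flip2 c) i p) = i.+1.
Proof.
move=> sp pc; apply/eqP; rewrite eqn_leq size_hform ?size_flip1 ?size_flip2 //=.
rewrite ltnNge; apply: contra pc => h; apply/eqP.
rewrite (horner_coef_wide _ sp) -[RHS](nth_default 0 h) hform_top ?size_flip1 ?size_flip2 //.
by apply: eq_bigr => k _; rewrite !coef_flip expr1n mulr1.
Qed.

Hypothesis charK0 : [pchar K]%R =i pred0.

(** Testing [i + 1] integers is enough, so finitely many flips bring every nonzero form of degree
    [i] to full size. *)
Lemma horner_neq0_nat (p : {poly K}) i : (size p <= i.+1)%N -> p != 0 ->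
  exists c : 'I_i.+1, p.[c%:R] != 0.
Proof.
move=> sp p0; apply: contrapT => h; have allr : all (root p) [seq (nat_of_ord c)%:R | c <- enum 'I_i.+1].
  apply/allP => x /mapP[c _ ->]; rewrite /root; apply: contrapT => /negP hc.
  by apply: h; exists c.
have uq : uniq [seq (nat_of_ord c)%:R : K | c <- enum 'I_i.+1].
  by rewrite map_inj_uniq ?enum_uniq // => a b /(natK_inj charK0) /val_inj.
have := max_poly_roots p0 allr uq; rewrite size_map size_enum_ord => /leq_trans /(_ sp).
by rewrite ltnn.
Qed.

End Flip.

(** * Simultaneous roots of an ideal in all degrees *)

Section DivisorChains.
Local Open Scope ring_scope.
Variable K : closedFieldType.

(** Roots are chosen one at a time: the next one is a root of the quotient of [F m] by the product
    found so far, for the last degree [m] that needs a further root. It serves the earlier degrees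
    too, because [F m] divides their forms. The bound [N] guarantees that a last degree exists. *)
Lemma divisor_chain (D : nat -> Prop) (s : nat -> nat) (F : nat -> {poly K}) N :
  (forall i, D i -> F i \is monic /\ size (F i) = (s i).+1) ->
  (forall i i', D i -> D i' -> (i <= i')%N -> F i' %| F i) ->
  (forall i, D i -> (0 < s i)%N -> (i < N)%N) ->
  exists u, forall i, D i -> F i = roots_poly u (s i).
Proof.
move=> mF dF bN.
have eqF f i : D i -> f \is monic -> size f = (s i).+1 -> f %| F i -> F i = f.
  move=> Di mf sf df; apply/eqP; rewrite eq_sym -eqp_monic //; last exact: (mF i Di).1.
  by rewrite -dvdp_size_eqp // sf (mF i Di).2.
have step k : exists u, forall i, D i ->
    ((s i <= k)%N -> F i = roots_poly u (s i)) /\ ((k < s i)%N -> roots_poly u k %| F i).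
  elim: k => [|k [u hu]].
    exists (fun=> 0) => i Di; split=> [|_]; last by rewrite /roots_poly big_ord0 dvd1p.
    rewrite leqn0 => /eqP si; apply: eqF => //; rewrite ?roots_poly_monic ?size_roots_poly //.
    by rewrite si /roots_poly big_ord0 dvd1p.
  have [ex|no] := pselect (exists i, D i /\ (k < s i)%N); last first.
    exists u => i Di; have ki : (s i <= k)%N by rewrite leqNgt; apply/negP => h; apply: no; exists i.
    split=> [_|h]; first exact: (hu i Di).1.
    by have := ltn_trans (ltnSn k) h; rewrite ltnNge ki.
  have exb : exists i, `[< D i /\ (k < s i)%N >] by case: ex => i h; exists i; apply/asboolP.
  have ub i : `[< D i /\ (k < s i)%N >] -> (i <= N)%N.
    by move/asboolP => [Di h]; apply: ltnW; apply: bN => //; apply: leq_trans h.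
  case: (ex_maxnP exb ub) => m /asboolP [Dm hm] mmax.
  have [_ /(_ hm) /dvdpP [Q FQ]] := hu m Dm.
  have Q0 : Q != 0.
    apply: contraTneq (monic_neq0 (mF m Dm).1) => Q0; by rewrite FQ Q0 mul0r eqxx.
  have Qs : size Q != 1%N.
    apply: contraTneq hm => Q1; have := (mF m Dm).2.
    rewrite FQ size_mul ?roots_poly_neq0 // Q1 size_roots_poly /= => -[<-].
    by rewrite ltnn.
  have [a ra] := closed_rootP _ Qs.
  pose u' n := if n == k then a else u n.
  have ulow n : (n <= k)%N -> roots_poly u' n = roots_poly u n.
    by move=> nk; apply: roots_poly_eq => l ln; rewrite /u' ltn_eqF // (leq_trans ln).
  have dm : roots_poly u' k.+1 %| F m.
    rewrite roots_polyS ulow // FQ [Q * _]mulrC dvdp_mul2l ?roots_poly_neq0 //.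
    by rewrite /u' eqxx dvdp_XsubCl.
  exists u' => i Di; have dd : (k < s i)%N -> roots_poly u' k.+1 %| F i.
    move=> ki; apply: dvdp_trans dm _; apply: dF => //; apply: mmax.
    by apply/asboolP.
  split=> [|ki]; last by apply: dd; apply: ltnW.
  rewrite leq_eqVlt => /orP[/eqP e|]; last first.
    by rewrite ltnS => ki; rewrite ulow //; apply: (hu i Di).1.
  apply: eqF; rewrite ?roots_poly_monic ?size_roots_poly // e; apply: dd.
  by rewrite e.
have [u hu] := step (\max_(i < N) s i)%N; exists u => i Di; apply: (hu i Di).1.
case: (posnP (s i)) => [->//|si]; exact: (leq_bigmax (Ordinal (bN i Di si))).
Qed.

End DivisorChains.

Section KernelStructure.
Local Open Scope ring_scope.
Variables (K : closedFieldType) (T : seq nat).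
Local Notation t := (nth 0%N T).
Variable phi : forall i, 'M[K]_(i.+1, t i).
Hypothesis hphi : hframe phi.

(** No drop on at least one side of [i]: the condition under which the kernel consists of the
    multiples of one form. *)
Definition stable i : Prop := t i.+1 = t i \/ exists2 k, i = k.+1 & t k = t i.

(** A form of full size is not divisible by [y]; then neither is the common factor, which therefore
    has full degree [t i]. *)
Lemma exact_multiples i : (t i <= i)%N -> stable i ->
  (exists2 g, in_ker phi i g & size g = i.+1) ->
  exists f : {poly K}, [/\ f \is monic, size f = (t i).+1 &
    forall p, in_ker phi i p <-> (size p <= i.+1)%N /\ f %| p].
Proof.
move=> ti st [g hg sg]; have [f [f0 sf hf]] := ker_structure hphi ti st.
have g0 : g != 0 by rewrite -size_poly_gt0 sg.
have fs : size f = (t i).+1.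
  apply/eqP; rewrite eqn_leq sf /=; have [h sh e] := (hf g).1 hg.
  have h0 : h != 0 by apply: contraNneq g0 => h0; rewrite e h0 mul0r.
  move: sg; rewrite e size_mul //; move: sh ti.
  by move: (size h) (size f) => a b; lia.
have lf : (lead_coef f)^-1 != 0 by rewrite invr_eq0 lead_coef_eq0.
exists ((lead_coef f)^-1 *: f); split=> [||p].
- by rewrite monicE lead_coefZ mulVf // lead_coef_eq0.
- by rewrite size_scale.
rewrite dvdpZl //; split=> [hp|[sp /dvdpP [h e]]].
  by split; [exact: hp.1|have [h _ ->] := (hf p).1 hp; rewrite dvdp_mull].
have [->|p0] := eqVneq p 0; first by split; rewrite ?size_poly0 // raddf0 mul0mx.
apply/hf; exists h => //; move: sp; rewrite e size_mul ?fs //; last first.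
  by apply: contraNneq p0 => h0; rewrite e h0 mul0r.
by move: (size h) => a; lia.
Qed.

Lemma in_ker_full i p : t i = i.+1 -> in_ker phi i p -> p = 0.
Proof.
move=> ti [sp hp]; have : row_free (phi i) by rewrite /row_free hphi.1 ti.
move/row_free_inj => inj; have : poly_rV p = 0 :> 'rV_i.+1.
  by apply: inj; rewrite hp mul0mx.
by move/(congr1 rVpoly); rewrite poly_rV_K // linear0.
Qed.

(** The degrees with [t i = i.+1] fit the same description: the kernel is zero there, and so is
    every multiple of a polynomial of degree [i + 1] that has size at most [i + 1]. *)
Lemma exact_roots (D : nat -> Prop) :
  (forall i, D i -> [/\ (t i <= i)%N, stable i & exists2 g, in_ker phi i g & size g = i.+1]) ->
  exists u, forall i p, D i \/ t i = i.+1 ->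
    in_ker phi i p <-> (size p <= i.+1)%N /\ roots_poly u (t i) %| p.
Proof.
move=> hD.
have ex i : exists f : {poly K}, D i -> [/\ f \is monic, size f = (t i).+1 &
    forall p, in_ker phi i p <-> (size p <= i.+1)%N /\ f %| p].
  have [/hD [h1 h2 h3]|no] := pselect (D i); last by exists 0.
  by have [f hf] := exact_multiples h1 h2 h3; exists f.
pose F i := projT1 (cid (ex i)).
have FP i : D i -> [/\ F i \is monic, size (F i) = (t i).+1 &
    forall p, in_ker phi i p <-> (size p <= i.+1)%N /\ F i %| p] := projT2 (cid (ex i)).
have [u hu] : exists u, forall i, D i -> F i = roots_poly u (t i).
  apply: (@divisor_chain K D t F (size T)) => [i /FP []|i i' Di Di' ii'|i _] //.
    have [_ sF hF] := FP i Di; have [_ _ hF'] := FP i' Di'; have [ti _ _] := hD i Di.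
    suff : in_ker phi i' (F i) by case/hF'.
    rewrite -(subnKC ii'); elim: (i' - i)%N => [|k IH]; last by rewrite addnS; apply: in_kerS.
    by rewrite addn0; apply/hF; rewrite sF ltnS.
  by case: (ltnP i (size T)) => // h; rewrite nth_default.
exists u => i p [Di|ti]; first by have [_ _ hF] := FP i Di; rewrite hF hu.
split=> [h|[sp h]].
  by split; [exact: h.1|rewrite (in_ker_full ti h) dvdp0].
rewrite (roots_poly_dvd_small _ h) ?ti //.
by split; rewrite ?size_poly0 // raddf0 mul0mx.
Qed.

Lemma good_degree i j g : in_ker phi i g -> size g = i.+1 -> (i <= j)%N ->
  exists2 g', in_ker phi j g' & size g' = j.+1.
Proof.
move=> hg sg ij; exists ('X^(j - i) * g).
  by rewrite -{1}(subnK ij); apply: in_kerM; rewrite ?size_polyXn.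
rewrite size_monicM ?monicXn ?size_polyXn ?sg //; first by move: ij; lia.
by rewrite -size_poly_gt0 sg.
Qed.

(** The kernel lies between the multiples of [f_c] and those of [f_b], so it is cut out by
    functionals on polynomials modulo [g], the quotient of [f_c] by [f_b]; [Z m l] is the value of
    the [l]-th functional at [X^m]. A single functional must be nonzero for reasons of rank. *)
Lemma exceptional_structure (u : nat -> K) j b c : (b <= t j)%N -> (b <= c)%N -> (c <= j.+1)%N ->
  (forall p, in_ker phi j p -> roots_poly u b %| p) ->
  (forall h : {poly K}, (size (h * roots_poly u c)%R <= j.+1)%N -> in_ker phi j (h * roots_poly u c)) ->
  exists Z : nat -> nat -> K,
    (forall p : {poly K}, (size p <= j.+1)%N -> in_ker phi j p <-> roots_poly u b %| p /\
       forall l, (l < t j - b)%N -> \sum_(m < c - b) ((p %% roots_poly u c) %/ roots_poly u b)`_m * Z m l = 0) /\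
    (t j = b.+1 -> exists2 m, (m < c - b)%N & Z m 0%N != 0).
Proof.
move=> bt bc cj hV hc; set f := roots_poly u b; set n := (j.+1 - b)%N.
have tj := leq_frame hphi j.
have f0 : f != 0 by exact: roots_poly_neq0.
have sf : size f = b.+1 by exact: size_roots_poly.
(* [M] is the frame restricted to the multiples of [f_b]. Its rank is [t j - b], and a column base
   of it provides the functionals [mu]. *)
pose B := multiples_mx j n f; pose M := B *m phi j.
have Bfree : row_free B by apply: multiples_mx_free => //; rewrite sf /n; lia.
have sizeM (h : {poly K}) : (size h <= n)%N -> (size (h * f)%R <= j.+1)%N.
  by move=> sh; rewrite (leq_trans (size_polyMleq _ _)) // sf; move: sh; rewrite /n; lia.
have quot (p : {poly K}) : (size p <= j.+1)%N -> f %| p -> (size (p %/ f)%R <= n)%N /\ p = (p %/ f) * f.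
  by move=> sp fp; split; [rewrite size_divp // sf /n /= leq_sub2r|rewrite divpK].
have kerM (h : {poly K}) : (size h <= n)%N -> in_ker phi j (h * f) <-> poly_rV h *m M = 0.
  move=> sh; rewrite mulmxA mul_multiples_mx poly_rV_K //.
  by split=> [[]//|]; split=> //; apply: sizeM.
have rM : \rank M = (t j - b)%N.
  have := mxrank_mul_ker B (phi j); rewrite -/M.
  have -> : \rank (B :&: kermx (phi j)) = (j.+1 - t j)%N.
    rewrite -(rank_ker hphi); apply: eqmx_rank; rewrite capmxSr /= sub_capmx submx_refl andbT.
    apply/rV_subP => v /sub_kermxP hv.
    have hk : in_ker phi j (rVpoly v) by split; rewrite ?rVpolyK // size_poly.
    have [sq e] := quot _ hk.1 (hV _ hk).
    by rewrite -[v]rVpolyK e -[X in X * f](poly_rV_K sq) -mul_multiples_mx submxMl.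
  move/eqP: Bfree => ->; rewrite /n; move: (\rank M) => r; lia.
pose C := col_base M; pose mu l (h : {poly K}) : K := oapp (fun l' => (poly_rV h *m C) 0 l') 0 (insub l).
have muE l h (lt : (l < \rank M)%N) : mu l h = (poly_rV h *m C) 0 (Ordinal lt).
  by rewrite /mu insubT.
have mu_lin l a p q : mu l (a *: p + q) = a * mu l p + mu l q.
  rewrite /mu; case: insub => [l'|]; last by rewrite /= mulr0 addr0.
  by rewrite /= linearP mulmxDl -scalemxAl !mxE.
have kerC (h : {poly K}) : (size h <= n)%N -> in_ker phi j (h * f) <-> forall l, (l < t j - b)%N -> mu l h = 0.
  move=> sh; rewrite kerM // -{1}(mulmx_base M) mulmxA -rM; split=> [E l lt|E].
    rewrite (muE _ _ lt) (_ : _ *m C = 0) ?mxE //.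
    by apply: (row_free_inj (row_base_free M)); rewrite mul0mx.
  rewrite (_ : _ *m col_base M = 0) ?mul0mx //; apply/rowP => l; rewrite [RHS]mxE.
  by rewrite -(E l (ltn_ord l)) (muE _ _ (ltn_ord l)); congr (_ 0 _); apply: val_inj.
pose g := roots_poly u c %/ f.
have fc : roots_poly u c = g * f by rewrite divpK // dvdp_roots_poly.
have g0 : g != 0 by apply: contraTneq (roots_poly_neq0 u c) => g0; rewrite fc g0 mul0r eqxx.
have sg : size g = (c - b).+1 by rewrite size_divp // size_roots_poly sf; move: bc; lia.
have smod (h : {poly K}) : (size (h %% g)%R <= c - b)%N by rewrite -ltnS -sg ltn_modp.
have mu_mod l (h : {poly K}) : (size h <= n)%N -> (l < t j - b)%N -> mu l h = mu l (h %% g).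
  move=> sh lt; rewrite {1}(divp_eq h g) -[X in X + _]scale1r mu_lin mul1r.
  have s1 : (size ((h %/ g) * g)%R <= n)%N.
    have -> : h %/ g * g = h - h %% g by rewrite {2}(divp_eq h g) addrK.
    rewrite (leq_trans (size_polyD _ _)) // geq_max sh size_polyN (leq_trans (smod h)) //.
    by rewrite leq_sub2r.
  rewrite (kerC _ s1).1 ?add0r // -mulrA -fc; apply: hc.
  by rewrite fc mulrA; apply: sizeM.
pose Z m l := mu l 'X^m.
have mu_sum l (h : {poly K}) : (size h <= c - b)%N -> mu l h = \sum_(m < c - b) h`_m * Z m l.
  move=> sh; rewrite {1}(poly_sumXn sh); elim/big_rec2: _ => [|m x y _ <-]; last exact: mu_lin.
  by have := mu_lin l (-1) 0 0; rewrite scaler0 addr0 mulN1r addNr.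
have modE (h : {poly K}) : (h * f) %% roots_poly u c %/ f = h %% g.
  rewrite {1}(divp_eq h g) mulrDl -mulrA -fc modp_addl_mul_small ?mulpK //.
  rewrite size_roots_poly (leq_ltn_trans (size_polyMleq _ _)) // sf.
  by have := smod h; move: (size _) bc => a; lia.
exists Z; split=> [p sp|tE].
  have main : f %| p -> in_ker phi j p <-> forall l, (l < t j - b)%N ->
      \sum_(m < c - b) ((p %% roots_poly u c) %/ f)`_m * Z m l = 0.
    move=> fp; have [sq e] := quot p sp fp; rewrite {1}e kerC // {2}e modE.
    by split=> h l lt; have := h l lt; rewrite mu_mod // mu_sum.
  split=> [hp|[fp]]; last by move/(main fp).
  by split; [exact: hV|apply/main => //; exact: hV].
apply: contrapT => no; have Z0 m : (m < c - b)%N -> Z m 0%N = 0.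
  by move=> mc; apply/eqP; apply: contrapT => /negP h; apply: no; exists m.
have r1 : \rank M = 1%N by rewrite rM tE subSnn.
have C0 : C = 0.
  apply/row_matrixP => k; rewrite row0 rowE; have -> : delta_mx 0 k = poly_rV 'X^k :> 'rV[K]_n.
    by apply/rowP => l; rewrite !mxE coefXn eqxx.
  apply/rowP => l; have l0 : (l < 1)%N by rewrite -r1.
  have -> : (poly_rV 'X^k *m C) 0 l = mu 0%N 'X^k.
    rewrite (muE 0%N _ (leq_ltn_trans (leq0n l) (ltn_ord l))).
    by congr (_ 0 _); apply: val_inj => /=; case: (nat_of_ord l) l0.
  rewrite mu_mod ?size_polyXn //; last by rewrite tE subSnn.
  by rewrite mu_sum // mxE big1 // => m _; rewrite Z0 ?mulr0.
by have := col_base_full M; rewrite /row_full -/C C0 mxrank0 r1.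
Qed.

End KernelStructure.

Section Dimensions.
Local Open Scope ring_scope.
Variables (K : closedFieldType) (charK0 : [pchar K]%R =i pred0) (T : seq nat).
Local Notation t := (nth 0%N T).
Local Notation family := (forall i, 'M[K]_(i.+1, t i)).
Hypotheses (T0 : 0%N \notin T) (t0 : t 0 != 0%N).
Hypothesis shape : forall i, (t i.+1 <= t i)%N \/ t i = i.+1.
Hypothesis tle : forall i, (t i <= i.+1)%N.

(** [flip] is an involution on kernels, so a description of the flipped ideal by [phi] describes the
    ideal itself by the flipped [phi]. *)
Lemma flip_cover x (psi phi : family) :
  (forall i (p : {poly K}), (size p <= i.+1)%N -> in_ker (flip x psi) i p <-> poly_rV p *m phi i = 0) ->
  forall i (p : {poly K}), (size p <= i.+1)%N ->
    poly_rV p *m psi i = 0 <-> poly_rV p *m flip x phi i = 0.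
Proof.
move=> h i p sp; set q := hform (flip1 x) (flip2 x) i p.
have sq : (size q <= i.+1)%N by apply: size_hform; rewrite ?size_flip1 ?size_flip2.
rewrite /flip subst_frameE // -/q -h // flip_ker // flipK //.
by split=> [|[]].
Qed.

Definition take_roots n (u : nat -> K) k := if (k < n)%N then u k else 0.

Lemma roots_poly_take n u k : (k <= n)%N -> roots_poly (take_roots n u) k = roots_poly u k.
Proof.
by move=> kn; apply: roots_poly_eq => m mk; rewrite /take_roots (leq_trans mk kn).
Qed.

Lemma std_frame_roots j b c (u : nat -> K) Z (psi : family) r (D : nat -> Prop) :
  hframe psi -> (forall i, D i -> (t i <= r)%N) ->
  (forall i (p : {poly K}), D i \/ t i = i.+1 ->
     in_ker psi i p <-> (size p <= i.+1)%N /\ roots_poly u (t i) %| p) ->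
  forall i (p : {poly K}), D i \/ t i = i.+1 -> i != j -> (size p <= i.+1)%N ->
   in_ker psi i p <-> poly_rV p *m std_frame T j b c (take_roots r u) Z i = 0.
Proof.
move=> hpsi rD hu i p Di ij sp; rewrite std_frame_ker //.
case: (Di) => [/rD tr|ti].
  by rewrite roots_poly_take // hu //; split=> [[]|].
split=> [h|h].
  by rewrite (in_ker_full hpsi ti h) dvdp0.
rewrite (roots_poly_dvd_small _ h) ?ti //.
by split; rewrite ?size_poly0 // raddf0 mul0mx.
Qed.

Section Tame.
Variables (d : nat).
Hypothesis td : (t d <= d)%N.
Hypothesis tame : forall i, (t i <= i)%N -> [/\ stable T i, (t i <= t d)%N & (d <= i)%N].

(** With no exceptional degree, an ideal in good position is the same as [t d] roots. The lower
    bound is [std_chain]; for the upper one, the flips of this one family by the integers up to [d]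
    cover everything. *)
Lemma tame_dim : dim_G_eq K T (t d).
Proof.
split.
  (* The exceptional degree of the standard family is placed at [size T], where it imposes no
     condition. *)
  have tS : t (size T) = 0%N by rewrite nth_default.
  have tSS : t (size T).+1 = 0%N by rewrite nth_default.
  have ri : (0 < t d)%N -> [/\ d != size T, t d = t d & (t d <= d)%N].
    by move=> td0; split=> //; apply: contraTneq td0 => ->; rewrite tS.
  exact: (@std_chain K charK0 T T0 t0 shape tle (size T) 0 0 0 (t d) d
    (leq0n _) (eq_leq tS) (leq0n _) (eq_leq tSS) (fun i _ => or_introl (leq0n _)) ri (leq0n _)).
pose uf (v : 'I_(t d) -> K) k : K := oapp v 0 (insub k).
pose fam (a : 'I_d.+1) v : family :=
  flip (nat_of_ord a)%:R (std_frame T (size T) 0 0 (uf v) (fun _ _ => 0)).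
apply: (G_krull_le charK0 T0 (phi := fam)) => [a i k l|psi hpsi].
  apply: polyfun_subst_frame; [exact: polycoef_cst|exact: polycoef_cst|].
  apply: polyfun_std_frame => [m|m l']; last exact: polyfun_cst.
  by rewrite /uf; case: insub => [x|]; [exact: polyfun_var|exact: polyfun_cst].
have [p hp p0] := in_ker_exists hpsi td; have [a pa] := horner_neq0_nat charK0 hp.1 p0.
have good := flip_ker_inv (nat_of_ord a)%:R hp.
have hpsi' := flip_hframe (nat_of_ord a)%:R hpsi.
have [u hu] := @exact_roots K T _ hpsi' (fun i => (t i <= i)%N) (fun i ti =>
   let: And3 st _ di := tame ti in And3 ti st (good_degree hpsi' good (size_flip hp.1 pa) di)).
exists a, (fun m : 'I_(t d) => u m); apply: flip_cover => i q sq.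
have Di : (t i <= i)%N \/ t i = i.+1.
  by case: (leqP (t i) i) => h; [left|right; apply/eqP; rewrite eqn_leq tle].
have ufE : uf (fun m : 'I_(t d) => u m) =1 take_roots (t d) u.
  by move=> k; rewrite /uf /take_roots; case: insubP => [m km <-|/negbTE ->]; rewrite ?km ?ltn_ord.
have [iT|iT] := eqVneq i (size T).
  split=> _.
    rewrite std_frame_ker_exceptional //; split=> [|l]; first by rewrite /roots_poly big_ord0 dvd1p.
    by rewrite nth_default.
  split=> //; apply/rowP => l; exfalso.
  by have := leq_trans (ltn_ord l) (eq_leq (etrans (congr1 t iT) (nth_default 0%N (leqnn _)))).
have -> : uf (fun m : 'I_(t d) => u m) = take_roots (t d) u by apply/funext.
apply: (@std_frame_roots _ _ _ _ _ _ _ (fun k => t k <= k)%N) => // k tk.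
by have [] := tame tk.
Qed.

End Tame.

Section Exceptional.
Variables (j c r d : nat).
Local Notation b := (t j.+1).
Hypotheses (tj : t j = b.+1) (bc : (b < c)%N) (cj : (c <= j.+1)%N) (br : (b <= r)%N).
Let D i := (t i <= i)%N /\ i != j.
Hypotheses (jS : (b <= j.+1)%N) (Dd : D d).
Hypothesis exc : forall i, D i -> [/\ stable T i, (t i <= r)%N & (d <= i)%N].
(** This puts the multiples of [f_c] of degree [j] into the ideal: either only 0 is one, or they
    come from degree [j - 1]. *)
Hypothesis cE : c = j.+1 \/ (0 < j)%N /\ t j.-1 = c /\ (c <= j.-1)%N.
Hypothesis ri0 : (0 < r)%N -> exists i0, [/\ i0 != j, t i0 = r & (r <= i0)%N].
Hypothesis jprev : forall i, i.+1 = j -> (c <= t i)%N \/ t i = i.+1.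

(* In the exceptional degree j the ideal consists of the multiples f_b q with mu(q) = 0
   for a functional mu vanishing on the multiples of f_c / f_b. *)
Lemma exceptional_kernel (psi : family) : hframe psi ->
  (exists2 g, in_ker psi d g & size g = d.+1) ->
  exists u (mu : nat -> K), (exists2 m, (m < c - b)%N & mu m != 0) /\
   (forall i (p : {poly K}), D i \/ t i = i.+1 ->
       in_ker psi i p <-> (size p <= i.+1)%N /\ roots_poly u (t i) %| p) /\
   (forall p : {poly K}, (size p <= j.+1)%N ->
      in_ker psi j p <-> roots_poly u b %| p /\
      \sum_(m < c - b) ((p %% roots_poly u c) %/ roots_poly u b)`_m * mu m = 0) /\
   (forall k, (r <= k)%N -> u k = 0).
Proof.
move=> hpsi [g hg sg].
have [u' hu'] := @exact_roots K T _ hpsi D (fun i Di =>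
   let: And3 st _ di := exc Di in And3 Di.1 st (good_degree hpsi hg sg di)).
pose u := take_roots r u'.
have hu i (p : {poly K}) : D i \/ t i = i.+1 ->
    in_ker psi i p <-> (size p <= i.+1)%N /\ roots_poly u (t i) %| p.
  case=> [Di|ti]; first by have [_ tr _] := exc Di; rewrite roots_poly_take // hu' //; left.
  split=> [h|[sp h]].
    by rewrite (in_ker_full hpsi ti h) dvdp0 size_poly0.
  rewrite (roots_poly_dvd_small _ h) ?ti //.
  by split; rewrite ?size_poly0 // raddf0 mul0mx.
have DS : D j.+1 by split; rewrite // gtn_eqF.
have hV (p : {poly K}) : in_ker psi j p -> roots_poly u b %| p.
  by move/(in_kerS hpsi); rewrite hu; [case|left].
have hc (h : {poly K}) : (size (h * roots_poly u c)%R <= j.+1)%N -> in_ker psi j (h * roots_poly u c).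
  have [->|h0] := eqVneq h 0; first by rewrite mul0r; split; rewrite ?size_poly0 // raddf0 mul0mx.
  rewrite size_Mmonic ?roots_poly_monic // size_roots_poly => sh.
  case: cE => [cj1|[j0 [tc c1]]].
    exfalso; move: h0; rewrite -size_poly_gt0; move: (size h) sh => s; lia.
  have Dj : D j.-1 by split; [rewrite tc|apply/eqP; lia].
  apply: (multiples_in_ker (n := (j.+1 - c)%N)); last by move: (size h) sh => s; lia.
    by rewrite size_roots_poly; lia.
  (* Each [X^k f_c] of degree [j] is [y] or [X] times such a product in degree [j - 1]. *)
  have base k : (k <= j.-1 - c)%N -> in_ker psi j.-1 ('X^k * roots_poly u c).
    move=> kc; apply/hu; first by left.
    rewrite tc dvdp_mull //; split=> //.
    by rewrite size_monicM ?monicXn ?roots_poly_neq0 // size_polyXn size_roots_poly; lia.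
  move=> k kc; rewrite -(prednK j0); case: (ltnP (j.-1 - c) k) => k1; last by apply: in_kerS => //; apply: base.
  have -> : k = (j.-1 - c).+1 by lia.
  by rewrite exprS -mulrA; apply: in_kerX => //; apply: base.
have bt : (b <= t j)%N by rewrite tj.
have [Z [hZ nZ]] := exceptional_structure hpsi bt (ltnW bc) cj hV hc.
exists u, (fun m => Z m 0%N); split; first exact: nZ.
split; first exact: hu.
split=> [p sp|k rk]; last by rewrite /u /take_roots ltnNge rk.
rewrite hZ // tj subSnn; split=> -[h1 h2]; split=> //; first exact: h2.
by case=> // _.
Qed.

(** The functional counts up to a scalar, as a point of a projective space of dimension [c - b - 1].
    [Zf] is the affine chart where the entry [y] is 1, so the covering is indexed by a flip and a
    chart. *)
Let n := (c - b).-1.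
Let vget (v : 'I_(n + r) -> K) m : K := oapp v 0 (insub m).
Let uf v k : K := if (k < r)%N then vget v (n + k) else 0.
Let Zf v (y m l : nat) : K := if m == y then 1 else vget v (unbump y m).
Let fam (a : 'I_d.+1 * 'I_(c - b)) v : family :=
  flip (nat_of_ord a.1)%:R (std_frame T j b c (uf v) (Zf v a.2)).

Let fam_poly a i k l : polyfun (fun v => fam a v i k l).
Proof.
have vget_poly m : polyfun (fun v => vget v m).
  by rewrite /vget; case: insub => [x|]; [exact: polyfun_var|exact: polyfun_cst].
apply: polyfun_subst_frame; [exact: polycoef_cst|exact: polycoef_cst|].
apply: polyfun_std_frame => [m|m l'].
  have [mr|mr] := boolP (m < r)%N.
    by apply: polyfun_ext (vget_poly (n + m)%N) => v; rewrite /uf mr.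
  by apply: (polyfun_ext _ (polyfun_cst _ 0)) => v; rewrite /uf (negbTE mr).
have [my|my] := boolP (m == a.2).
  by apply: (polyfun_ext _ (polyfun_cst _ 1)) => v; rewrite /Zf my.
by apply: polyfun_ext (vget_poly (unbump a.2 m)) => v; rewrite /Zf (negbTE my).
Qed.

Lemma exceptional_dim : dim_G_eq K T (n + r).
Proof.
have tc : (t j <= c)%N by rewrite tj.
have bt : (b <= t j)%N by rewrite tj.
have nE : (n <= (t j - b) * (c - t j))%N by rewrite tj subSnn mul1n /n; lia.
split.
  case: (posnP r) => [r0|/ri0 [i0 hi0]].
    by rewrite r0; apply: (@std_chain K charK0 T T0 t0 shape tle j b c n 0 0).
  by apply: (@std_chain K charK0 T T0 t0 shape tle j b c n r i0).
apply: (G_krull_le charK0 T0 (phi := fun a => fam (enum_val a))) => [a i k l|psi hpsi].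
  exact: fam_poly.
have [p hp p0] := in_ker_exists hpsi Dd.1; have [x px] := horner_neq0_nat charK0 hp.1 p0.
have good := flip_ker_inv (nat_of_ord x)%:R hp.
have hpsi' := flip_hframe (nat_of_ord x)%:R hpsi.
have [u [mu [[y yc my] [hu [hj u0]]]]] := exceptional_kernel hpsi' (ex_intro2 _ _ _ good (size_flip hp.1 px)).
pose v (i : 'I_(n + r)) : K := if (i < n)%N then mu (bump y i) / mu y else u (i - n)%N.
exists (enum_rank (x, Ordinal yc)), v; rewrite enum_rankK; apply: flip_cover => i q sq /=.
have ufE : uf v = u.
  apply/funext => k; rewrite /uf; case: ltnP => [kr|/u0 -> //].
  have h : (n + k < n + r)%N by rewrite ltn_add2l.
  by rewrite /vget insubT /= /v /= ltnNge leq_addr addKn.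
have ZfE m l : (m < c - b)%N -> Zf v y m l = mu m / mu y.
  move=> mc; rewrite /Zf; case: eqVneq => [->|my']; first by rewrite divff.
  have un : (unbump y m < n)%N by rewrite /unbump /n; move: my' mc yc; case: ltngtP => //; lia.
  have h : (unbump y m < n + r)%N by rewrite ltn_addr.
  by rewrite /vget insubT /= /v /= un unbumpK // inE.
rewrite ufE; have [ij|ij] := eqVneq i j; last first.
  have Di : D i \/ t i = i.+1.
    by case: (leqP (t i) i) => h; [left|right; apply/eqP; rewrite eqn_leq tle].
  by rewrite hu // std_frame_ker //; split=> [[]|].
subst i; rewrite hj // std_frame_ker_exceptional // tj subSnn.
have E l : \sum_(m < c - b) ((q %% roots_poly u c) %/ roots_poly u b)`_m * Zf v y m l =
    (\sum_(m < c - b) ((q %% roots_poly u c) %/ roots_poly u b)`_m * mu m) / mu y.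
  by rewrite mulr_suml; apply: eq_bigr => m _; rewrite ZfE // mulrA.
split=> -[h1 h2]; split=> //; first by move=> l _; rewrite E h2 mul0r.
have := h2 0%N isT; rewrite E => /eqP; rewrite mulf_eq0 invr_eq0 (negbTE my) orbF.
by move/eqP.
Qed.

End Exceptional.
End Dimensions.

(** * Normal forms *)

Section InverseSubstitution.
Local Open Scope ring_scope.
Variable K : closedFieldType.

Lemma hform_right_inverse (L1 L2 : {poly K}) : (size L1 <= 2)%N -> (size L2 <= 2)%N ->
  form_det L1 L2 != 0 -> exists M1 M2 : {poly K},
  [/\ (size M1 <= 2)%N, (size M2 <= 2)%N, form_det M1 M2 != 0 &
   forall i (p : {poly K}), (size p <= i.+1)%N -> hform L1 L2 i (hform M1 M2 i p) = p].
Proof.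
move=> s1 s2; set D := form_det L1 L2 => D0.
pose lin (x y : K) : {poly K} := x *: 'X + y%:P.
have slin x y : (size (lin x y) <= 2)%N.
  rewrite (leq_trans (size_polyD _ _)) // geq_max (leq_trans (size_scale_leq _ _)) ?size_polyX //=.
  by rewrite (leq_trans (size_polyC_leq1 _)).
have clin x y : ((lin x y)`_0 = y) * ((lin x y)`_1 = x).
  by rewrite !coefD !coefZ !coefC !coefX /= mulr0 mulr1 addr0 add0r.
set a := L1`_1; set b := L1`_0; set c := L2`_1; set d := L2`_0.
have DE : D = a * d - b * c by [].
exists (lin (d / D) (- b / D)), (lin (- c / D) (a / D)); split=> //.
  rewrite /form_det !clin (_ : _ - _ = D^-1) ?invr_eq0 //.
  by rewrite DE; field; rewrite -DE.
move=> i p sp; rewrite -hform_hform //; last exact: mulrC.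
have E (q : {poly K}) : hform L1 L2 1 q = q`_0 *: L2 + q`_1 *: L1.
  by rewrite /hform !big_ord_recr big_ord0 /= add0r !expr1 !expr0 mul1r mulr1.
rewrite !E !clin -[RHS](hform_X1 sp).
have e1 := linear_poly s1; have e2 := linear_poly s2.
have X1 : - b / D *: L2 + d / D *: L1 = 'X.
  apply/polyP => m; rewrite coefD !coefZ e1 e2 !coefD !coefZ !coefC !coefX -/a -/b -/c -/d.
  case: m => [|[|m]] /=; rewrite ?mulr0 ?mulr1 ?addr0 ?add0r ?mulr0 ?addr0 //.
    by rewrite DE; field; rewrite -DE.
  by rewrite DE; field; rewrite -DE.
have X2 : a / D *: L2 + - c / D *: L1 = 1.
  apply/polyP => m; rewrite coefD !coefZ e1 e2 !coefD !coefZ !coefC !coefX ?coef1 -/a -/b -/c -/d.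
  case: m => [|[|m]] /=; rewrite ?mulr0 ?mulr1 ?addr0 ?add0r ?mulr0 ?addr0 //.
    by rewrite DE; field; rewrite -DE.
  by rewrite DE; field; rewrite -DE.
by rewrite X1 X2.
Qed.

Lemma hform_inverse (L1 L2 : {poly K}) : (size L1 <= 2)%N -> (size L2 <= 2)%N ->
  form_det L1 L2 != 0 -> exists M1 M2 : {poly K}, [/\ (size M1 <= 2)%N, (size M2 <= 2)%N &
   forall i (p : {poly K}), (size p <= i.+1)%N -> hform M1 M2 i (hform L1 L2 i p) = p].
Proof.
move=> s1 s2 D0; have [M1 [M2 [t1 t2 E0 h]]] := hform_right_inverse s1 s2 D0.
(* A right inverse of the right inverse must be the original substitution, so the inverse is
   two-sided. *)
have [N1 [N2 [r1 r2 _ h']]] := hform_right_inverse t1 t2 E0.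
exists M1, M2; split=> // i p sp; rewrite -{1}(h' i p sp) h ?h' //.
exact: size_hform.
Qed.

Lemma hform_dvd (L1 L2 : {poly K}) i k (f p : {poly K}) : (k <= i)%N -> size f = k.+1 ->
  (size p <= i.+1)%N -> f %| p -> hform L1 L2 k f %| hform L1 L2 i p.
Proof.
move=> ki sf sp fp; have f0 : f != 0 by rewrite -size_poly_gt0 sf.
rewrite -(divpK fp) -(subnK ki) hformM ?dvdp_mull // ?sf //; first exact: mulrC.
rewrite size_divp // sf /=; move: (size p) sp => s; lia.
Qed.

Section MovingRoots.
Variables (L1 L2 : {poly K}).
Hypotheses (s1 : (size L1 <= 2)%N) (s2 : (size L2 <= 2)%N).
Variables (u w : nat -> K) (s : nat).
(** The Moebius map [L1 / L2] takes the value [w m] at the point [u m]. *)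
Hypothesis uw : forall m, (m < s)%N -> exists2 c, c != 0 & L1 - w m *: L2 = c *: ('X - (u m)%:P).

Lemma hform_roots k : (k <= s)%N ->
  exists2 c, c != 0 & hform L1 L2 k (roots_poly w k) = c *: roots_poly u k.
Proof.
elim: k => [|k IH] ks.
  exists 1; first exact: oner_neq0.
  by rewrite /roots_poly !big_ord0 hform1 scale1r.
have [c c0 e] := IH (ltnW ks); have [x x0 ex] := uw ks.
exists (c * x); first by rewrite mulf_neq0.
rewrite !roots_polyS -addn1 hformM ?size_roots_poly ?size_XsubC //; last exact: mulrC.
have -> : hform L1 L2 1 ('X - (w k)%:P) = L1 - w k *: L2.
  rewrite /hform !big_ord_recr big_ord0 /= add0r !coefB !coefX !coefC /= !expr1 !expr0.
  by rewrite mul1r mulr1 sub0r subr0 scale1r scaleNr addrC.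
by rewrite e ex -scalerAl -scalerAr scalerA.
Qed.

Hypothesis D0 : form_det L1 L2 != 0.

Lemma hform_roots_dvd i k (p : {poly K}) : (k <= s)%N -> (k <= i)%N -> (size p <= i.+1)%N ->
  roots_poly u k %| hform L1 L2 i p <-> roots_poly w k %| p.
Proof.
move=> ks ki sp; have [c c0 e] := hform_roots ks; split=> [h|h]; last first.
  by have := hform_dvd L1 L2 ki (size_roots_poly w k) sp h; rewrite e dvdpZl.
have [M1 [M2 [r1 r2 inv]]] := hform_inverse s1 s2 D0.
have := hform_dvd M1 M2 ki (size_roots_poly u k) (size_hform i p s1 s2) h.
rewrite inv // -[roots_poly u k](scalerK c0) -e linearZ /= inv ?size_roots_poly //.
by rewrite dvdpZl // invr_eq0.
Qed.

End MovingRoots.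
End InverseSubstitution.

Section PresentedAlgebras.
Local Open Scope ring_scope.
Variables (K : closedFieldType) (T : seq nat).
Local Notation t := (nth 0%N T).
Local Notation family := (forall i, 'M[K]_(i.+1, t i)).
Implicit Types W : nat -> {poly K} -> Prop.
Hypothesis T0 : 0%N \notin T.

(** [W] describes the forms of the ideal degree by degree. It determines the algebra up to
    isomorphism, so finite type follows as soon as finitely many [W] suffice. *)
Definition presented (R : falgType K) W := exists psi : family,
  [/\ hframe psi, presents R psi & forall i (p : {poly K}), (size p <= i.+1)%N ->
    poly_rV p *m psi i = 0 <-> W i p].

Lemma presented_iso (R S : falgType K) W : presented R W -> presented S W -> alg_isomorphic R S.
Proof.
move=> [psi [h1 p1 k1]] [psi' [h2 p2 k2]]; apply: (presents_iso p1 p2).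
have [_ ->] := same_ker_hframe T0 h1 (fun i p sp => iff_trans (k1 i p sp) (iff_sym (k2 i p sp))).
by [].
Qed.

Lemma presented_ext (R : falgType K) W W' : presented R W ->
  (forall i (p : {poly K}), (size p <= i.+1)%N -> W i p <-> W' i p) -> presented R W'.
Proof.
move=> [psi [h1 p1 k1]] e; exists psi; split=> // i p sp.
by apply: iff_trans (k1 i p sp) (e i p sp).
Qed.

Lemma presented_subst (R : falgType K) W (L1 L2 : {poly K}) : (size L1 <= 2)%N -> (size L2 <= 2)%N ->
  form_det L1 L2 != 0 -> presented R W -> presented R (fun i p => W i (hform L1 L2 i p)).
Proof.
move=> s1 s2 D0 [psi [h1 p1 k1]]; exists (subst_frame L1 L2 psi).
split; [exact: subst_frame_hframe|exact: presents_subst|move=> i p sp].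
by rewrite subst_frameE // k1 //; apply: size_hform.
Qed.

Lemma presented_finite_type (I : finType) (W : I -> nat -> {poly K} -> Prop) :
  (forall R : falgType K, standard_graded R -> has_HilbertSamuel R T -> exists a, presented R (W a)) ->
  homogeneous_finite_type K T.
Proof.
(* [R0] is the default for predicates that present no algebra; if no graded algebra has this
   sequence at all, the empty list works. *)
move=> h; have [[R0 _]|no] := pselect (exists R : falgType K, standard_graded R /\ has_HilbertSamuel R T); last first.
  exists 0%N, (fun x : 'I_0 => match x with Ordinal m h => match Bool.diff_false_true h with end end).
  by move=> R s hs; case: no; exists R.
have ex a : exists S : falgType K, forall R, presented R (W a) -> alg_isomorphic R S.
  have [[S hS]|none] := pselect (exists S, presented S (W a)).
    by exists S => R hR; apply: presented_iso hR hS.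
  by exists R0 => R hR; case: none; exists R.
exists #|I|, (fun k => projT1 (cid (ex (enum_val k)))) => R sR hR.
have [a ha] := h R sR hR; exists (enum_rank a).
by apply: (projT2 (cid (ex _))); rewrite enum_rankK.
Qed.

End PresentedAlgebras.

Section TameFinite.
Local Open Scope ring_scope.
Variables (K : closedFieldType) (charK0 : [pchar K]%R =i pred0) (T : seq nat).
Local Notation t := (nth 0%N T).

Lemma fresh_scalar (s : seq K) : exists x, x \notin s.
Proof.
pose p := \prod_(a <- s) ('X - a%:P).
have p0 : p != 0 by apply: monic_neq0; apply: monic_prod => a _; apply: monicXsubC.
have [c hc] := horner_neq0_nat charK0 (leqnSn (size p)) p0; exists c%:R.
by move: hc; rewrite -[_ != 0]/(~~ root p _) root_prod_XsubC.
Qed.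

(** The first three roots may coincide. They are completed by fresh scalars to three distinct
    points, and [e] records the pattern of coincidences. *)
Lemma distinct_values (u : nat -> K) : exists (v : nat -> K) (e : {ffun 'I_3 -> 'I_3}),
  [/\ v 0 != v 1, v 0 != v 2, v 1 != v 2 & forall m : 'I_3, u m = v (e m)]%N.
Proof.
pose pk x y z : nat -> K := fun m => [:: x; y; z]`_m.
pose pe (x y z : nat) : {ffun 'I_3 -> 'I_3} := [ffun m : 'I_3 => inord (nth 0%N [:: x; y; z] m)].
have ord3 (P : 'I_3 -> Prop) : P ord0 -> P (inord 1) -> P (inord 2) -> forall m, P m.
  move=> h0 h1 h2 [[|[|[|m]]] lt] //.
  - by rewrite (_ : Ordinal lt = ord0) //; apply: val_inj.
  - by rewrite (_ : Ordinal lt = inord 1) //; apply: val_inj; rewrite /= inordK.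
  - by rewrite (_ : Ordinal lt = inord 2) //; apply: val_inj; rewrite /= inordK.
have [f hf] := fresh_scalar [:: u 0%N; u 1%N; u 2%N].
have [g hg] := fresh_scalar [:: f; u 0%N; u 1%N; u 2%N].
move: hf hg; rewrite !inE !negb_or => /and3P[f0 f1 f2] /and4P[gf g0 g1 g2].
have [e01|n01] := eqVneq (u 0%N) (u 1%N).
  have [e02|n02] := eqVneq (u 0%N) (u 2%N).
    exists (pk (u 0%N) f g), (pe 0 0 0)%N; rewrite /pk /=.
    by split; rewrite 1?eq_sym //; apply: ord3; rewrite !ffunE !inordK //= ?inordK.
  exists (pk (u 0%N) (u 2%N) f), (pe 0 0 1)%N; rewrite /pk /=.
  by split; rewrite 1?eq_sym //; [rewrite eq_sym|apply: ord3; rewrite !ffunE !inordK //= ?inordK].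
have [e02|n02] := eqVneq (u 0%N) (u 2%N).
  exists (pk (u 0%N) (u 1%N) f), (pe 0 1 0)%N; rewrite /pk /=.
  by split; rewrite // 1?eq_sym //; apply: ord3; rewrite !ffunE !inordK //= ?inordK.
have [e12|n12] := eqVneq (u 1%N) (u 2%N).
  exists (pk (u 0%N) (u 1%N) f), (pe 0 1 1)%N; rewrite /pk /=.
  by split; rewrite // 1?eq_sym //; apply: ord3; rewrite !ffunE !inordK //= ?inordK.
exists u, (pe 0 1 2)%N; split=> //.
by apply: ord3; rewrite !ffunE !inordK //= ?inordK.
Qed.

(** Transitivity of [PGL_2] on triples of distinct points, with target 0, 1, 2; these are distinct
    in characteristic 0. *)
Lemma three_points (v : nat -> K) : v 0%N != v 1%N -> v 0%N != v 2%N -> v 1%N != v 2%N ->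
  exists L1 L2 : {poly K}, [/\ (size L1 <= 2)%N, (size L2 <= 2)%N, form_det L1 L2 != 0 &
    forall k, (k < 3)%N -> exists2 c, c != 0 & L1 - k%:R *: L2 = c *: ('X - (v k)%:P)].
Proof.
move=> n01 n02 n12; have two : 2%:R != 0 :> K by have /pcharf0P -> := charK0.
(* [L1] vanishes at [v 0] and [M = L1 - L2] at [v 1]; the two scalars are such that
   [L1 - 2 L2 = 2 M - L1] vanishes at [v 2]. *)
pose L1 := (2%:R * (v 1%N - v 2%N)) *: ('X - (v 0%N)%:P).
pose M := (v 0%N - v 2%N) *: ('X - (v 1%N)%:P).
have sz c x : (size (c *: ('X - x%:P))%R <= 2)%N.
  by rewrite (leq_trans (size_scale_leq _ _)) // size_XsubC.
exists L1, (L1 - M); split.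
- exact: sz.
- by rewrite (leq_trans (size_polyD _ _)) // size_polyN geq_max !sz.
- rewrite /form_det /L1 /M !coefB !coefZ !coefB !coefX !coefC /=.
  rewrite (_ : _ - _ = 2%:R * (v 1%N - v 2%N) * (v 0%N - v 2%N) * (v 1%N - v 0%N)); last by ring.
  by rewrite !mulf_neq0 // subr_eq0 // eq_sym.
case=> [|[|[|k]]] // _.
- exists (2%:R * (v 1%N - v 2%N)); first by rewrite mulf_neq0 // subr_eq0.
  by rewrite scale0r subr0.
- exists (v 0%N - v 2%N); first by rewrite subr_eq0.
  by rewrite scale1r opprB addrC subrK.
exists (2%:R * (v 0%N - v 1%N)); first by rewrite mulf_neq0 // subr_eq0.
by rewrite /L1 /M -!mul_polyC !polyCM !polyCB !polyC_natr; ring.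
Qed.

Variable d : nat.
Hypotheses (T0 : 0%N \notin T) (t1 : t 1 = 2%N) (td : (t d <= d)%N) (td3 : (t d <= 3)%N).
Hypothesis tle : forall i, (t i <= i.+1)%N.
Hypothesis tame : forall i, (t i <= i)%N -> [/\ stable T i, (t i <= t d)%N & (d <= i)%N].

Let normal (e : {ffun 'I_3 -> 'I_3}) k : K := oapp (fun m => (e m : nat)%:R) 0 (insub k).

(** The normal forms are indexed by the maps from ['I_3] to itself: each of the at most three roots
    is moved to 0, 1 or 2. *)
Lemma tame_finite_type : homogeneous_finite_type K T.
Proof.
apply: (presented_finite_type T0 (W := fun e i p => roots_poly (normal e) (t i) %| p)) => R sR hR.
have [psi hpsi pres] := standard_graded_presents sR hR t1.
have [p hp p0] := in_ker_exists hpsi td; have [x px] := horner_neq0_nat charK0 hp.1 p0.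
have good := flip_ker_inv (nat_of_ord x)%:R hp.
have hpsi' := flip_hframe (nat_of_ord x)%:R hpsi.
have [u hu] := @exact_roots K T _ hpsi' (fun i => (t i <= i)%N) (fun i ti =>
   let: And3 st _ di := tame ti in And3 ti st (good_degree hpsi' good (size_flip hp.1 px) di)).
have pu : presented T R (fun i p => roots_poly u (t i) %| p).
  exists (flip (nat_of_ord x)%:R psi); split=> //.
    by apply: presents_subst; rewrite ?size_flip1 ?size_flip2 ?flip_det.
  move=> i q sq; have Di : (t i <= i)%N \/ t i = i.+1.
    by case: (leqP (t i) i) => h; [left|right; apply/eqP; rewrite eqn_leq tle].
  have [h1 h2] := hu i q Di; split=> [e|e]; first by have [] := h1 (conj sq e).
  by have [] := h2 (conj sq e).
have [v [e [n01 n02 n12 ue]]] := distinct_values u.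
have [L1 [L2 [s1 s2 D0 hL]]] := three_points n01 n02 n12.
exists e; apply: presented_ext (presented_subst s1 s2 D0 pu) _ => i q sq.
have sh := size_hform i q s1 s2.
have uw m : (m < 3)%N -> exists2 c, c != 0 & L1 - normal e m *: L2 = c *: ('X - (u m)%:P).
  move=> m3; rewrite /normal insubT /= -[in u m]/(nat_of_ord (Ordinal m3)) ue.
  exact: hL.
case: (leqP (t i) i) => ti.
  have [_ tid _] := tame ti; apply: (hform_roots_dvd s1 s2 uw D0) => //.
  exact: leq_trans td3.
have e1 : t i = i.+1 by apply/eqP; rewrite eqn_leq tle.
rewrite e1; split=> h.
  have [M1 [M2 [r1 r2 inv]]] := hform_inverse s1 s2 D0.
  by rewrite -(inv i q sq) (roots_poly_dvd_small sh h) linear0 dvdp0.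
by rewrite (roots_poly_dvd_small sq h) linear0 dvdp0.
Qed.

End TameFinite.

(** * Normal forms with one exceptional degree *)

Section ExceptionalFinite.
Local Open Scope ring_scope.
Variables (K : closedFieldType) (charK0 : [pchar K]%R =i pred0) (T : seq nat) (j : nat).
Local Notation t := (nth 0%N T).
Local Notation family := (forall i, 'M[K]_(i.+1, t i)).
Hypothesis T0 : 0%N \notin T.
Hypothesis tle : forall i, (t i <= i.+1)%N.
Local Notation b := (t j.+1).
Hypotheses (tj : t j = b.+1) (bj : (b < j)%N).
Hypothesis tD : forall i, (t i <= i)%N -> i != j -> (t i <= b.+2)%N.
Implicit Types (u w : nat -> K) (mu : {poly K} -> Prop).

Definition exc_pred u mu i (p : {poly K}) : Prop :=
  if i == j then roots_poly u b %| p /\ mu (p %/ roots_poly u b)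
  else roots_poly u (t i) %| p.

(* In all cases b <= 1: the root of f_1 is also a root of the quadratic form
   annihilated by the functional of degree j. *)
Definition two_roots (a0 a1 : K) m : K := if (m <= b)%N then a0 else a1.

(** Besides moving the roots, a substitution transports the condition in degree [j]: the quotient of
    the substituted form by [f_b] is the substituted quotient up to a scalar, whence the hypothesis
    on [mu]. *)
Lemma exc_pred_subst (R : falgType K) u w mu mu' (L1 L2 : {poly K}) :
  (size L1 <= 2)%N -> (size L2 <= 2)%N -> form_det L1 L2 != 0 ->
  (forall m, (m < b.+2)%N -> exists2 c, c != 0 & L1 - w m *: L2 = c *: ('X - (u m)%:P)) ->
  (forall (c : K) (h : {poly K}), c != 0 -> (size h <= (j - b).+1)%N ->
     mu (c *: hform L1 L2 (j - b) h) <-> mu' h) ->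
  presented T R (exc_pred u mu) -> presented T R (exc_pred w mu').
Proof.
move=> s1 s2 D0 uw hmu pu; apply: presented_ext (presented_subst s1 s2 D0 pu) _ => i q sq.
have sh := size_hform i q s1 s2; rewrite /exc_pred.
case: eqVneq => [ij|ij]; last first.
  case: (leqP (t i) i) => ti.
    by apply: (hform_roots_dvd s1 s2 uw D0) => //; apply: tD.
  have e1 : t i = i.+1 by apply/eqP; rewrite eqn_leq tle.
  rewrite e1; split=> h.
    have [M1 [M2 [r1 r2 inv]]] := hform_inverse s1 s2 D0.
    by rewrite -(inv i q sq) (roots_poly_dvd_small sh h) linear0 dvdp0.
  by rewrite (roots_poly_dvd_small sq h) linear0 dvdp0.
subst i; have bb : (b <= b.+2)%N by rewrite leqW.
have [c c0 e] := hform_roots uw bb.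
have dv := hform_roots_dvd s1 s2 uw D0 bb (ltnW bj) sq.
have main : roots_poly w b %| q ->
    mu (hform L1 L2 j q %/ roots_poly u b) <-> mu' (q %/ roots_poly w b).
  move=> wq; set h := q %/ _.
  have sh' : (size h <= (j - b).+1)%N.
    rewrite size_divp ?roots_poly_neq0 // size_roots_poly /=.
    by have := bj; move: (size q) sq => s; lia.
  have -> : hform L1 L2 j q = (c *: hform L1 L2 (j - b) h) * roots_poly u b.
    rewrite -{1}(divpK wq) -/h -{1}(subnK (ltnW bj)) hformM ?size_roots_poly //; last exact: mulrC.
    by rewrite e -scalerAl scalerAr.
  by rewrite mulpK ?roots_poly_neq0 //; apply: hmu.
by split=> -[h1 h2]; have h3 := h1; move/dv: h3 => h3; split=> //; apply/main => //; apply/dv.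
Qed.

(** These are the functionals modulo a quadratic polynomial: combinations of the values at two
    distinct roots or, for a double root, of value and derivative. *)
Definition value_pred (a0 a1 x y : K) (h : {poly K}) : Prop := x * h.[a0] + y * h.[a1] = 0.
Definition jet_pred (a x y : K) (h : {poly K}) : Prop := x * h.[a] + y * h^`().[a] = 0.

Lemma horner_hform (L1 L2 : {poly K}) k (h : {poly K}) x :
  (hform L1 L2 k h).[x] = \sum_(m < k.+1) h`_m * (L1.[x] ^+ m * L2.[x] ^+ (k - m)).
Proof.
rewrite /hform horner_sum; apply: eq_bigr => m _.
by rewrite hornerZ hornerM !horner_exp.
Qed.

Lemma horner_hform0 (L1 L2 : {poly K}) k (h : {poly K}) x : L1.[x] = 0 ->
  (hform L1 L2 k h).[x] = L2.[x] ^+ k * h.[0].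
Proof.
move=> e; rewrite horner_hform big_ord_recl e expr0 mul1r subn0 big1 ?addr0.
  by rewrite horner_coef0 mulrC.
by move=> m _; rewrite expr0n /= mul0r mulr0.
Qed.

Lemma horner_hform1 (L1 L2 : {poly K}) k (h : {poly K}) x : (size h <= k.+1)%N -> L1.[x] = L2.[x] ->
  (hform L1 L2 k h).[x] = L1.[x] ^+ k * h.[1].
Proof.
move=> sh e; rewrite horner_hform (horner_coef_wide _ sh) mulr_sumr; apply: eq_bigr => m _.
by rewrite -e -exprD subnKC -1?ltnS // expr1n mulr1 mulrC.
Qed.

Lemma deriv_hform0 (L1 L2 : {poly K}) k (h : {poly K}) x : L1.[x] = 0 -> L2.[x] = 1 ->
  (hform L1 L2 k.+1 h)^`().[x] = h`_0 * (k.+1%:R * L2^`().[x]) + h`_1 * L1^`().[x].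
Proof.
move=> e1 e2.
have dE m n : (L1 ^+ m * L2 ^+ n)^`().[x] = L1^`().[x] * (0 ^+ m.-1 *+ m) + 0 ^+ m * (L2^`().[x] *+ n).
  rewrite derivM !deriv_exp hornerD !hornerM !hornerMn !hornerM !horner_exp e1 e2 !expr1n !mulr1.
  by rewrite !mulrnAr.
rewrite /hform raddf_sum horner_sum !big_ord_recl /= big1 => [|m _].
  rewrite !derivZ !hornerZ !dE /bump /= addr0 !expr0 !expr1 mulr0n !mulr0 !add0r mul0r addr0 mulr1n.
  by rewrite mul1r mulr1 subn0 mulr_natl.
by rewrite derivZ hornerZ dE /bump /= !exprS !mul0r addr0 mul0rn mulr0 mulr0.
Qed.

Lemma exists_root (a : K) k : (0 < k)%N -> a != 0 -> exists2 x, x != 0 & x ^+ k = a.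
Proof.
move=> k0 a0; have s : size ('X^k - a%:P) != 1%N by rewrite size_XnsubC // eqSS -lt0n.
have [x] := closed_rootP _ s; rewrite rootE !hornerE subr_eq0 => /eqP e; exists x => //.
by apply: contraNneq a0 => x0; rewrite -e x0 expr0n gtn_eqF.
Qed.

Lemma two_rootsP (a0 a1 w0 w1 : K) (L1 L2 : {poly K}) :
  (exists2 c, c != 0 & L1 - w0 *: L2 = c *: ('X - a0%:P)) ->
  (exists2 c, c != 0 & L1 - w1 *: L2 = c *: ('X - a1%:P)) ->
  forall m, (m < b.+2)%N -> exists2 c, c != 0 &
    L1 - two_roots w0 w1 m *: L2 = c *: ('X - (two_roots a0 a1 m)%:P).
Proof. by move=> h0 h1 m _; rewrite /two_roots; case: ifP. Qed.

Let scale_XsubC (c x : K) : (size (c *: ('X - x%:P))%R <= 2)%N.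
Proof. by rewrite (leq_trans (size_scale_leq _ _)) // size_XsubC. Qed.

Lemma value_normal_form (R : falgType K) (a0 a1 x y : K) : a0 != a1 ->
  presented T R (exc_pred (two_roots a0 a1) (value_pred a0 a1 x y)) ->
  presented T R (exc_pred (two_roots 0 1) (value_pred 0 1 (x != 0)%:R (y != 0)%:R)).
Proof.
move=> a01; have k0 : (0 < j - b)%N by rewrite subn_gt0.
(* The torus fixing both points scales the two values independently by [j - b]-th powers, and roots
   exist in [K], so each nonzero coefficient can be made 1. *)
have norm (z : K) : exists2 r : K, r != 0 & z * r ^+ (j - b) = (z != 0)%:R.
  have [->|z0] := eqVneq z 0; first by exists 1; [exact: oner_neq0|rewrite mul0r].
  have [||r r0 e] := @exists_root z^-1 (j - b) => //; first by rewrite invr_eq0.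
  by exists r => //; rewrite e divff.
have [r0 r00 e0] := norm x; have [r1 r10 e1] := norm y.
have da : a1 - a0 != 0 by rewrite subr_eq0 eq_sym.
pose c0 := r1 / (a1 - a0); pose c1 := r0 / (a1 - a0).
have c00 : c0 != 0 by rewrite mulf_neq0 // invr_eq0.
have c10 : c1 != 0 by rewrite mulf_neq0 // invr_eq0.
pose L1 := c0 *: ('X - a0%:P); pose M := c1 *: ('X - a1%:P).
apply: (exc_pred_subst (L1 := L1) (L2 := L1 - M)).
- exact: scale_XsubC.
- by rewrite (leq_trans (size_polyD _ _)) // size_polyN geq_max !scale_XsubC.
- rewrite /form_det /L1 /M !coefB !coefZ !coefB !coefX !coefC /=.
  rewrite (_ : _ - _ = c0 * c1 * (a1 - a0)); last by ring.
  by apply: mulf_neq0 da; apply: mulf_neq0.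
- apply: two_rootsP; first by exists c0; rewrite // scale0r subr0.
  by exists c1; rewrite // scale1r opprB addrC subrK.
move=> c h cn0 sh; rewrite /value_pred !hornerZ.
rewrite horner_hform0; last by rewrite /L1 !hornerE subrr mulr0.
rewrite horner_hform1 //; last by rewrite /M !hornerE subrr mulr0 oppr0 addr0.
have -> : (L1 - M).[a0] = r0 by rewrite /L1 /M !hornerE subrr mulr0 /c1; field.
have -> : L1.[a1] = r1 by rewrite /L1 !hornerE /c0; field.
have -> : x * (c * (r0 ^+ (j - b) * h.[0])) + y * (c * (r1 ^+ (j - b) * h.[1])) =
   c * ((x != 0)%:R * h.[0] + (y != 0)%:R * h.[1]).
  by rewrite -e0 -e1; ring.
split=> [/eqP|->]; last by rewrite mulr0.
by rewrite mulf_eq0 (negbTE cn0) => /eqP.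
Qed.

(* Substituting y + f x for y adds (j - b) f times the value to the derivative, which
   needs characteristic 0. *)
Lemma jet_normal_form (R : falgType K) (a x y : K) : (x != 0) || (y != 0) ->
  presented T R (exc_pred (two_roots a a) (jet_pred a x y)) ->
  exists e : bool, presented T R (exc_pred (two_roots 0 0) (jet_pred 0 (~~ e)%:R e%:R)).
Proof.
move=> xy; have [k ek] : exists k, (j - b = k.+1)%N by exists (j - b).-1; lia.
have kn : k.+1%:R != 0 :> K by have /pcharf0P -> := charK0.
(* Chosen so that [x + y (j - b) f], the new coefficient of the value, is zero when [y] is not. *)
pose f := if y == 0 then 0 else - x / (y * k.+1%:R).
pose L1 := 'X - a%:P; pose L2 := f *: L1 + 1.
have e1 : L1.[a] = 0 by rewrite /L1 !hornerE subrr.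
have e2 : L2.[a] = 1 by rewrite /L2 hornerD hornerZ e1 mulr0 add0r hornerC.
have d1 : L1^`().[a] = 1 by rewrite /L1 derivB derivX derivC subr0 hornerC.
have d2 : L2^`().[a] = f by rewrite /L2 derivD derivZ !hornerE derivC hornerC d1 mulr1 addr0.
move=> pr; exists (y != 0); apply: (exc_pred_subst (L1 := L1) (L2 := L2)) pr.
- by rewrite size_XsubC.
- rewrite (leq_trans (size_polyD _ _)) // geq_max size_poly1 andbT.
  by rewrite (leq_trans (size_scale_leq _ _)) // size_XsubC.
- rewrite /form_det /L2 /L1 !coefD !coefZ !coefB ?coefN !coefX !coefC ?coef1 /=.
  by rewrite (_ : _ - _ = 1) ?oner_eq0 //; ring.
- by apply: two_rootsP; (exists 1; first exact: oner_neq0); rewrite scale0r subr0 scale1r.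
move=> c h c0 sh; rewrite /jet_pred derivZ !hornerZ ek horner_hform0 // deriv_hform0 //.
rewrite e2 d1 d2 expr1n mul1r mulr1 horner_coef0 -[h^`().[0]]/(_) horner_coef0 coef_deriv mulr1n.
have -> : x * (c * h`_0) + y * (c * (h`_0 * (k.+1%:R * f) + h`_1)) =
   c * ((x + y * k.+1%:R * f) * h`_0 + y * h`_1) by ring.
rewrite negbK /f; have [y0|y0] := eqVneq y 0.
  have x0 : x != 0 by move: xy; rewrite y0 eqxx orbF.
  rewrite y0 mulr0 addr0 !mul0r !addr0 mul1r; split=> [/eqP|->]; last by rewrite !mulr0.
  by rewrite !mulf_eq0 (negbTE c0) (negbTE x0) => /eqP.
have -> : x + y * k.+1%:R * (- x / (y * k.+1%:R)) = 0 by move: (k.+1%:R : K) kn => n kn; field; rewrite y0 kn.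
rewrite !mul0r !add0r mul1r; split=> [/eqP|->]; last by rewrite !mulr0.
by rewrite !mulf_eq0 (negbTE c0) (negbTE y0) => /eqP.
Qed.

Lemma modp_mul_divp (g f h : {poly K}) : f != 0 -> g != 0 -> (h * f) %% (g * f) %/ f = h %% g.
Proof.
move=> f0 g0; rewrite {1}(divp_eq h g) mulrDl -mulrA modp_addl_mul_small ?mulpK //.
have [->|m0] := eqVneq (h %% g) 0; first by rewrite mul0r size_poly0 size_poly_gt0 mulf_neq0.
have := ltn_modp h g; rewrite g0 !size_mul //.
have : (0 < size f)%N by rewrite size_poly_gt0.
by move: (size _) (size _) (size _) => A B C; lia.
Qed.

(** The functional found by [exceptional_structure] is known on the basis [1], [X] modulo the
    quadratic [g]; here it is rewritten in values or jets at the roots of [g]. *)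
Lemma exceptional_presented (R : falgType K) (psi : family) (a0 a1 : K) :
  hframe psi -> presents R psi ->
  (forall i (p : {poly K}), (t i <= i)%N -> i != j ->
     in_ker psi i p <-> (size p <= i.+1)%N /\ roots_poly (two_roots a0 a1) (t i) %| p) ->
  (forall h : {poly K}, (size (h * roots_poly (two_roots a0 a1) b.+2)%R <= j.+1)%N ->
     in_ker psi j (h * roots_poly (two_roots a0 a1) b.+2)) ->
  exists x y, (x != 0) || (y != 0) /\ presented T R (exc_pred (two_roots a0 a1)
    (if a0 == a1 then jet_pred a0 x y else value_pred a0 a1 x y)).
Proof.
move=> hpsi pres hD hc; set u := two_roots a0 a1 in hD hc *.
have bt : (b <= t j)%N by rewrite tj.
have hV (p : {poly K}) : in_ker psi j p -> roots_poly u b %| p.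
  by move/(in_kerS hpsi); rewrite hD ?gtn_eqF ?(leqW (ltnW bj)) // => -[].
have [Z [hZ nZ]] := exceptional_structure hpsi bt (leqW (leqnSn b)) (bj : b.+2 <= j.+1)%N hV hc.
have [m m2 zm] := nZ tj.
pose g := ('X - a0%:P) * ('X - a1%:P); pose z0 := Z 0%N 0%N; pose z1 := Z 1%N 0%N.
have ub : u b = a0 by rewrite /u /two_roots leqnn.
have uSb : u b.+1 = a1 by rewrite /u /two_roots ltnn.
have cb : (b.+2 - b = 2)%N by lia.
have zz : (z0 != 0) || (z1 != 0).
  by move: m2 zm; rewrite cb; case: m => [|[]] // _ -> //; rewrite orbT.
have fg : roots_poly u b.+2 = g * roots_poly u b by rewrite !roots_polyS ub uSb /g -mulrA mulrC.
have g0 : g != 0 by rewrite mulf_neq0 // monic_neq0 // monicXsubC.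
have sg : size g = 3%N by rewrite size_mul ?polyXsubC_eq0 // !size_XsubC.
have hK (h : {poly K}) : (size (h * roots_poly u b)%R <= j.+1)%N ->
    in_ker psi j (h * roots_poly u b) <-> z0 * (h %% g)`_0 + z1 * (h %% g)`_1 = 0.
  move=> sh; rewrite hZ // fg modp_mul_divp ?roots_poly_neq0 // cb tj subSnn.
  have E : \sum_(m < 2) (h %% g)`_m * Z m 0%N = z0 * (h %% g)`_0 + z1 * (h %% g)`_1.
    by rewrite !big_ord_recr big_ord0 /= add0r ![_ * Z _ _]mulrC.
  rewrite -E; split=> [[_ ->]//|e]; split; first by rewrite dvdp_mull.
  by case=> // _.
have modE (h : {poly K}) : exists (Q : {poly K}) (x0 x1 : K), [/\ h = Q * g + (x0%:P + x1 *: 'X),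
    (h %% g)`_0 = x0 & (h %% g)`_1 = x1].
  exists (h %/ g), (h %% g)`_0, (h %% g)`_1; split=> //.
  rewrite {1}(divp_eq h g); congr (_ + _).
  have sm : (size (h %% g)%R <= 2)%N by rewrite -ltnS -sg ltn_modp.
  by rewrite {1}(linear_poly sm) addrC.
have fin mu : (forall h, mu h <-> z0 * (h %% g)`_0 + z1 * (h %% g)`_1 = 0) ->
    presented T R (exc_pred u mu).
  move=> hmu; exists psi; split=> // i p sp; rewrite /exc_pred; case: eqVneq => [ij|ij].
    subst i; split=> [e|[fp]].
      have hp : in_ker psi j p by [].
      have fp := hV p hp; split=> //; apply/hmu/hK; first by rewrite divpK.
      by rewrite divpK.
    by move/hmu/hK; rewrite divpK // => /(_ sp) [].
  case: (leqP (t i) i) => ti.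
    have [h1 h2] := hD i p ti ij; split=> [e|e]; first by have [] := h1 (conj sp e).
    by have [] := h2 (conj sp e).
  have e1 : t i = i.+1 by apply/eqP; rewrite eqn_leq tle.
  split=> h; first by rewrite (in_ker_full hpsi e1 (conj sp h)) dvdp0.
  by rewrite (roots_poly_dvd_small _ h) ?e1 // raddf0 mul0mx.
have [e01|n01] := eqVneq a0 a1.
  (* For [h] congruent to [x0 + x1 X] modulo [g], the value at [a0] is [x0 + a0 x1] and the
     derivative is [x1]; these coefficients express [z0 x0 + z1 x1] in them. *)
  exists z0, (z1 - a0 * z0); split.
    by case: (eqVneq z0 0) zz => //= ->; rewrite mulr0 subr0.
  apply: fin => h; rewrite /jet_pred; have [Q [x0 [x1 [hE e0 e1]]]] := modE h.
  have dX : ('X - a0%:P : {poly K})^`() = 1 by rewrite derivB derivX derivC subr0.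
  rewrite e0 e1 hE /g -e01 !derivD !derivM derivZ derivX derivC dX.
  rewrite !(hornerD, hornerM, hornerZ, hornerX, hornerN, hornerC) subrr.
  rewrite !(mul0r, mulr0, add0r, addr0, mulr1).
  by rewrite (_ : _ + _ = z0 * x0 + z1 * x1) //; ring.
have da : a1 - a0 != 0 by rewrite subr_eq0 eq_sym.
pose y := (z1 - z0 * a0) / (a1 - a0); exists (z0 - y), y; split.
  case: (eqVneq y 0) => [y0|]; last by rewrite orbT.
  move: zz; rewrite y0 subr0; case: eqVneq => //= z00; move: y0; rewrite /y z00 mul0r subr0.
  by move/eqP; rewrite mulf_eq0 invr_eq0 (negbTE da) orbF => ->.
apply: fin => h; rewrite /value_pred; have [Q [x0 [x1 [hE e0 e1]]]] := modE h.
rewrite e0 e1 hE /g !(hornerD, hornerM, hornerZ, hornerX, hornerN, hornerC) !subrr !(mul0r, mulr0) !add0r.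
rewrite (_ : _ + _ = z0 * x0 + z1 * x1) // /y; by field.
Qed.

End ExceptionalFinite.

Section ExceptionalFiniteType.
Local Open Scope ring_scope.
Variables (K : closedFieldType) (charK0 : [pchar K]%R =i pred0) (T : seq nat) (j : nat).
Local Notation t := (nth 0%N T).
Local Notation family := (forall i, 'M[K]_(i.+1, t i)).
Hypotheses (T0 : 0%N \notin T) (t1 : t 1 = 2%N).
Hypothesis tle : forall i, (t i <= i.+1)%N.
Local Notation b := (t j.+1).
Hypotheses (tj : t j = b.+1) (bj : (b < j)%N).
Hypothesis tD : forall i, (t i <= i)%N -> i != j -> (t i <= b.+2)%N.

Definition two_root_form (psi : family) (a0 a1 : K) : Prop :=
  (forall i (p : {poly K}), (t i <= i)%N -> i != j ->
     in_ker psi i p <-> (size p <= i.+1)%N /\ roots_poly (two_roots T j a0 a1) (t i) %| p) /\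
  (forall h : {poly K}, (size (h * roots_poly (two_roots T j a0 a1) b.+2)%R <= j.+1)%N ->
     in_ker psi j (h * roots_poly (two_roots T j a0 a1) b.+2)).

Let normal (a : (bool * bool) + bool) : nat -> {poly K} -> Prop :=
  match a with
  | inl (e, f) => exc_pred T j (two_roots T j 0 1) (value_pred 0 1 e%:R f%:R)
  | inr e => exc_pred T j (two_roots T j 0 0) (jet_pred 0 (~~ e)%:R e%:R)
  end.

(** Two flips are allowed because some of the roots to be made finite may be known only after the
    first. There are six normal forms: four choices of coefficients 0 or 1 at two points, and a pure
    value or a pure derivative at a double root. *)
Lemma exceptional_finite_type :
  (forall psi : family, hframe psi -> exists x y a0 a1, two_root_form (flip x (flip y psi)) a0 a1) ->
  homogeneous_finite_type K T.
Proof.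
move=> hyp; apply: (presented_finite_type T0 (W := normal)) => R sR hR.
have [psi0 hpsi0 pres0] := standard_graded_presents sR hR t1.
have [x [y [a0 [a1 [h1 h2]]]]] := hyp psi0 hpsi0.
have hpsi := flip_hframe x (flip_hframe y hpsi0).
have pres : presents R (flip x (flip y psi0)).
  by do 2!(apply: presents_subst; rewrite ?size_flip1 ?size_flip2 ?flip_det //).
have [z0 [z1 [zz pr]]] := exceptional_presented T0 tle tj bj hpsi pres h1 h2.
move: pr; have [<-|n01] := eqVneq a0 a1 => pr.
  by have [e he] := jet_normal_form charK0 T0 tle tj bj tD zz pr; exists (inr e).
by exists (inl (z0 != 0, z1 != 0)); apply: (value_normal_form T0 tle tj bj tD n01 pr).
Qed.

End ExceptionalFiniteType.

Section ExceptionalCases.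
Local Open Scope ring_scope.
Variables (K : closedFieldType) (charK0 : [pchar K]%R =i pred0) (T : seq nat) (j : nat).
Local Notation t := (nth 0%N T).
Local Notation family := (forall i, 'M[K]_(i.+1, t i)).
Hypotheses (T0 : 0%N \notin T) (t0 : t 0 != 0%N) (t1 : t 1 = 2%N).
Hypothesis tle : forall i, (t i <= i.+1)%N.

(** Sequences ending in [2, 1]: both roots come from the degrees before [j], and degree [j] adds one
    functional modulo their product. *)
Lemma two_drop_finite_type d : t j = 1%N -> t j.+1 = 0%N -> (2 <= d)%N -> t d = 2%N ->
  t j.-1 = 2%N -> (2 < j)%N -> d != j ->
  (forall i, (t i <= i)%N -> i != j -> [/\ stable T i, (t i <= 2)%N & (d <= i)%N]) ->
  homogeneous_finite_type K T.
Proof.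
move=> tj tjS d2 td2 tj1 j2 dj exc; have td : (t d <= d)%N by rewrite td2.
have b0 : t j.+1 = 0%N := tjS.
have tjb : t j = (t j.+1).+1 by rewrite tj b0.
apply: (@exceptional_finite_type K charK0 T j T0 t1 tle tjb); first by rewrite b0; lia.
  by move=> i ti ij; rewrite b0; have [] := exc i ti ij.
move=> psi0 hpsi0; have [p hp p0] := in_ker_exists (flip_hframe 0 hpsi0) td.
have [x px] := horner_neq0_nat charK0 hp.1 p0; exists x%:R, 0.
have hpsi := flip_hframe (x : nat)%:R (flip_hframe 0 hpsi0).
have good := flip_ker_inv (nat_of_ord x)%:R hp.
have [u [mu [_ [hu [hj _]]]]] : exists u (mu : nat -> K), (exists2 m, (m < 2 - t j.+1)%N & mu m != 0) /\
   (forall i (p : {poly K}), ((t i <= i)%N /\ i != j) \/ t i = i.+1 ->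
       in_ker (flip x%:R (flip 0 psi0)) i p <-> (size p <= i.+1)%N /\ roots_poly u (t i) %| p) /\
   (forall p : {poly K}, (size p <= j.+1)%N ->
      in_ker (flip x%:R (flip 0 psi0)) j p <-> roots_poly u (t j.+1) %| p /\
      \sum_(m < 2 - t j.+1) ((p %% roots_poly u 2) %/ roots_poly u (t j.+1))`_m * mu m = 0) /\
   (forall k, (2 <= k)%N -> u k = 0).
  apply: (exceptional_kernel T0 t0 (j := j) (c := 2) (r := 2) (d := d)) => //; rewrite ?b0 //.
  - exact: ltnW (leqW j2).
  - by move=> i [ti ij]; apply: exc.
  - by right; rewrite tj1; split; [exact: leq_trans j2|split=> //; lia].
  - by move=> _; exists d; split.
  by exists (hform (flip1 x%:R) (flip2 x%:R) d p) => //; exact: size_flip hp.1 px.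
exists (u 0%N), (u 1%N).
have ue k : (k <= 2)%N -> roots_poly (two_roots T j (u 0%N) (u 1%N)) k = roots_poly u k.
  move=> k2; apply: roots_poly_eq => m mk; rewrite /two_roots b0 leqn0.
  by case: m mk => [|[|m]] //= mk; have := leq_trans mk k2.
split=> [i q ti ij|h].
  by have [_ ti2 _] := exc i ti ij; rewrite ue // hu //; left.
rewrite b0 ue // => sh; apply/hj => //; rewrite b0 modp_mull div0p.
split; first by rewrite /roots_poly big_ord0 dvd1p.
by rewrite big1 // => m _; rewrite coef0 mul0r.
Qed.

Lemma in_ker_zero (psi : family) i (p : {poly K}) : hframe psi -> t i = 0%N -> (size p <= i.+1)%N -> in_ker psi i p.
Proof.
move=> hpsi ti sp; split=> //; have : \rank (psi i) == 0%N by rewrite hpsi.1 ti.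
by rewrite mxrank_eq0 => /eqP ->; rewrite mulmx0.
Qed.

Lemma quadratic_split (q : {poly K}) : size q = 3%N ->
  exists a0 a1 c, c != 0 /\ q = c *: (('X - a0%:P) * ('X - a1%:P)).
Proof.
move=> sq; have [r qE] := closed_field_poly_normal q.
have l0 : lead_coef q != 0 by rewrite lead_coef_eq0 -size_poly_gt0 sq.
have : size q = (size r).+1 by rewrite {1}qE size_scale // size_prod_XsubC.
rewrite sq => -[sr]; case: r sr qE => [|a0 [|a1 []]] // _ qE.
by exists a0, a1, (lead_coef q); split=> //; rewrite {1}qE !big_cons big_nil mulr1.
Qed.

(* A functional on the quadratic or cubic forms vanishes on the multiples of some
   quadratic form, since this imposes at most two conditions on its coefficients. *)
Lemma one_drop_finite_type : (1 < j <= 3)%N -> (forall i, (i < j)%N -> t i = i.+1) ->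
  t j = 1%N -> (forall i, (j < i)%N -> t i = 0%N) -> homogeneous_finite_type K T.
Proof.
move=> /andP[j1 j3] low tj high; have b0 : t j.+1 = 0%N by apply: high.
have tjb : t j = (t j.+1).+1 by rewrite tj b0.
have big i : (t i <= i)%N -> i != j -> t i = 0%N.
  move=> ti ij; apply: high; rewrite ltn_neqAle eq_sym ij /= leqNgt.
  by apply: contraL ti => /low ->; rewrite ltnn.
apply: (@exceptional_finite_type K charK0 T j T0 t1 tle tjb); first by rewrite b0; lia.
  by move=> i ti ij; rewrite big.
move=> psi0 hpsi0; have hpsi := flip_hframe 0 hpsi0; set psi := flip 0 psi0 in hpsi *.
have [|||||Z [hZ _]] := @exceptional_structure K T psi hpsi (fun=> 0) j 0 j.+1 => //.
- by move=> p _; rewrite /roots_poly big_ord0 dvd1p.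
- move=> h; have [->|h0] := eqVneq h 0; first by rewrite mul0r; split; rewrite ?size_poly0 // raddf0 mul0mx.
  rewrite size_Mmonic ?roots_poly_monic // size_roots_poly => sh; exfalso.
  by move: h0; rewrite -size_poly_gt0; move: (size h) sh => s; lia.
pose mu m := Z m 0%N; pose Lam (p : {poly K}) := \sum_(m < j.+1) p`_m * mu m.
have kerL (p : {poly K}) : (size p <= j.+1)%N -> in_ker psi j p <-> Lam p = 0.
  move=> sp; rewrite hZ // subn0 tj modp_small ?size_roots_poly // /roots_poly big_ord0 divp1.
  split=> [[_ h]|h]; first exact: h.
  by split=> [|[|l]] //; rewrite dvd1p.
have LamX s : (s <= j)%N -> Lam 'X^s = mu s.
  move=> sj; rewrite /Lam (bigD1 (Ordinal (sj : (s < j.+1)%N))) //= coefXn eqxx mul1r big1 ?addr0 // => m.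
  by rewrite -val_eqE /= coefXn => /negbTE ->; rewrite mul0r.
have Lam_sum n (c : 'I_n -> K) (F : 'I_n -> {poly K}) : Lam (\sum_k c k *: F k) = \sum_k c k * Lam (F k).
  rewrite /Lam; under [RHS]eq_bigr => k _ do rewrite mulr_sumr.
  rewrite exchange_big; apply: eq_bigr => m _; rewrite coef_sum mulr_suml.
  by apply: eq_bigr => k _; rewrite coefZ mulrA.
(* A catalecticant (Hankel) matrix with three rows and at most two columns, hence with a nonzero
   left kernel; a vector there is a quadratic form whose multiples in degree [j] are all killed by
   [Lam]. *)
pose A : 'M[K]_(3, j.-1) := \matrix_(m, k) mu (m + k)%N.
have : kermx A != 0.
  rewrite -mxrank_eq0 mxrank_ker; have := rank_leq_col A; move: (\rank A) => r rj.
  by rewrite subn_eq0 -ltnNge; lia.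
case/rowV0Pn => v /sub_kermxP vA v0.
pose q : {poly K} := rVpoly v.
have sq : (size q <= 3)%N by exact: size_poly.
have q0 : q != 0.
  by apply: contraNneq v0 => q0; rewrite -[v]rVpolyK -/q q0 linear0.
have hq (h : {poly K}) : (size h <= j.-1)%N -> in_ker psi j (h * q).
  apply: multiples_in_ker; first by move: (size q) sq => s; lia.
  move=> k kj; apply/kerL.
    rewrite (leq_trans (size_polyMleq _ _)) // size_polyXn.
    by move: (size q) sq => s; lia.
  have -> : 'X^k * q = \sum_(m < 3) v 0 m *: 'X^(m + k).
    rewrite {1}(poly_sumXn sq) mulr_sumr; apply: eq_bigr => m _.
    by rewrite -scalerAr -exprD addnC /q coef_rVpoly_ord.
  rewrite Lam_sum.
  have := congr1 (fun B : 'rV[K]_(j.-1) => B 0 (Ordinal kj)) vA; rewrite !mxE => e.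
  rewrite -[RHS]e; apply: eq_bigr => m _; rewrite mxE LamX //=.
  by have := ltn_ord m; move: (nat_of_ord m) => m'; lia.
(* A second flip gives the quadratic form full size, so that both of its roots are finite. *)
have [x qx] := horner_neq0_nat charK0 sq q0.
have sq' := size_flip sq qx; set q' := hform _ _ _ _ in sq'.
have [a0 [a1 [c [c0 qE]]]] := quadratic_split sq'.
exists x%:R, 0, a0, a1; split=> [i p ti ij|h].
  have ti0 := big i ti ij; rewrite ti0 /roots_poly big_ord0; split=> [[sp _]|[sp _]].
    by rewrite dvd1p.
  by apply: in_ker_zero => //; apply: flip_hframe.
have f2 : roots_poly (two_roots T j a0 a1) 2 = c^-1 *: q'.
  rewrite qE scalerA mulVf // scale1r !roots_polyS /two_roots b0 /=.
  by rewrite /roots_poly big_ord0 mul1r.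
have [->|h0] := eqVneq h 0; first by rewrite mul0r; split; rewrite ?size_poly0 // raddf0 mul0mx.
rewrite size_Mmonic ?roots_poly_monic // size_roots_poly b0 => sh.
have sh' : (size h <= (j - 2).+1)%N by move: (size h) sh => s; lia.
rewrite f2 -scalerAr; apply: in_kerZ; apply/flip_ker.
  rewrite (leq_trans (size_polyMleq _ _)) // sq'; by move: (size h) sh => s; lia.
rewrite -{2}(subnK j1) hformM ?sq' //; last exact: mulrC.
rewrite /q' flipK //; apply: hq; have := size_hform (j - 2) h (size_flip1 x%:R) (size_flip2 x%:R).
by move: (size _) => s; lia.
Qed.

End ExceptionalCases.

Section LinearDrop.
Local Open Scope ring_scope.
Variables (K : closedFieldType) (charK0 : [pchar K]%R =i pred0) (T : seq nat).
Local Notation t := (nth 0%N T).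
Local Notation family := (forall i, 'M[K]_(i.+1, t i)).
Hypotheses (T0 : 0%N \notin T) (t1 : t 1 = 2%N).
Hypothesis tle : forall i, (t i <= i.+1)%N.

Lemma linear_split (p : {poly K}) : size p = 2%N -> exists a c, c != 0 /\ p = c *: ('X - a%:P).
Proof.
move=> sp; have [r pE] := closed_field_poly_normal p.
have l0 : lead_coef p != 0 by rewrite lead_coef_eq0 -size_poly_gt0 sp.
have : size p = (size r).+1 by rewrite {1}pE size_scale // size_prod_XsubC.
rewrite sp => -[sr]; case: r sr pE => [|a []] // _ pE.
by exists a, (lead_coef p); split=> //; rewrite {1}pE big_cons big_nil mulr1.
Qed.

Lemma hform_exp (L1 L2 : {poly K}) (p : {poly K}) k : (size p <= 2)%N ->
  hform L1 L2 k (p ^+ k) = hform L1 L2 1 p ^+ k.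
Proof.
move=> sp; elim: k => [|k IH]; first by rewrite !expr0 hform1.
by rewrite !exprS -add1n hformM ?IH ?(coefX_top k sp).2 //; exact: mulrC.
Qed.

(* V_3 lies in l R_2, and meets l^2 R_1 for dimension reasons. *)
Lemma linear_drop_finite_type : (forall i, (i < 3)%N -> t i = i.+1) -> t 3 = 2%N -> t 4 = 1%N ->
  (forall i, (4 <= i)%N -> stable T i /\ (t i <= 1)%N) -> homogeneous_finite_type K T.
Proof.
move=> low t3 t4 high; have tjb : t 3 = (t 4).+1 by rewrite t3 t4.
have D4 i : (t i <= i)%N -> i != 3%N -> (4 <= i)%N.
  by case: (ltnP i 3) => [/low ->|]; [rewrite ltnn|case: i => [|[|[|[|i]]]]].
apply: (@exceptional_finite_type K charK0 T 3 T0 t1 tle tjb); first by rewrite t4.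
  by move=> i ti i3; rewrite t4; have [_ h] := high i (D4 i ti i3); apply: leq_trans h _.
move=> psi0 hpsi0; have t44 : (t 4 <= 4)%N by rewrite t4.
have [p hp p0] := in_ker_exists hpsi0 t44.
have [y py] := horner_neq0_nat charK0 hp.1 p0.
have hpsi := flip_hframe (y : nat)%:R hpsi0; set psi := flip y%:R psi0 in hpsi *.
have dD i : (4 <= i)%N -> (t i <= i)%N.
  by move=> i4; have [_ h] := high i i4; apply: leq_trans h _; apply: leq_trans i4.
have [u hu] := @exact_roots K T psi hpsi (fun i => 4 <= i)%N (fun i i4 =>
   And3 (dD i i4) (high i i4).1 (good_degree hpsi (flip_ker_inv (nat_of_ord y)%:R hp) (size_flip hp.1 py) i4)).
pose l : {poly K} := 'X - (u 0%N)%:P.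
have rl : roots_poly u 1 = l by rewrite roots_polyS /roots_poly big_ord0 mul1r.
have sl : size l = 2%N by rewrite size_XsubC.
have l0 : l != 0 by rewrite polyXsubC_eq0.
have hu4 (q : {poly K}) : in_ker psi 4 q <-> (size q <= 5)%N /\ l %| q.
  by rewrite hu ?t4 ?rl //; left.
have [|||||Z [hZ _]] := @exceptional_structure K T psi hpsi u 3 1 4; rewrite ?t3 //.
- by move=> q /(in_kerS hpsi) /hu4 []; rewrite rl.
- move=> h; have [->|h0] := eqVneq h 0; first by rewrite mul0r; split; rewrite ?size_poly0 // raddf0 mul0mx.
  rewrite size_Mmonic ?roots_poly_monic // size_roots_poly => sh; exfalso.
  by move: h0; rewrite -size_poly_gt0; move: (size h) sh => s; lia.
pose Lam (q : {poly K}) := \sum_(m < 3) q`_m * Z m 0%N.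
have kerL (q : {poly K}) : (size q <= 3)%N -> Lam q = 0 -> in_ker psi 3 (q * l).
  move=> sq Lq; have sql : (size (q * l)%R <= 4)%N.
    by rewrite (leq_trans (size_polyMleq _ _)) // sl; move: (size q) sq => s; lia.
  rewrite hZ // rl dvdp_mull //; split=> //.
  by rewrite t3 modp_small ?size_roots_poly // mulpK //; case.
have Lam_lin (a b : K) (q r : {poly K}) : Lam (a *: q + b *: r) = a * Lam q + b * Lam r.
  rewrite /Lam !mulr_sumr -big_split; apply: eq_bigr => m _.
  by rewrite coefD !coefZ /=; ring.
(* A nonzero solution among the linear forms of the single linear equation [Lam (h l) = 0]. *)
pose h : {poly K} := if Lam l == 0 then 1 else (Lam ('X * l))%:P - Lam l *: 'X.
have sh : (size h <= 2)%N.
  rewrite /h; case: ifP => _; first by rewrite size_poly1.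
  rewrite (leq_trans (size_polyD _ _)) // size_polyN geq_max (leq_trans (size_polyC_leq1 _)) //=.
  by rewrite (leq_trans (size_scale_leq _ _)) // size_polyX.
have h0 : h != 0.
  rewrite /h; have [_|n0] := eqVneq (Lam l) 0; first by rewrite -size_poly_gt0 size_poly1.
  apply: contraNneq n0 => /(congr1 (fun q : {poly K} => q`_1)).
  by rewrite coefB coefC coefZ coefX coef0 mulr1 /= sub0r => /eqP; rewrite oppr_eq0.
have hker : in_ker psi 3 (h * l * l).
  apply: kerL; first by rewrite (leq_trans (size_polyMleq _ _)) // sl; move: (size h) sh => s; lia.
  rewrite /h; have [e|_] := eqVneq (Lam l) 0; first by rewrite mul1r.
  rewrite mulrBl mul_polyC -scalerAl -scaleNr Lam_lin; ring.
have hl0 : h * l * l != 0 by rewrite !mulf_neq0.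
(* The second flip is at a point where neither [h] nor [l] vanishes, so that both roots become
   finite. *)
have [x] := horner_neq0_nat charK0 hker.1 hl0.
rewrite !hornerM !mulf_eq0 !negb_or => /andP[/andP[hx lx] _].
exists x%:R, y%:R; rewrite -/psi.
pose L1 : {poly K} := flip1 (x : nat)%:R; pose L2 : {poly K} := flip2 (x : nat)%:R.
have [a0 [c0 [c00 lE]]] := linear_split (size_flip (eq_leq sl) lx).
have [a1 [c1 [c10 hE]]] := linear_split (size_flip sh hx).
exists a0, a1; rewrite -/L1 -/L2 in lE hE.
have hpsi2 := flip_hframe (x : nat)%:R hpsi.
(* A power of [l] supplies a form of full size in degree 4 after the second flip, as needed to
   recover the root there. *)
have l4 : in_ker psi 4 (l ^+ 4).
  by apply/hu4; rewrite exprS dvdp_mulr // -exprS; split=> //; have [] := coefX_top 4 (eq_leq sl).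
have l4x : (l ^+ 4).[x%:R] != 0 by rewrite horner_exp expf_eq0.
have good2 := flip_ker_inv (nat_of_ord x)%:R l4.
have [u2 hu2] := @exact_roots K T _ hpsi2 (fun i => 4 <= i)%N (fun i i4 =>
   And3 (dD i i4) (high i i4).1 (good_degree hpsi2 good2 (size_flip l4.1 l4x) i4)).
have u2a : u2 0%N = a0.
  have := (hu2 4 _ (or_introl isT)).1 good2; rewrite t4 roots_polyS /roots_poly big_ord0 mul1r => -[_].
  rewrite -/L1 -/L2 hform_exp ?sl // lE dvdp_XsubCl rootE horner_exp expf_eq0 /=.
  by rewrite hornerZ mulf_eq0 (negbTE c00) !hornerE subr_eq0 => /eqP.
split=> [i q ti i3|g].
  have i4 := D4 i ti i3; rewrite hu2; last by left.
  rewrite (@roots_poly_eq _ (two_roots T 3 a0 a1) u2) // => k.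
  have [_ ti1] := high i i4; move=> kt; have : (k < 1)%N := leq_trans kt ti1.
  by rewrite ltnS leqn0 => /eqP ->; rewrite u2a.
(* Here [b = 1], so [two_roots] takes the value [a0] twice, and the cubic is the transform of
   [h l^2] up to a scalar. *)
rewrite t4; have -> : roots_poly (two_roots T 3 a0 a1) 3 = (c1 * c0 * c0)^-1 *: hform L1 L2 3 (h * l * l).
  rewrite -[3%N]/((1 + 1) + 1)%N !hformM ?sl //; try exact: mulrC.
    rewrite lE hE -!scalerAl -!scalerAr -!scalerAl !scalerA.
    have -> : (c1 * c0 * c0)^-1 * c1 * c0 * c0 = 1 by field; rewrite c00 c10.
    rewrite scale1r !roots_polyS /roots_poly big_ord0 mul1r /two_roots t4 /=; ring.
  by rewrite (leq_trans (size_polyMleq _ _)) // sl; move: (size h) sh => s; lia.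
set f3 := hform _ _ _ _; have sf3 : size f3 = 4%N.
  by apply: size_flip; [exact: hker.1|rewrite !hornerM !mulf_neq0].
have cc : (c1 * c0 * c0)^-1 != 0 by rewrite invr_eq0 !mulf_neq0.
have [->|g0] := eqVneq g 0; first by rewrite mul0r; split; rewrite ?size_poly0 // raddf0 mul0mx.
rewrite size_mul // ?scaler_eq0 ?(negbTE cc) -?size_poly_eq0 ?sf3 // size_scale // sf3 => sg.
have /size1_polyC -> : (size g <= 1)%N by move: (size g) sg => s; lia.
by rewrite mul_polyC scalerA; apply: in_kerZ; apply: flip_ker_inv.
Qed.

End LinearDrop.

(** * The listed sequences sorted by the argument they need *)

Section ProfileFacts.
Variables (d a b c : nat).
Hypotheses (d2 : 2 <= d) (a3 : 0 < a -> 3 <= d).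
Local Notation T := (profile d a b c).
Local Notation t := (nth 0 T).

Lemma profile_pos : 0 \notin T.
Proof.
by rewrite !mem_cat mem_iota !mem_nseq; rewrite !andbF.
Qed.

Lemma profile_head : t 0 != 0.
Proof. by rewrite nth_profile ifT //; lia. Qed.

Lemma profile_t1 : t 1 = 2.
Proof. by rewrite nth_profile d2. Qed.

Lemma profile_shape i : t i.+1 <= t i \/ t i = i.+1.
Proof. by rewrite !nth_profile; repeat (case: ifP => ?); lia. Qed.

Lemma profile_le i : t i <= i.+1.
Proof. by rewrite !nth_profile; repeat (case: ifP => ?); lia. Qed.

Lemma stableI i : t i.+1 = t i \/ 0 < i /\ t i.-1 = t i -> stable T i.
Proof. by case=> [e|[i0 e]]; [left|right; exists i.-1; rewrite ?prednK]. Qed.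

(** The conditions exclude degrees with a drop on both sides: a single 3, 2 or 1, unless it prolongs
    the last value of the rise. *)
Lemma profile_tame : (a = 1 -> d = 3) -> (b = 1 -> a = 0 /\ d = 2) -> c != 1 ->
  forall i, t i <= i -> [/\ stable T i, t i <= t d & d <= i].
Proof.
move=> a1 b1 c1 i ti; split; first apply: stableI; move: ti; rewrite !nth_profile;
  repeat (case: ifP => ?); lia.
Qed.

Lemma profile_two_drop : a = 0 -> b != 0 -> (b = 1 -> d = 2) -> c = 1 ->
  forall i, t i <= i -> i != d + b -> [/\ stable T i, t i <= 2 & d <= i].
Proof.
move=> a0 b0 b1 c1 i ti ij; split; first apply: stableI; move: ti; rewrite !nth_profile;
  repeat (case: ifP => ?); lia.
Qed.

End ProfileFacts.

(** Here the rise is taken maximal, which the list itself does not require: 2's after [n = 1] or 3's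
    after [n = 2] continue the rise by one step. *)
Variant listed_class (T : seq nat) (n : nat) : Prop :=
| ListedTame d a b c of T = profile d a b c & 2 <= d & 0 < a -> 3 <= d & a = 1 -> d = 3
    & b = 1 -> a = 0 /\ d = 2 & c != 1 & n = nth 0 T d & n <= 3
| ListedOneDrop d of T = profile d 0 0 1 & 2 <= d <= 3 & n = d
| ListedLinearDrop c of T = profile 3 0 1 c & 2 <= c & n = 3
| ListedTwoDrop d b of T = profile d 0 b 1 & 2 <= d & 1 <= b & b = 1 -> d = 2 & n = 3.

Lemma listed_classification T n : listed T n -> listed_class T n.
Proof.
have tame d a b c m T' : T' = profile d a b c -> 2 <= d -> (0 < a -> 3 <= d) -> (a = 1 -> d = 3) ->
    (b = 1 -> a = 0 /\ d = 2) -> c != 1 ->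
    m = (if 0 < a then 3 else if 0 < b then 2 else (0 < c : nat)) -> listed_class T' m.
  move=> -> d2 a3 a1 b1 c1 ->; apply: ListedTame => //; first by rewrite nth_profile; repeat (case: ifP => ?); lia.
  by repeat (case: ifP => ?); lia.
case=> {T n}.
- by move=> n n2; apply: (@tame n 0 0 0); rewrite // /profile /= cats0.
- exact: (@ListedOneDrop _ _ 2).
- exact: (@ListedOneDrop _ _ 3).
- by move=> k k1; apply: (@ListedLinearDrop _ _ k.+1).
- by move=> n k n2 k1; apply: (@tame n 0 0 k.+1) => //; lia.
- move=> n k n1 k1; case: n n1 => [|[|n]] // _; last first.
    by apply: (@tame n.+2 0 k.+1 0) => //; [rewrite /profile /= cats0|lia].
  by case: k k1 => // k _; apply: (@tame 2 0 k.+1 0) => //; rewrite /profile /= cats0.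
- move=> n k l n1 k1 l1; case: n n1 => [|[|n]] // _; case: k k1 => // k _; case: eqVneq => [->|l1'].
  + by apply: (@ListedTwoDrop _ _ 2 k.+1).
  + by apply: (@tame 2 0 k.+1 l).
  + by apply: (@ListedTwoDrop _ _ n.+2 k.+2).
  by apply: (@tame n.+2 0 k.+2 l).
- move=> n k n2 k1; case: n n2 => [|[|[|n]]] // _; last first.
    by apply: (@tame n.+3 k.+1 0 0) => //; [rewrite /profile /= cats0|lia].
  by case: k k1 => // k _; apply: (@tame 3 k.+1 0 0) => //; rewrite /profile /= cats0.
- move=> n k l n2 k1 l2; case: n n2 => [|[|[|n]]] // _; last first.
    by apply: (@tame n.+3 k.+1 0 l) => //; lia.
  by case: k k1 => // k _; apply: (@tame 3 k.+1 0 l) => //; lia.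
- move=> n k l n2 k1 l2; case: n n2 => [|[|[|n]]] // _; last first.
    by apply: (@tame n.+3 k.+1 l 0) => //; [rewrite /profile /= cats0|lia|lia].
  by case: k k1 => // k _; apply: (@tame 3 k.+1 l 0) => //; [rewrite /profile /= cats0|lia].
move=> n k l s n2 k1 l2 s2; case: n n2 => [|[|[|n]]] // _; last first.
  by apply: (@tame n.+3 k.+1 l s) => //; lia.
by case: k k1 => // k _; apply: (@tame 3 k.+1 l s) => //; lia.
Qed.

Section Main.
Variables (K : closedFieldType) (charK0 : [pchar K]%R =i pred0).

Ltac profile_lia := rewrite ?nth_profile; repeat (case: ifP => ?); lia.

Lemma listed_finite_type T n : listed T n -> homogeneous_finite_type K T.
Proof.
case/listed_classification.
- move=> d a b c -> d2 a3 a1 b1 c1 -> n3.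
  have td : nth 0 (profile d a b c) d <= d by profile_lia.
  apply: (tame_finite_type charK0 _ _ td n3) (profile_tame d2 a3 a1 b1 c1).
  + exact: profile_pos.
  + exact: profile_t1.
  exact: profile_le.
- move=> d -> /andP[d2 d3] _.
  apply: (one_drop_finite_type charK0 (j := d)).
  + exact: profile_pos.
  + exact: profile_head.
  + exact: profile_t1.
  + by apply: profile_le.
  + by rewrite d2.
  + by move=> i id; rewrite nth_profile id.
  + by profile_lia.
  by move=> i id; profile_lia.
- move=> c -> c2 _.
  apply: (linear_drop_finite_type charK0).
  + exact: profile_pos.
  + exact: profile_t1.
  + by apply: profile_le.
  + by move=> i id; rewrite nth_profile id.
  + by [].
  + by case: c c2.
  by move=> i i4; split; first (apply: stableI); profile_lia.
move=> d b -> d2 b1 b1d _.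
apply: (@two_drop_finite_type K charK0 (profile d 0 b 1) (d + b) _ _ _ _ d) => //.
- exact: profile_pos.
- exact: profile_head.
- exact: profile_t1.
- by apply: profile_le.
- by profile_lia.
- by profile_lia.
- by profile_lia.
- by profile_lia.
- by lia.
- by lia.
by apply: profile_two_drop => //; lia.
Qed.

(** The dimension is the number of free roots plus, if there is an exceptional degree, the dimension
    [c - b - 1] of its projective space of functionals. *)
Lemma listed_dim T n : listed T n -> dim_G_eq K T n.
Proof.
case/listed_classification.
- move=> d a b c -> d2 a3 a1 b1 c1 -> n3.
  have td : nth 0 (profile d a b c) d <= d by profile_lia.
  apply: (tame_dim charK0 _ _ _ _ td) (profile_tame d2 a3 a1 b1 c1).
  + exact: profile_pos.
  + exact: profile_head.
  + exact: profile_shape.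
  exact: profile_le.
- move=> d -> /andP[d2 d3] ->.
  have tS : nth 0 (profile d 0 0 1) d.+1 = 0 by profile_lia.
  (* There are no roots: the ideal amounts to a hyperplane in the forms of degree [d], a point of a
     projective space of dimension [d]. *)
  rewrite -[X in dim_G_eq _ _ X](_ : (d.+1 - nth 0 (profile d 0 0 1) d.+1).-1 + 0 = d); last by rewrite tS; lia.
  apply: (@exceptional_dim K charK0 (profile d 0 0 1) _ _ _ _ d d.+1 0 d.+1); rewrite ?tS //.
  + exact: profile_pos.
  + exact: profile_head.
  + by apply: profile_shape.
  + by apply: profile_le.
  + by profile_lia.
  + by rewrite gtn_eqF.
  + move=> i [ti ij]; split; first (apply: stableI); move: ti; profile_lia.
  + by left.
  by move=> i <-; right; rewrite nth_profile ltnSn.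
- move=> c -> c2 ->.
  have tS : nth 0 (profile 3 0 1 c) 4 = 1 by profile_lia.
  rewrite -[X in dim_G_eq _ _ X](_ : (4 - nth 0 (profile 3 0 1 c) 4).-1 + 1 = 3); last by rewrite tS.
  apply: (@exceptional_dim K charK0 (profile 3 0 1 c) _ _ _ _ 3 4 1 4); rewrite ?tS //.
  + exact: profile_pos.
  + by apply: profile_shape.
  + by apply: profile_le.
  + move=> i [ti ij]; split; first (apply: stableI); move: ti; profile_lia.
  + by left.
  + by move=> _; exists 4; rewrite tS.
  by move=> i [->]; right.
move=> d b -> d2 b1 b1d ->.
have tS : nth 0 (profile d 0 b 1) (d + b).+1 = 0 by profile_lia.
have td : nth 0 (profile d 0 b 1) d = 2 by profile_lia.
rewrite -[X in dim_G_eq _ _ X](_ : (2 - nth 0 (profile d 0 b 1) (d + b).+1).-1 + 2 = 3); last by rewrite tS.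
apply: (@exceptional_dim K charK0 (profile d 0 b 1) _ _ _ _ (d + b) 2 2 d); rewrite ?tS //.
- exact: profile_pos.
- exact: profile_head.
- by apply: profile_shape.
- by apply: profile_le.
- by profile_lia.
- by lia.
- by split; rewrite ?td; lia.
- by move=> i [ti ij]; apply: profile_two_drop => //; lia.
- by right; split; [lia|split; [profile_lia|lia]].
- by move=> _; exists d; rewrite td; split=> //; lia.
by move=> i e; left; move: e; profile_lia.
Qed.

End Main.

Unset Implicit Arguments.

Theorem theorem1 (K : closedFieldType) (charK0 : [pchar K]%R =i pred0) :
  (forall T : seq nat,
     HilbertSamuel_sequence K T -> nth 0 T 1 = 2 ->
     (homogeneous_finite_type K T <-> exists d, listed T d)) /\
  (forall (T : seq nat) (d : nat), listed T d -> dim_G_eq K T d).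
Proof.
split=> [T HS t1|T d]; last exact: listed_dim.
split=> [|[d]]; last exact: listed_finite_type.
exact: finite_type_listed.
Qed.
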